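(* Suppose the noise is super smooth with parameters $\nu_0,\nu_1,d_0,d_1,\delta,\beta$ (Assumption 2 of the context). Let $s\ge1/2$, $R>0$ and $\psi_N=(\log N)^{-2s/\beta}$. There is a constant $K>0$ depending only on $d_0,d_1,\nu_0,\beta,\delta,s$ such that, if $\mathcal{C}\le KR^2$ (with $\mathcal C>0$), then $$\liminf_{N\to\infty}\ \inf_{\Delta_N}\left\{\mathbb{P}_{f_0}(\Delta_N=1)+\sup_{f\in H_1(s,R,\mathcal{C}\psi_N)}\mathbb{P}_f(\Delta_N=0)\right\}\ \ge\ 1,$$ where the infimum is taken over all test procedures $\Delta_N$ (that is, $\{0,1\}$-valued measurable functions) based on the observations $Z_1,\dots,Z_N$.
   Context: Model. $\mathbb{S}^2$ is the unit sphere of $\mathbb{R}^3$ with its surface (Lebesgue) measure $dx$ of total mass $4\pi$; $\|\cdot\|_2$ is the norm of $\mathbb{L}_2(\mathbb{S}^2)$. One observes $Z_i=\varepsilon_iX_i$, $i=1,\dots,N$, where the $\varepsilon_i$ are i.i.d. random rotations in $SO(3)$ with known density $f_\varepsilon$ with respect to the probability Haar measure, the $X_i$ are i.i.d. random variables on $\mathbb{S}^2$ with unknown density $f$ with respect to $dx$, and the $X_i$ are independent of the $\varepsilon_i$. The density of $Z_i$ is $f_Z=f_\varepsilon*f$, where $f_\varepsilon*f(\omega)=\int_{SO(3)}f_\varepsilon(u)f(u^{-1}\omega)\,du$. $\mathbb{P}_f$ denotes the probability when the $X_i$ have density $f$. The uniform density is $f_0=(4\pi)^{-1}\mathbf{1}_{\mathbb{S}^2}$.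 Fourier analysis. $(Y^l_m)_{l\ge0,\,-l\le m\le l}$ is the usual complex orthonormal basis of spherical harmonics of $\mathbb{L}_2(\mathbb{S}^2)$. For $f\in\mathbb{L}_2(\mathbb{S}^2)$, $f^{\star l}_m=\int_{\mathbb{S}^2}f(x)\overline{Y^l_m(x)}\,dx$. The rotational harmonics $D^l_{mn}$ on $SO(3)$ ($-l\le m,n\le l$) are the matrix coefficients with $\overline{Y^l_m(gx)}=\sum_{n=-l}^l D^l_{mn}(g)\overline{Y^l_n(x)}$. The rotational Fourier transform of $f_\varepsilon$ at order $l$ is the $(2l+1)\times(2l+1)$ matrix $f_\varepsilon^{\star l}$ with entries $(f_\varepsilon^{\star l})_{mn}=\int_{SO(3)}f_\varepsilon(g)D^l_{mn}(g)\,dg$, so that $(f_\varepsilon*f)^{\star l}=f_\varepsilon^{\star l}f^{\star l}$. $\|\cdot\|_{op}$ is the operator norm associated with the Euclidean norm. Assumption 2 (super smooth noise). For all $l\ge0$ the matrix $f_\varepsilon^{\star l}$ is invertible, with inverse denoted $f^{\star l}_{\varepsilon^{-1}}$, and there exist reals $\nu_1\le\nu_0$ and positive constants $d_0,d_1,\delta,\beta$ such that for all $l\ge1$: $\|f^{\star l}_{\varepsilon^{-1}}\|_{op}\le d_0^{-1}l^{-\nu_0}\exp(l^\beta/\delta)$ and $\|f^{\star l}_{\varepsilon}\|_{op}\le d_1l^{\nu_1}\exp(-l^\beta/\delta)$. Sobolev classes and alternatives. $\|f\|_{W_s}^2=\sum_{l\ge0}\sum_{m=-l}^l(1+l(l+1))^s|f^{\star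 l}_m|^2$; $W_s(\mathbb{S}^2)$ is the completion of $C^\infty(\mathbb{S}^2)$ for this norm; for $R>0$, $W_s(\mathbb{S}^2,R)$ is the set of probability densities $f\in W_s(\mathbb{S}^2)$ with $\|f\|_{W_s}^2\le\frac1{4\pi}+R^2$. $H_1(s,R,\rho)$ is the set of $f\in W_s(\mathbb{S}^2,R)$ with $\|f-f_0\|_2^2\ge\rho$. A supremum of probabilities over an empty set is taken to be $0$. *)

(* Defs.v *)
From HB Require Import structures.
From mathcomp Require Import all_boot all_order all_algebra.
From mathcomp Require Import complex.
From mathcomp Require Import all_classical all_reals all_analysis.
From mathcomp Require Import measurable_realfun.

Set Implicit Arguments.
Unset Strict Implicit.
Unset Printing Implicit Defensive.

Import Order.TTheory GRing.Theory Num.Theory.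
Import numFieldNormedType.Exports.

Local Open Scope classical_set_scope.
Local Open Scope ring_scope.

Definition matrix_display : measure_display.
Proof. exact. Qed.

(* Real matrices, hence column vectors, carry the sigma-algebra generated by
   their entries, which is the Borel sigma-algebra. *)
Section MeasurableMatrix.
Variables (R : realType) (m n : nat).

Definition entry_sets : set (set 'M[R]_(m, n)) :=
  \bigcup_(p in [set: 'I_m * 'I_n])
    preimage_set_system setT (fun M : 'M[R]_(m, n) => M p.1 p.2) measurable.

HB.instance Definition _ := @isMeasurable.Build matrix_display 'M[R]_(m, n)
  <<s entry_sets >> (@sigma_algebra0 _ setT entry_sets)
  (@sigma_algebraC _ entry_sets) (@sigma_algebra_bigcup _ setT entry_sets).

Lemma measurable_entry (i : 'I_m) (j : 'I_n) :
  measurable_fun setT (fun M : 'M[R]_(m, n) => M i j).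
Proof.
by move=> _ Y mY; apply: sub_sigma_algebra; exists (i, j) => //; exists Y.
Qed.

Lemma measurable_fun_matrixP d (T : measurableType d) (f : T -> 'M[R]_(m, n)) :
  measurable_fun setT f <->
  forall i j, measurable_fun setT (fun t => f t i j).
Proof.
split=> [mf i j|mf].
  exact: (measurableT_comp (measurable_entry i j) mf).
apply: (@measurability _ _ _ _ _ _ entry_sets) => //.
move=> _ [_ [[i j] _ [Y mY <-]] <-]; rewrite !setTI /=.
have := mf i j measurableT Y mY; rewrite setTI; exact.
Qed.

End MeasurableMatrix.

Section SphereMeasure.
Context {R : realType}.

Definition sphere : set 'cV[R]_3 := [set x | \sum_(i < 3) x i 0 ^+ 2 = 1].

(* p = (theta, phi): colatitude in [0, pi] and longitude in [0, 2 pi[ *)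
Definition sphere_pt (p : R * R) : 'cV[R]_3 :=
  \col_(i < 3) [:: sin p.1 * cos p.2; sin p.1 * sin p.2; cos p.1]`_i.

Definition angles : set (R * R) := `[0, pi] `*` `[0, 2 * pi[.

(* The surface measure, of element sin(theta) dtheta dphi, seen as a measure on
   R^3 concentrated on the sphere. *)
Definition sphere_measure (A : set 'cV[R]_3) : \bar R :=
  (\int[lebesgue_measure \x lebesgue_measure]_(p in angles `&` sphere_pt @^-1` A)
     (sin p.1)%:E)%E.

Lemma measurable_sphere_pt : measurable_fun setT sphere_pt.
Proof.
have msin1 : measurable_fun setT (fun p : R * R => sin p.1).
  by apply: measurableT_comp => //; apply: continuous_measurable_fun;
     exact: continuous_sin.
have msin2 : measurable_fun setT (fun p : R * R => sin p.2).
  by apply: measurableT_comp => //; apply: continuous_measurable_fun;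
     exact: continuous_sin.
have mcos1 : measurable_fun setT (fun p : R * R => cos p.1).
  by apply: measurableT_comp => //; apply: continuous_measurable_fun;
     exact: continuous_cos.
have mcos2 : measurable_fun setT (fun p : R * R => cos p.2).
  by apply: measurableT_comp => //; apply: continuous_measurable_fun;
     exact: continuous_cos.
apply/measurable_fun_matrixP => i j.
under eq_fun do rewrite mxE.
case: i => [[|[|[|//]]] /= _].
- exact: measurable_funM.
- exact: measurable_funM.
- exact: mcos1.
Qed.

Lemma measurable_angles : measurable angles.
Proof. by apply: measurableX; exact: measurable_itv. Qed.

Let sin_ge0 (A : set 'cV[R]_3) (p : R * R) :
  (angles `&` sphere_pt @^-1` A) p -> (0 <= (sin p.1)%:E)%E.
Proof.
move=> [[/= + _] _]; rewrite in_itv /= => p1; rewrite lee_fin.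
exact: sin_ge0_pi.
Qed.

Let sphere_measure0 : sphere_measure set0 = 0%E.
Proof. by rewrite /sphere_measure preimage_set0 setI0 integral_set0. Qed.

Let sphere_measure_ge0 A : (0 <= sphere_measure A)%E.
Proof. by apply: integral_ge0 => p; exact: sin_ge0. Qed.

Let sphere_measure_semi_sigma_additive : semi_sigma_additive sphere_measure.
Proof.
have mpre A : measurable A -> measurable (angles `&` sphere_pt @^-1` A).
  move=> mA; apply: measurableI; first exact: measurable_angles.
  by rewrite -[X in measurable X]setTI; exact: measurable_sphere_pt.
move=> F mF tF mUF; rewrite /sphere_measure preimage_bigcup setI_bigcupr.
rewrite ge0_integral_bigcup//=.
- apply: is_cvg_ereal_nneg_natsum_cond => n _ _.
  by apply: integral_ge0 => p; exact: sin_ge0.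
- by move=> n; apply: mpre.
- apply: measurable_funTS; apply/measurable_EFinP.
  by apply: measurableT_comp => //; apply: continuous_measurable_fun;
     exact: continuous_sin.
- by rewrite -setI_bigcupr -preimage_bigcup => p; exact: sin_ge0.
- apply: trivIset_setIl; apply/trivIsetP => i j _ _ ij.
  by rewrite -preimage_setI; move/trivIsetP: tF => ->//; rewrite preimage_set0.
Qed.

HB.instance Definition _ := isMeasure.Build _ _ _ sphere_measure
  sphere_measure0 sphere_measure_ge0 sphere_measure_semi_sigma_additive.

End SphereMeasure.

Section SphericalHarmonics.
Context {R : realType}.
Local Notation C := R[i].
Local Open Scope complex_scope.

Definition Cintegral d (T : measurableType d) (mu : {measure set T -> \bar R})
    (D : set T) (g : T -> C) : C :=
  Rintegral mu D (fun x => complex.Re (g x)) +i*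
  Rintegral mu D (fun x => complex.Im (g x)).

(* Rodrigues' formula *)
Definition legendre (l : nat) : {poly R} :=
  ((2 ^ l * l`!)%:R)^-1 *: derivn l (('X^2 - 1) ^+ l).

(* The usual formula in spherical coordinates is, for 0 <= m <= l,
     (-1)^m sqrt ((2l+1)/(4 pi) (l-m)!/(l+m)!) P_l^m(cos theta) e^(i m phi),
   with P_l^m(z) = (1 - z^2)^(m/2) (d/dz)^m P_l(z).  At x = sphere_pt (theta, phi)
   one has cos theta = x_3 and (sin theta)^m e^(i m phi) = (x_1 + i x_2)^m. *)
Definition spherical_harmonic_nat (l m : nat) (x : 'cV[R]_3) : C :=
  ((-1) ^+ m *
   Num.sqrt ((2 * l + 1)%:R / (4 * pi) * ((l - m)`!%:R / (l + m)`!%:R)) *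
   (derivn m (legendre l)).[x 2 0])%:C
  * (x 0 0 +i* x 1 0) ^+ m.

Definition spherical_harmonic (l : nat) (m : int) (x : 'cV[R]_3) : C :=
  match m with
  | Posz k => spherical_harmonic_nat l k x
  | Negz k => (-1) ^+ k.+1 * (spherical_harmonic_nat l k.+1 x)^*
  end.

(* The orders -l <= m <= l are indexed by i < 2l+1, with m = i - l. *)
Definition order_of (l : nat) (i : 'I_(2 * l).+1) : int := i%:Z - l%:Z.

Definition fourier (g : 'cV[R]_3 -> C) (l : nat) (i : 'I_(2 * l).+1) : C :=
  Cintegral sphere_measure sphere
    (fun x => g x * (spherical_harmonic l (order_of i) x)^*).

Definition SO3 : set 'M[R]_3 := [set u | u *m u^T = 1%:M /\ \det u = 1].

Definition is_haar (haar : probability 'M[R]_3 R) : Prop :=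
  haar SO3 = 1%E /\
  forall (u : 'M[R]_3) (A : set 'M[R]_3), SO3 u -> measurable A ->
    haar [set u *m g | g in A] = haar A.

(* The relation determines D on SO3, the harmonics of degree l being linearly
   independent on the sphere; off SO3 the values of D are irrelevant. *)
Definition is_rotational_harmonics
    (D : forall l : nat, 'M[R]_3 -> 'M[C]_((2 * l).+1)) : Prop :=
  forall (l : nat) (g : 'M[R]_3) (x : 'cV[R]_3) (i : 'I_(2 * l).+1),
    SO3 g -> sphere x ->
    (spherical_harmonic l (order_of i) (g *m x))^* =
    \sum_(j < (2 * l).+1) D l g i j * (spherical_harmonic l (order_of j) x)^*.

Definition rot_fourier (haar : probability 'M[R]_3 R)
    (D : forall l : nat, 'M[R]_3 -> 'M[C]_((2 * l).+1))
    (h : 'M[R]_3 -> R) (l : nat) : 'M[C]_((2 * l).+1) :=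
  \matrix_(i, j) Cintegral haar SO3 (fun g => (h g)%:C * D l g i j).

Definition euclidean_norm n (v : 'cV[C]_n) : R :=
  Num.sqrt (\sum_(i < n) Normc.normc (v i 0) ^+ 2).

Definition op_norm n (A : 'M[C]_n) : R :=
  sup [set euclidean_norm (A *m v) | v in [set v | euclidean_norm v <= 1]].

Definition is_density d (T : measurableType d) (mu : {measure set T -> \bar R})
    (D : set T) (f : T -> R) : Prop :=
  [/\ measurable_fun D f, (forall x, D x -> 0 <= f x) &
      (\int[mu]_(x in D) (f x)%:E = 1)%E].

Definition super_smooth (haar : probability 'M[R]_3 R)
    (D : forall l : nat, 'M[R]_3 -> 'M[C]_((2 * l).+1)) (feps : 'M[R]_3 -> R)
    (nu0 nu1 d0 d1 delta beta : R) : Prop :=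
  let F := rot_fourier haar D feps in
  (forall l : nat, F l \in unitmx) /\
  [/\ nu1 <= nu0, 0 < d0, 0 < d1, 0 < delta & 0 < beta] /\
  forall l : nat, (1 <= l)%N ->
    op_norm (invmx (F l)) <=
      d0^-1 * (l%:R `^ (- nu0)) * expR (l%:R `^ beta / delta) /\
    op_norm (F l) <= d1 * (l%:R `^ nu1) * expR (- (l%:R `^ beta / delta)).

End SphericalHarmonics.

Section Sobolev.
Context {R : realType}.
Local Notation C := R[i].
Local Open Scope complex_scope.

Definition sobolev_sqnorm (s : R) (g : 'cV[R]_3 -> C) : \bar R :=
  (\sum_(0 <= l <oo) \sum_(i < (2 * l).+1)
     (((1 + l * (l + 1))%:R `^ s) * Normc.normc (fourier g i) ^+ 2)%:E)%E.

Fixpoint Ck (k : nat) (G : 'cV[R]_3 -> R) : Prop :=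
  continuous G /\
  match k with
  | 0 => True
  | k'.+1 => forall i : 'I_3,
      (forall x, derivable G x (delta_mx i 0)) /\
      Ck k' (fun x => 'D_(delta_mx i 0) G x)
  end.

Definition smooth (G : 'cV[R]_3 -> R) : Prop := forall k, Ck k G.

(* Smooth functions on the (closed) submanifold S^2 of R^3 are the restrictions
   of smooth functions on R^3. *)
Definition smooth_on_sphere (g : 'cV[R]_3 -> C) : Prop :=
  exists G1 G2 : 'cV[R]_3 -> R, [/\ smooth G1, smooth G2 &
    forall x, sphere x -> g x = G1 x +i* G2 x].

(* For s >= 0 the Sobolev norm dominates the L^2 norm, and the completion of the
   smooth functions is realized as their closure in L^2(S^2). *)
Definition sobolev_space (s : R) (f : 'cV[R]_3 -> R) : Prop :=
  [/\ measurable_fun sphere f,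
      (\int[sphere_measure]_(x in sphere) ((f x) ^+ 2)%:E < +oo)%E &
      exists g : nat -> 'cV[R]_3 -> C,
        (forall k, smooth_on_sphere (g k)) /\
        sobolev_sqnorm s (fun x => (f x)%:C - g k x) @[k --> \oo] --> 0%E].

Definition sphere_density (f : 'cV[R]_3 -> R) : Prop :=
  is_density sphere_measure sphere f.

Definition uniform_density (x : 'cV[R]_3) : R := (4 * pi)^-1 * \1_sphere x.

Definition sobolev_ball (s r : R) : set ('cV[R]_3 -> R) :=
  [set f | [/\ sphere_density f, sobolev_space s f &
    (sobolev_sqnorm s (fun x => (f x)%:C) <= ((4 * pi)^-1 + r ^+ 2)%:E)%E]].

Definition alternatives (s r rho : R) : set ('cV[R]_3 -> R) :=
  [set f | sobolev_ball s r f /\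
    (rho%:E <= \int[sphere_measure]_(x in sphere)
                 ((f x - uniform_density x) ^+ 2)%:E)%E].

End Sobolev.

Section Testing.
Context {R : realType} d {Om : measurableType d}.
Variables (P : ('cV[R]_3 -> R) -> probability Om R)
  (eps : nat -> Om -> 'M[R]_3) (X : nat -> Om -> 'cV[R]_3).

(* P f is the probability under which the signals X_i have density f.  Taking
   some of the sets A i, B i to be full in model_indep gives the product rule
   for every finite subfamily of the eps_i and X_i. *)
Record deconvolution_model (haar : probability 'M[R]_3 R)
    (feps : 'M[R]_3 -> R) : Prop := DeconvolutionModel {
  model_eps_meas : forall i, measurable_fun setT (eps i);
  model_X_meas : forall i, measurable_fun setT (X i);
  model_eps_SO3 : forall i w, SO3 (eps i w);
  model_X_sphere : forall i w, sphere (X i w);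
  model_eps_law : forall f, sphere_density f ->
    forall i (A : set 'M[R]_3), measurable A ->
    P f (eps i @^-1` A) = (\int[haar]_(u in SO3 `&` A) (feps u)%:E)%E;
  model_X_law : forall f, sphere_density f ->
    forall i (B : set 'cV[R]_3), measurable B ->
    P f (X i @^-1` B) = (\int[sphere_measure]_(x in sphere `&` B) (f x)%:E)%E;
  model_indep : forall f, sphere_density f ->
    forall (N : nat) (A : nat -> set 'M[R]_3) (B : nat -> set 'cV[R]_3),
    (forall i, measurable (A i)) -> (forall i, measurable (B i)) ->
    P f [set w | forall i, (i < N)%N -> A i (eps i w) /\ B i (X i w)] =
    (\prod_(i < N) (P f (eps i @^-1` A i) * P f (X i @^-1` B i)))%E
}.

Definition observations (N : nat) (w : Om) : N.-tuple 'cV[R]_3 :=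
  [tuple eps i w *m X i w | i < N].

(* Observations lie on the sphere, so the values of a test at tuples with an
   entry off the sphere play no role. *)
Definition is_test (N : nat) : set (N.-tuple 'cV[R]_3 -> bool) :=
  [set Delta | measurable_fun setT Delta].

(* maxe 0 makes the supremum over an empty set of alternatives equal to 0. *)
Definition testing_risk (s r rho : R) (N : nat)
    (Delta : N.-tuple 'cV[R]_3 -> bool) : \bar R :=
  (P uniform_density [set w | Delta (observations N w) = true] +
   maxe 0 (ereal_sup [set P f [set w | Delta (observations N w) = false]
                     | f in alternatives s r rho]))%E.

Definition minimax_risk (s r rho : R) (N : nat) : \bar R :=
  ereal_inf [set testing_risk s r rho Delta | Delta in @is_test N].

End Testing.

Definition separation_rate {R : realType} (s beta : R) (N : nat) : R :=
  ln (N%:R) `^ (- (2 * s / beta)).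

(* Main.v *)
(* The lower bound needs a single alternative, f_1 = 1/(4 pi) + a sqrt(2) Re Y^l_l with
   a^2 = C psi_N and l of order (2 delta ln N)^(1/beta): it is at L^2 distance a from f_0,
   lies in the Sobolev ball for C <= K R^2, and is positive for l large, since |Y^l_l| is
   O(l^(1/4)) while a is O(l^(-s)) with s >= 1/2.  The density of an observation under f_1
   is 1/(4 pi) plus a sqrt(2) Re (f_eps * Y^l_l), and f_eps * Y^l_l has the l-th column of
   f_eps^l as coefficients on the Y^l_m, so that it is O(l^3 ||f_eps^l||_op).  Hence the law
   of an observation under f_1 dominates 1 - eta times its law under f_0, with
   eta = O(l^(3 + nu_1) exp(- l^beta / delta)), and the laws of N observations compare with
   the factor (1 - eta)^N >= 1 - N eta.  This makes the risk of every test at least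
   1 - N eta, and N eta tends to 0 because N <= exp(l^beta / (2 delta)). *)

Require Import Defs.
From HB Require Import structures.
From mathcomp Require Import all_boot all_order all_algebra.
From mathcomp Require Import complex.
From mathcomp Require Import all_classical all_reals all_analysis.
From mathcomp Require Import measurable_realfun ring lra zify.
Import Order.TTheory GRing.Theory Num.Theory.
Import numFieldNormedType.Exports.
Set Implicit Arguments.
Unset Strict Implicit.
Unset Printing Implicit Defensive.
Local Open Scope classical_set_scope.
Local Open Scope ring_scope.

(** The choice m = l matters. At s = 1/2 the Sobolev bound only gives a = O(r l^(-1/2)), with r
    arbitrary against a K independent of it. The zonal harmonic, whose maximum is of order l^(1/2),
    would leave a perturbation that need not be small; the slower growth of the top order makes it
    vanish in the limit. Comparing laws by domination rather than by a chi-square distance asks only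
    for a uniform bound on f_eps * Y^l_l, and domination passes to products and to every event at
    once. Losses polynomial in l are harmless against exp(- l^beta / delta), so these bounds are
    crude. Two inputs do not come with the definitions. The surface measure is defined in
    coordinates around one axis, so its invariance under SO(3) must be proved: it is visible for
    rotations about that axis, and for the exchange of two coordinates once the sphere is seen as
    two graphs over a disc; these are enough to reach every rotation. The rotational harmonics are
    known only through their transformation rule; orthonormality of the spherical harmonics yields
    an integral formula for them, hence unitarity and measurability. *)

Section Density.
Local Open Scope ereal_scope.
Context d (T : measurableType d) (R : realType).
Variables (mu : {measure set T -> \bar R}) (w : T -> R).
Hypotheses (mw : measurable_fun setT w) (w0 : forall x, (0 <= w x)%R).

(* mw and w0 are arguments of the function so that instances can be attached *)
Definition mdensity (_ : measurable_fun setT w) (_ : forall x, (0 <= w x)%R)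
  (A : set T) : \bar R := \int[mu]_(x in A) (w x)%:E.

Local Notation nu := (mdensity mw w0).

Let nu0 : nu set0 = 0. Proof. exact: integral_set0. Qed.

Let nu_ge0 A : 0 <= nu A.
Proof. by apply: integral_ge0 => x _; rewrite lee_fin. Qed.

Let nu_sigma : semi_sigma_additive nu.
Proof.
move=> F mF tF mUF; rewrite /mdensity ge0_integral_bigcup//=.
- apply: is_cvg_ereal_nneg_natsum_cond => n _ _.
  by apply: integral_ge0 => p _; rewrite lee_fin.
- by apply: measurable_funTS; exact/measurable_EFinP.
- by move=> x _; rewrite lee_fin.
Qed.

HB.instance Definition _ := isMeasure.Build _ _ _ nu nu0 nu_ge0 nu_sigma.

Import HBNNSimple.

(** Both sides are limits along one increasing sequence of simple functions, by monotone
    convergence. On a level set of a simple function the identity is the definition of the measure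
    with density [w]. *)
Lemma ge0_integral_mdensity D (f : T -> \bar R) : measurable D ->
  measurable_fun D f -> (forall x, D x -> 0 <= f x) ->
  \int[nu]_(x in D) f x = \int[mu]_(x in D) (f x * (w x)%:E).
Proof.
move=> mD mf f0; pose h := (nnsfun_approx mD mf : {nnsfun T >-> R}^nat).
have cvh x : D x -> (h n x)%:E @[n --> \oo] --> f x.
  by move=> Dx; exact: cvg_nnsfun_approx.
have mwE : measurable_fun D (EFin \o w).
  by apply: measurable_funTS; exact/measurable_EFinP.
have mh n : measurable_fun D (EFin \o h n).
  by apply: measurable_funTS; apply/measurable_EFinP; exact/measurable_funP.
transitivity (lim (\int[nu]_(x in D) (h n x)%:E @[n --> \oo])).
  rewrite -monotone_convergence//.
  - by apply: eq_integral => x /[!inE] Dx; apply/esym/cvg_lim => //; exact: cvh.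
  - by move=> n x Dx; rewrite lee_fin.
  - by move=> x Dx a b ab; rewrite lee_fin; exact/lefP/nd_nnsfun_approx.
transitivity (lim (\int[mu]_(x in D) ((h n x)%:E * (w x)%:E) @[n --> \oo])); last first.
  rewrite -monotone_convergence//.
  - apply: eq_integral => x /[!inE] Dx; apply/cvg_lim => //.
    by apply: cvgeZr => //; exact: cvh.
  - by move=> n; apply: emeasurable_funM => //; exact: mh.
  - by move=> n x Dx; rewrite mule_ge0// lee_fin.
  - move=> x Dx a b ab; rewrite lee_wpmul2r ?lee_fin//.
    exact/lefP/nd_nnsfun_approx.
congr (limn _); apply/funext => n.
transitivity (\int[nu]_(x in D)
   (\sum_(y \in range (h n)) (y * \1_(h n @^-1` [set y]) x)%:E)).
  by apply: eq_integral => t tE; rewrite /= fimfunE -fsumEFin.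
have mi r : measurable_fun D (fun x => (r * \1_(h n @^-1` [set r]) x)%:E).
  by apply: (measurable_comp measurableT) => //; exact: measurable_funM.
rewrite ge0_integral_fsum//; last by move=> y x Dx; exact: nnfun_muleindic_ge0.
transitivity (\int[mu]_(x in D) (\sum_(y \in range (h n))
    (y * \1_(h n @^-1` [set y]) x)%:E * (w x)%:E)); last first.
  apply: eq_integral => x xD.
  rewrite -ge0_mule_fsuml => [|y]; last exact: nnfun_muleindic_ge0.
  by rewrite fsumEFin // -(fimfunE _ x).
rewrite ge0_integral_fsum//; last 2 first.
  - by move=> y; apply: emeasurable_funM.
  - by move=> y x Dx; apply: mule_ge0; [exact: nnfun_muleindic_ge0|rewrite lee_fin].
apply: eq_fsbigr => r /[!inE] -[t _ htr].
have r0 : (0 <= r)%R by rewrite -htr.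
under eq_integral do rewrite EFinM.
rewrite integralZl_indic_nnsfun// integral_indic//.
under [RHS]eq_integral do rewrite EFinM -muleA.
rewrite ge0_integralZl//.
- congr (_ * _); rewrite setIC -[LHS]/(\int[mu]_(x in D `&` _) _) integral_mkcondr; apply: eq_integral => x xD.
  by rewrite epatch_indic muleC.
- by apply: emeasurable_funM => //; exact/measurable_EFinP.
- by move=> x Dx; rewrite mule_ge0// lee_fin.
Qed.

End Density.

Definition mpushforward d1 d2 (T1 : measurableType d1) (T2 : measurableType d2)
    (R : realType) (m : {measure set T1 -> \bar R}) (f : T1 -> T2)
    (mf : measurable_fun setT f) : {measure set T2 -> \bar R} :=
  measure_function_pushforward__canonical__measure_function_Measure m mf.

(** * Rotation invariance of the surface measure *)

Section Cosine.
Local Open Scope ereal_scope.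
Context (R : realType).
Notation lam := (@lebesgue_measure R).

Lemma integral_sin (a b : R) : (a <= b)%R ->
  \int[lam]_(x in `[a, b]) (sin x)%:E = (cos a - cos b)%:E.
Proof.
rewrite le_eqVlt => /predU1P[->|ab]; first by rewrite set_itv1 integral_set1 subrr.
rewrite (@continuous_FTC2 _ _ (fun x => - cos x)%R)//.
- by rewrite -EFinB opprK addrC.
- by apply: continuous_subspaceT => x; exact: continuous_sin.
- split.
  + by move=> x _; apply: derivableN; exact: derivable_cos.
  + by apply: cvgN; apply: cvg_at_right_filter; exact: continuous_cos.
  + by apply: cvgN; apply: cvg_at_left_filter; exact: continuous_cos.
- by move=> x _; rewrite derive1E deriveN// derive_val opprK.
Qed.

Let w (r : R) (x : R) : R := (r * (sin x * \1_(`]0, pi[) x))%R.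

Let mw r : measurable_fun setT (w r).
Proof.
apply: measurable_funM => //; apply: measurable_funM => //.
by apply: continuous_measurable_fun; exact: continuous_sin.
Qed.

Let w0 r : (0 <= r)%R -> forall x, (0 <= w r x)%R.
Proof.
move=> r0 x; rewrite /w mulr_ge0// indicE.
case: (boolP (x \in _)); rewrite ?mulr0// mulr1 inE/= in_itv/= => /andP[x0 xpi].
by apply: sin_ge0_pi; rewrite !ltW.
Qed.

(** The substitution is an equality of measures: the image under r cos of the density r sin on ]0,
    pi[ and the Lebesgue measure on ]-r, r[ agree on half-lines, a generating class stable by
    intersection. The radius r is 1 for the colatitude and sin t on a circle of latitude. *)
Lemma ge0_integral_cos (r : R) (f : R -> \bar R) : (0 < r)%R ->
  measurable_fun setT f -> (forall x, 0 <= f x) ->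
  \int[lam]_(x in `]0%R, pi[) (f (r * cos x)%R * (r * sin x)%:E) =
  \int[lam]_(x in `](- r)%R, r[) f x.
Proof.
move=> r0 mf f0.
have mc : @measurable_fun _ _ (measurableTypeR R) (measurableTypeR R)
    setT (fun x => r * cos x)%R.
  apply: measurable_funM => //.
  by apply: continuous_measurable_fun; exact: continuous_cos.
pose m := mpushforward (mdensity lam (mw r) (w0 (ltW r0))) mc.

have mI : measurable_fun setT (\1_(`](- r)%R, r[) : R -> R) by [].
have I0 x : (0 <= (\1_(`](- r)%R, r[) : R -> R) x)%R by [].
have mI_ A : measurable A -> mdensity lam mI I0 A = lam (A `&` `](- r)%R, r[).
  by move=> mA; rewrite /mdensity integral_indic// setIC.
have mE (a : R) : m `]-oo, a[%classic = lam (`]-oo, a[ `&` `](- r)%R, r[).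
  (* The level a / r is clamped to [-1, 1] so that [acos c] is meaningful for every a. *)
  pose c : R := (Num.max (-1) (Num.min 1 (a / r)))%R.
  have c11 : (-1 <= c <= 1)%R by rewrite /c le_max lexx/= ge_max ge_min lexx/= andbT; lra.
  have ltc x : (-1 < x < 1)%R -> (r * x < a)%R = (x < c)%R.
    move=> /andP[x1 x2]; rewrite mulrC -ltr_pdivlMr// /c lt_max lt_min x2/=.
    by rewrite [(x < -1)%R]ltNge (ltW x1).
  have -> : lam (`]-oo, a[ `&` `](- r)%R, r[) = (r * c + r)%:E.
    have -> : `]-oo, a[ `&` `](- r)%R, r[ = `](- r)%R, (r * c)%R[%classic :> set R.
      apply/seteqP; split => x /=; rewrite !in_itv/=.
        move=> [xa /andP[xr rx]]; rewrite xr/= mulrC -ltr_pdivrMr// -ltc.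
          by rewrite mulrC divfK// gt_eqF.
        by rewrite ltr_pdivlMr// ltr_pdivrMr// mulN1r mul1r xr.
      move=> /andP[xr xc].
      have rx : (x < r)%R.
        by rewrite (lt_le_trans xc)// ger_pMr//; case/andP: c11.
      rewrite xr rx; split => //; rewrite -(divfK (lt0r_neq0 r0) x) mulrC ltc.
        by rewrite ltr_pdivrMr// mulrC.
      by rewrite ltr_pdivlMr// ltr_pdivrMr// mulN1r mul1r xr.
    rewrite lebesgue_measure_itv/= lte_fin -EFinB opprK; case: ifPn => //.
    rewrite -leNgt => h; congr EFin; apply/esym/eqP; rewrite eq_le.
    rewrite -lerBrDr sub0r h/= -[X in (_ <= _ + X)%R]mulr1 -mulrDr mulr_ge0 ?(ltW r0)//.
    by rewrite -lerBlDr sub0r; case/andP: c11.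
  have cosx x : (0 < x < pi)%R -> (-1 < cos x < 1)%R.
    move=> /andP[x0 xpi]; rewrite -cospi -cos0 !ltr_cos ?x0 ?xpi// in_itv/= ?lexx ?pi_ge0 ?ltW//.
  rewrite /m /= /pushforward /= /mdensity.
  (* Cosine decreases on ]0, pi[, so r cos x < a there means acos c < x. *)
  transitivity (\int[lam]_(x in `]acos c, pi[) (r * sin x)%:E).
    rewrite [LHS]integral_mkcond [RHS]integral_mkcond; apply: eq_integral => x _.
    rewrite !patchE /w indicE.
    have [xpi|xpi] := boolP (x \in `]0%R, pi[).
      have xpi' := xpi; move: xpi'; rewrite in_itv/= => x0pi.
      rewrite (_ : (x \in `]0%R, pi[%classic) = true) ?mulr1; last by rewrite mem_set.
      have -> : (x \in (fun x0 => r * cos x0)%R @^-1` `]-oo, a[) =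
                (x \in `]acos c, pi[%classic) => //.
      apply/idP/idP; rewrite !inE/= !in_itv/= ltc ?cosx//.
        rewrite -{1}(acosK c11) ltr_cos ?in_itv/= ?acos_ge0 ?acos_lepi//.
          by move=> ->; case/andP: x0pi.
        by case/andP: x0pi => *; rewrite !ltW.
      rewrite -{2}(acosK c11) ltr_cos ?in_itv/= ?acos_ge0 ?acos_lepi//.
        by move=> /andP[].
      by case/andP: x0pi => *; rewrite !ltW.
    rewrite (_ : (x \in `]0%R, pi[%classic) = false) ?mulr0 ?mulr0; last by rewrite memNset//; exact/negP.
    case: ifPn => _; case: ifPn => //.
      rewrite inE/= in_itv/= => /andP[h1 h2]; move: xpi; rewrite in_itv/= h2.
      by rewrite (le_lt_trans _ h1)// acos_ge0.
    rewrite inE/= in_itv/= => /andP[h1 h2]; move: xpi; rewrite in_itv/= h2.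
    by rewrite (le_lt_trans _ h1)// acos_ge0.
  rewrite -(@integral_itv_bndoo _ _ _ _ true false); last first.
    apply/measurable_funTS/measurable_EFinP; apply: measurable_funM => //.
    by apply: continuous_measurable_fun; exact: continuous_sin.
  under eq_integral do rewrite EFinM.
  rewrite ge0_integralZl//.
  - rewrite integral_sin ?acos_lepi// cospi acosK// opprK -EFinM mulrDr mulr1//.
  - apply/measurable_funTS/measurable_EFinP.
    by apply: continuous_measurable_fun; exact: continuous_sin.
  - move=> x; rewrite /= in_itv/= => /andP[h1 h2]; rewrite lee_fin sin_ge0_pi//.
    by rewrite h2 (le_trans _ h1)// acos_ge0.
  - by rewrite lee_fin ltW.
have mUE A : measurable A -> m A = mdensity lam mI I0 A.
  move=> mA.
  apply: (@measure_unique _ _ (measurableTypeR R) (@RGenInftyO.G R) (fun n => `]-oo, n%:R[%classic) _ _ _ _ m (mdensity lam mI I0)) => //.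
  - exact: RGenInftyO.measurableE.
  - move=> _ _ [x ->] [y ->]; exists (Num.min x y).
    apply/seteqP; split => z /=; rewrite !in_itv/= lt_min.
      by move=> [-> ->].
    by move=> /andP[].
  - by move=> n; exists n%:R.
  - apply/seteqP; split => // z _; exists (Num.truncn `|z|).+1 => //=.
    by rewrite in_itv/= (le_lt_trans (ler_norm _))// truncnS_gt.
  - by move=> _ [x ->]; exact: (etrans (mE x) (esym (mI_ _ (measurable_itv _)))).
  - move=> k; rewrite mE (@le_lt_trans _ _ (lam `](- r)%R, r[))//.
      by apply: le_measure; rewrite ?inE//; exact: measurableI.
    by rewrite lebesgue_measure_itv/=; case: ifP => // _; rewrite ltry.
transitivity (\int[m]_x f x).
  rewrite /m ge0_integral_pushforward//.
  have mf' : @measurable_fun _ _ (measurableTypeR R) _ setT f := mf.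
  rewrite preimage_setT ge0_integral_mdensity//; first last.
  - by move=> x _ /=.
  - exact: (measurableT_comp mf' mc).
  rewrite [LHS]integral_mkcond; apply: eq_integral => x _.
  rewrite patchE /w /= indicE; case: ifPn => _; rewrite ?mulr1// mulr0 mulr0 mule0//.
rewrite (eq_measure_integral (mdensity lam mI I0)).
  rewrite ge0_integral_mdensity// [RHS]integral_mkcond; apply: eq_integral => x _.
  by rewrite patchE indicE; case: ifPn => _; rewrite ?mule1 ?mule0.
by move=> A mA _; exact: mUE.
Qed.
End Cosine.

(** * Isometries of the line and periodic integrands *)

Section LineIsometries.
Local Open Scope ereal_scope.
Context (R : realType).
Notation lam := (@lebesgue_measure R).
Implicit Types (f : R -> \bar R) (c : R).

Lemma ge0_integral_shift f c : measurable_fun setT f -> (forall x, 0 <= f x) ->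
  \int[lam]_x f (c + x)%R = \int[lam]_x f x.
Proof.
move=> mf f0.
have mc : @measurable_fun _ _ (measurableTypeR R) (measurableTypeR R)
    setT (fun x => c + x)%R by exact: measurable_funD.
transitivity (\int[mpushforward lam mc]_x f x).
  by rewrite ge0_integral_pushforward.
apply: eq_measure_integral => A mA _; apply/esym.
apply: (@lebesgue_measure_unique _ (mpushforward lam mc)) => // _ [[a b] _ <-].
rewrite /= /pushforward /=.
have -> : (fun x => c + x)%R @^-1` `]a, b] = `](a - c)%R, (b - c)%R]%classic.
  by apply/seteqP; split => x /=; rewrite !in_itv/= ltrBlDl lerBrDl.
rewrite !lebesgue_measure_itv/= !lte_fin ltrD2r.
by case: ifP => // _; rewrite -!EFinB opprB addrA subrK.
Qed.

Lemma ge0_integral_opp f : measurable_fun setT f -> (forall x, 0 <= f x) ->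
  \int[lam]_x f (- x)%R = \int[lam]_x f x.
Proof.
move=> mf f0.
have mc : @measurable_fun _ _ (measurableTypeR R) (measurableTypeR R)
    setT (fun x => - x)%R by exact: measurable_funN.
transitivity (\int[mpushforward lam mc]_x f x).
  by rewrite ge0_integral_pushforward.
by apply: eq_measure_integral => A mA _; exact: lebesgue_measureN.
Qed.

Lemma ge0_integral_reflect f c : measurable_fun setT f -> (forall x, 0 <= f x) ->
  \int[lam]_x f (c - x)%R = \int[lam]_x f x.
Proof.
move=> mf f0; rewrite -[RHS](@ge0_integral_shift _ c)//.
rewrite -(@ge0_integral_opp (fun x => f (c + x)%R))//.
by apply: measurableT_comp => //; exact: measurable_funD.
Qed.

Lemma ge0_integral_period f (T c : R) : (0 <= c < T)%R -> measurable_fun setT f ->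
  (forall x, 0 <= f x) -> (forall x, f (x + T)%R = f x) ->
  \int[lam]_(x in `[0%R, T[) f (c + x)%R = \int[lam]_(x in `[0%R, T[) f x.
Proof.
move=> /andP[c0 cT] mf f0 fT.
have mfS D : measurable_fun D f by apply: measurable_funTS.
have sh a b s : \int[lam]_(x in `[a, b[) f (s + x)%R = \int[lam]_(x in `[(s + a)%R, (s + b)%R[) f x.
  rewrite integral_mkcond [RHS]integral_mkcond -[RHS](@ge0_integral_shift _ s).
  - apply: eq_integral => x _; rewrite !patchE.
    by congr (if _ then _ else _); apply/idP/idP; rewrite !inE/= !in_itv/= lerD2l ltrD2l.
  - by apply/(measurable_restrictT _ _).1 => //; exact: measurable_itv.
  - by move=> x; rewrite patchE; case: ifP.
rewrite sh addr0.
have E a b d : (a <= b)%R -> (b <= d)%R -> \int[lam]_(x in `[a, d[) f x =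
    \int[lam]_(x in `[a, b[) f x + \int[lam]_(x in `[b, d[) f x.
  move=> ab bd; rewrite -ge0_integral_setU//=.
  - congr (integral _ _ _); apply/seteqP; split => x /=; rewrite !in_itv/=.
      by case: (ltP x b) => xb /andP[-> ->]; [left|right].
    move=> [/andP[-> /=]|/andP[h ->]].
      by move/lt_le_trans; apply.
    by rewrite (le_trans ab).
  - exact: mfS.
  - apply/disj_setPS => x [/=]; rewrite !in_itv/= => /andP[_ xb] /andP[bx _].
    by move: xb; rewrite ltNge bx.
(* The shifted period [c, c + T[ is cut at T, and the overflow [T, c + T[ is brought back to [0, c[
   by periodicity. *)
rewrite (E c T (c + T)%R) ?(ltW cT) ?lerDr// (E 0%R c T) ?(ltW cT)// addeC; congr (_ + _).
have := sh 0%R c T; rewrite addr0 addrC => <-.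
by apply: eq_integral => x _; rewrite addrC fT.
Qed.

End LineIsometries.

(** * The surface measure as an iterated integral *)

Section SphereIntegral.
Local Open Scope ereal_scope.
Context (R : realType).
Notation lam := (@lebesgue_measure R).
Notation T2 := (measurableTypeR R * measurableTypeR R)%type.

Lemma measurable_sin D : measurable_fun D (@sin R).
Proof.
by apply: measurable_funTS; apply: continuous_measurable_fun; exact: continuous_sin.
Qed.

Let mpt : @measurable_fun _ _ T2 _ setT (@sphere_pt R).
Proof. exact: measurable_sphere_pt. Qed.


Lemma measurable_indic_slice (A : set 'cV[R]_3) (D : set R) t : measurable A ->
  measurable_fun D (fun u => (\1_A (sphere_pt (t, u)))%:E : \bar R).
Proof.
move=> mA; apply: measurable_funTS; apply/measurable_EFinP.
have mI : measurable_fun setT (\1_A : _ -> R) by exact: measurable_indic.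
exact: (measurableT_comp mI (measurableT_comp mpt (pair1_measurable t))).
Qed.

Lemma measurable_sphere_slice (A : set 'cV[R]_3) (B : set R) : measurable A ->
  measurable B ->
  @measurable_fun _ _ (measurableTypeR R) _ setT
    (fun t => \int[lam]_(u in B) (\1_A (sphere_pt (t, u)))%:E).
Proof.
move=> mA mB.
have mA' : @measurable _ T2 (sphere_pt @^-1` A).
  by rewrite -[X in measurable X]setTI; exact: mpt.
pose H (p : T2) : \bar R := (\1_B p.2 * \1_(sphere_pt @^-1` A) p)%:E.
have mH : measurable_fun setT H.
  apply/measurable_EFinP; apply: measurable_funM; last exact: measurable_indic.
  have mB' : @measurable_fun _ _ (measurableTypeR R) _ setT (\1_B : _ -> R).
    exact: measurable_indic.
  exact: (measurableT_comp mB' measurable_snd).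
have H0 p : 0 <= H p by rewrite lee_fin mulr_ge0.
have := @measurable_fun_fubini_tonelli_F _ _ _ _ _ lam H mH H0.
congr measurable_fun; apply/funext => t; rewrite /fubini_F [RHS]integral_mkcond.
apply: eq_integral => u _; rewrite patchE /H /= !indicE.
by case: (u \in B); rewrite ?mul0r ?mul1r.
Qed.

(** Tonelli in the two angles. The endpoints of the colatitude are dropped to match the open
    interval of [ge0_integral_cos]. *)
Lemma sphere_measureE (A : set 'cV[R]_3) : measurable A ->
  sphere_measure A = \int[lam]_(t in `]0%R, pi[) ((sin t)%:E *
    \int[lam]_(u in `[0%R, (2 * pi)%R[) (\1_A (sphere_pt (t, u)))%:E).
Proof.
move=> mA; rewrite /sphere_measure.
have mA' : @measurable _ T2 (sphere_pt @^-1` A).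
  by rewrite -[X in measurable X]setTI; exact: mpt.
pose G (p : T2) : \bar R := (\1_(@angles R) p * (\1_(sphere_pt @^-1` A) p * sin p.1))%:E.
have G0 p : 0 <= G p.
  rewrite lee_fin indicE; case: (boolP (p \in _)); rewrite ?mul0r// mul1r inE /angles.
  by move=> [/= + _]; rewrite in_itv/= => h; rewrite mulr_ge0// sin_ge0_pi.
have mang : @measurable _ T2 (@angles R) by exact: measurable_angles.
have mG : measurable_fun setT G.
  apply/measurable_EFinP; apply: measurable_funM; first exact: measurable_indic.
  apply: measurable_funM; first exact: measurable_indic.
  have ms : @measurable_fun _ _ (measurableTypeR R) _ setT (@sin R) by exact: measurable_sin.
  exact: (measurableT_comp ms measurable_fst).
transitivity (\int[lebesgue_measure \x lebesgue_measure]_p G p).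
  rewrite integral_mkcond; apply: eq_integral => p _; rewrite patchE /G !indicE in_setI.
  by case: (p \in angles); case: (p \in _ @^-1` _); rewrite /= ?mul0r ?mul1r.
rewrite fubini_tonelli1//= /fubini_F -(@integral_itv_bndoo _ _ _ _ true false)//; last first.
  apply: emeasurable_funM; first by apply/measurable_EFinP; exact: measurable_sin.
  by apply: measurable_funTS; apply: measurable_sphere_slice => //; exact: measurable_itv.
rewrite [RHS]integral_mkcond; apply: eq_integral => t _.
rewrite patchE; case: ifPn => [|tpi].
  rewrite inE/= in_itv/= => tpi.
  rewrite [X in _ * X]integral_mkcond -ge0_integralZl//; last 3 first.
  - apply/(measurable_restrictT _ _).1; first exact: measurable_itv.
    exact: measurable_indic_slice.
  - by move=> u _; rewrite patchE; case: ifP => // _; rewrite lee_fin.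
  - by rewrite lee_fin sin_ge0_pi.
  apply: eq_integral => u _; rewrite patchE /G.
  rewrite !indicE /angles /=.
  have -> : ((t, u) \in `[0%R, pi] `*` `[0%R, (2 * pi)%R[) = (u \in `[0%R, (2 * pi)%R[%classic).
    by apply/idP/idP; rewrite !inE/= !in_itv/= tpi; [case|].
  by case: (u \in _); rewrite ?mul0r ?mul1r ?mule0//= EFinM muleC.
rewrite integral0_eq// => u _; rewrite /G indicE memNset ?mul0r//.
by rewrite /angles /= => -[h _]; move: tpi; rewrite mem_set.
Qed.
End SphereIntegral.

(** * Invariance under axial rotations and under the exchange of two coordinates *)

Section SphereSymmetries.
Local Open Scope ereal_scope.
Context (R : realType).
Notation lam := (@lebesgue_measure R).
Notation T2 := (measurableTypeR R * measurableTypeR R)%type.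

Lemma indic_preim (T U : Type) (f : T -> U) (A : set U) (x : T) :
  \1_[set y | A (f y)] x = \1_A (f x) :> R.
Proof.
by rewrite !indicE; congr (_ (nat_of_bool _)); apply/idP/idP; rewrite !inE.
Qed.

Definition vec3 (a b c : R) : 'cV[R]_3 := \col_(i < 3) [:: a; b; c]`_i.

Lemma sphere_ptE (t u : R) :
  sphere_pt (t, u) = vec3 (sin t * cos u) (sin t * sin u) (cos t).
Proof. by []. Qed.

Lemma vec3_eta (x : 'cV[R]_3) : x = vec3 (x 0 0)%R (x 1 0)%R (x 2 0)%R.
Proof.
apply/matrixP => i j; rewrite mxE ord1.
by case: i => [[|[|[|//]]] h] /=; congr (x _ _); exact/val_inj.
Qed.

Lemma sum3 (V : nmodType) (F : 'I_3 -> V) : (\sum_(i < 3) F i = F 0 + F 1 + F 2)%R.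
Proof.
rewrite !big_ord_recl big_ord0 addr0 addrA.
by congr (F _ + F _ + F _)%R; exact/val_inj.
Qed.

Lemma mulmx3E (g : 'M[R]_3) (x : 'cV[R]_3) (i : 'I_3) :
  ((g *m x) i 0 = g i 0 * x 0 0 + g i 1 * x 1 0 + g i 2 * x 2 0)%R.
Proof. by rewrite mxE sum3. Qed.

Lemma vec3E (a b c : R) :
  ((vec3 a b c 0%R 0%R = a) * (vec3 a b c 1%R 0%R = b) * (vec3 a b c 2%R 0%R = c))%type.
Proof. by rewrite !mxE. Qed.

Lemma measurable_vec3 d (T : measurableType d) (a b c : T -> R) :
  measurable_fun setT a -> measurable_fun setT b -> measurable_fun setT c ->
  measurable_fun setT (fun t => vec3 (a t) (b t) (c t)).
Proof.
move=> ma mb mc; apply/measurable_fun_matrixP => i j.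
under eq_fun do rewrite mxE.
by case: i => [[|[|[|//]]] h].
Qed.

Lemma measurable_mulmx (g : 'M[R]_3) :
  measurable_fun setT (fun x : 'cV[R]_3 => g *m x).
Proof.
apply/measurable_fun_matrixP => i j; under eq_fun do rewrite mxE.
by apply: measurable_sum => k; apply: measurable_funM => //; exact: measurable_entry.
Qed.

Definition sphere_symmetry (g : 'M[R]_3) := forall A : set 'cV[R]_3, measurable A ->
  sphere_measure [set x | A (g *m x)] = sphere_measure A.

Lemma measurable_preim_mulmx (g : 'M[R]_3) (A : set 'cV[R]_3) :
  measurable A -> measurable [set x | A (g *m x)].
Proof.
by move=> mA; rewrite -[X in measurable X]setTI; exact: measurable_mulmx.
Qed.

Lemma sphere_symmetryM (g h : 'M[R]_3) : sphere_symmetry g -> sphere_symmetry h ->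
  sphere_symmetry (g *m h).
Proof.
move=> sg sh A mA; rewrite -(sg A)// -(sh _ (measurable_preim_mulmx g mA)).
by congr sphere_measure; apply/seteqP; split => x /=; rewrite mulmxA.
Qed.

Definition rotz (a : R) : 'M[R]_3 := \matrix_(i < 3, j < 3)
  (nth [::] [:: [:: cos a; - sin a; 0]; [:: sin a; cos a; 0]; [:: 0; 0; 1]] i)`_j%R.

Definition swapxz : 'M[R]_3 := \matrix_(i < 3, j < 3)
  (nth [::] [:: [:: 0; 0; 1]; [:: 0; 1; 0]; [:: 1; 0; 0]] i)`_j%R.

Lemma rotz_vec3 (a x y z : R) :
  (rotz a *m vec3 x y z = vec3 (cos a * x - sin a * y) (sin a * x + cos a * y) z)%R.
Proof.
apply/matrixP => i j; rewrite ord1 mulmx3E !vec3E !mxE.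
by case: i => [[|[|[|//]]] h] /=; rewrite ?mul0r ?mul1r ?addr0 ?add0r ?mulNr.
Qed.

Lemma swapxz_vec3 (x y z : R) : swapxz *m vec3 x y z = vec3 z y x.
Proof.
apply/matrixP => i j; rewrite ord1 mulmx3E !vec3E !mxE.
by case: i => [[|[|[|//]]] h] /=; rewrite ?mul0r ?mul1r ?addr0 ?add0r.
Qed.

Lemma rotz_sphere_pt (a t u : R) : rotz a *m sphere_pt (t, u) = sphere_pt (t, a + u)%R.
Proof.
rewrite !sphere_ptE rotz_vec3 cosD sinD; congr vec3; ring.
Qed.

(** The rotation shifts the longitude by a. The angle is kept within one turn because
    [ge0_integral_period] wraps around only once. *)
Lemma sphere_symmetry_rotz (a : R) : (0 <= a < 2 * pi)%R -> sphere_symmetry (rotz a).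
Proof.
move=> a2pi A mA; rewrite !sphere_measureE//; last exact: measurable_preim_mulmx.
apply: eq_integral => t _; congr (_ * _).
rewrite -[RHS](@ge0_integral_period _ _ _ a)//.
- by apply: eq_integral => u _; rewrite indic_preim rotz_sphere_pt.
- exact: measurable_indic_slice.
- by move=> u; rewrite !sphere_ptE mulr_natl sinD2pi cosD2pi.
Qed.

(* The area of the graph y = (-1)^e sqrt (1 - x^2 - z^2) over the unit disc. *)
Definition disc_density (e : bool) (A : set 'cV[R]_3) (p : R * R) : \bar R :=
  let w := Num.sqrt (1 - p.1 ^+ 2 - p.2 ^+ 2) in
  if (p.1 ^+ 2 + p.2 ^+ 2 < 1)%R then
    (\1_A (vec3 p.2 ((-1) ^+ e * w) p.1) * w^-1)%:E
  else 0.

Lemma disc_density_ge0 e A p : 0 <= disc_density e A p.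
Proof. by rewrite /disc_density; case: ifP. Qed.

Lemma measurable_disc_density e A : measurable A ->
  @measurable_fun _ _ T2 _ setT (disc_density e A).
Proof.
move=> mA.
have m1 : @measurable_fun _ _ T2 R setT fst.
  by move=> _ Y mY; exact: (@measurable_fst _ _ (measurableTypeR R) (measurableTypeR R)).
have m2 : @measurable_fun _ _ T2 R setT snd.
  by move=> _ Y mY; exact: (@measurable_snd _ _ (measurableTypeR R) (measurableTypeR R)).
have mw : @measurable_fun _ _ T2 R setT
    (fun p => Num.sqrt (1 - p.1 ^+ 2 - p.2 ^+ 2)%R).
  have ms : @measurable_fun _ _ R R setT (@Num.sqrt R).
    by apply: continuous_measurable_fun; exact: sqrt_continuous.
  apply: (measurableT_comp ms); apply: measurable_funB.
    by apply: measurable_funB => //; exact: measurable_funX.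
  exact: measurable_funX.
have mI : @measurable_fun _ _ _ R setT (\1_A : 'cV[R]_3 -> R) by exact: measurable_indic.
apply: measurable_fun_ifT => //.
  by apply: measurable_fun_ltr => //; apply: measurable_funD; exact: measurable_funX.
apply/measurable_EFinP; apply: measurable_funM.
  apply: (measurableT_comp mI); apply: measurable_vec3 => //.
  exact: measurable_funM.
under eq_fun do rewrite -powR_inv1 ?sqrtr_ge0//.
exact: (measurableT_comp (@measurable_powR R (-1)) mw).
Qed.

(* The substitution [x = sin t * cos u] on a half circle of latitude. *)
Lemma half_circleE (e : bool) A (t : R) : measurable A -> (0 < t < pi)%R ->
  \int[lam]_(u in `]0%R, pi[)
     (\1_A (vec3 (sin t * cos u) ((-1) ^+ e * (sin t * sin u)) (cos t)))%:E =
  \int[lam]_x disc_density e A (cos t, x).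
Proof.
move=> mA tpi; pose f x : \bar R := disc_density e A (cos t, x).
rewrite -[RHS]/(\int[lam]_x f x).
have st : (0 < sin t)%R by exact: sin_gt0_pi.
have mf : measurable_fun setT f.
  exact: (measurableT_comp (measurable_disc_density e mA) (pair1_measurable (cos t))).
have f0 x : 0 <= f x by exact: disc_density_ge0.
transitivity (\int[lam]_(x in `](- sin t)%R, (sin t)[) f x); last first.
  rewrite integral_mkcond; apply: eq_integral => x _; rewrite patchE.
  case: ifPn => // xs; rewrite /f /disc_density /=; case: ifPn => // h; exfalso.
  move/negP: xs; apply; rewrite inE/= in_itv/= -ltr_norml.
  by rewrite -ltr_sqr ?nnegrE ?(ltW st)// real_normK ?num_real// sin2cos2 ltrBrDl.
rewrite -ge0_integral_cos//; apply: eq_integral => u; rewrite inE/= in_itv/= => upi.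
have su : (0 < sin u)%R by exact: sin_gt0_pi.
have E : (1 - cos t ^+ 2 - (sin t * cos u) ^+ 2 = (sin t * sin u) ^+ 2)%R.
  by rewrite -sin2cos2 !exprMn [(sin u ^+ 2)%R]sin2cos2; ring.
have lt1 : (cos t ^+ 2 + (sin t * cos u) ^+ 2 < 1)%R.
  by rewrite -subr_gt0 opprD addrA E exprn_gt0// mulr_gt0.
rewrite /f /disc_density /= lt1 E sqrtr_sqr gtr0_norm ?mulr_gt0// -EFinM divfK//.
by rewrite gt_eqF ?mulr_gt0.
Qed.

(** Longitudes in ]0, pi[ give the half sphere y > 0, and the reflection u -> 2 pi - u reduces the
    other half to the same interval. Unlike the spherical coordinates, the resulting formula treats
    x and z alike. *)
Lemma sphere_measure_discE A : measurable A ->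
  sphere_measure A = 
    \int[lam]_z \int[lam]_x (disc_density false A (z, x) + disc_density true A (z, x)).
Proof.
move=> mA; rewrite sphere_measureE//.
pose D p := disc_density false A p + disc_density true A p.
have mD : @measurable_fun _ _ T2 _ setT D.
  by apply: emeasurable_funD; exact: measurable_disc_density.
have D0 p : 0 <= D p by apply: adde_ge0; exact: disc_density_ge0.
have mF := @measurable_fun_fubini_tonelli_F _ _ _ _ _ lam _ mD D0.
pose K := fubini_F lam D.
have K0 z : 0 <= K z by apply: integral_ge0 => x _; exact: D0.
transitivity (\int[lam]_(z in `](-1)%R, 1%R[) K z); last first.
  rewrite integral_mkcond; apply: eq_integral => z _; rewrite patchE.
  case: ifPn => // z1; apply/esym; apply: integral0_eq => x _.
  rewrite /D /disc_density /=; case: ifPn => [h|_]; last by rewrite adde0.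
  exfalso; move/negP: z1; apply; rewrite inE/= in_itv/= -ltr_norml.
  rewrite -ltr_sqr ?nnegrE// real_normK ?num_real// expr1n.
  by rewrite (le_lt_trans _ h)// lerDl sqr_ge0.
rewrite -(@ge0_integral_cos _ 1 K)//; apply: eq_integral => t.
rewrite inE/= in_itv/= => tpi; rewrite !mul1r muleC; congr (_ * _).
have mi B : measurable_fun B (fun u => (\1_A (sphere_pt (t, u)))%:E : \bar R) by exact: measurable_indic_slice.
have m2 : (pi < 2 * pi :> R)%R by rewrite ltr_pMl ?pi_gt0// ltr1n.
rewrite (@integral_itv_bndoo _ 0%R (2 * pi)%R _ true true)//.
transitivity (\int[lam]_(u in `]0%R, pi[) (\1_A (sphere_pt (t, u)))%:E +
   \int[lam]_(u in `]pi, (2 * pi)%R[) (\1_A (sphere_pt (t, u)))%:E).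
  rewrite -(@integral_itv_bndoo _ pi (2 * pi)%R _ true true)//.
  rewrite -ge0_integral_setU//=.
  - congr (integral _ _ _); apply/seteqP; split => x /=; rewrite !in_itv/=.
      by case: (ltP x pi) => xb /andP[-> ->]; [left|right].
    move=> [/andP[-> /=]|/andP[h ->]].
      by move/lt_trans; apply.
    by rewrite (lt_le_trans (pi_gt0 R)).
  - exact: mi.
  - apply/disj_setPS => x [/=]; rewrite !in_itv/= => /andP[_ xb] /andP[bx _].
    by move: xb; rewrite ltNge bx.
have -> : \int[lam]_(u in `]pi, (2 * pi)%R[) (\1_A (sphere_pt (t, u)))%:E =
  \int[lam]_(u in `]0%R, pi[) (\1_A (sphere_pt (t, (2 * pi - u)%R)))%:E.
  rewrite integral_mkcond [RHS]integral_mkcond.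
  rewrite -(@ge0_integral_reflect _ _ (2 * pi)%R)//.
  - apply: eq_integral => u _; rewrite !patchE; congr (if _ then _ else _).
    apply/idP/idP; rewrite !inE/= !in_itv/= => /andP[h1 h2]; apply/andP; split; lra.
  - by apply/(measurable_restrictT _ _).1 => //; exact: measurable_indic_slice.
  - by move=> x; rewrite patchE; case: ifP.
have h0 := half_circleE false mA tpi.
have h1 := half_circleE true mA tpi.
transitivity (\int[lam]_(u in `]0%R, pi[)
     (\1_A (vec3 (sin t * cos u) ((-1) ^+ false * (sin t * sin u)) (cos t)))%:E +
   \int[lam]_(u in `]0%R, pi[)
     (\1_A (vec3 (sin t * cos u) ((-1) ^+ true * (sin t * sin u)) (cos t)))%:E).
  congr (_ + _); apply: eq_integral => u _; rewrite sphere_ptE ?expr0 ?mul1r//.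
  rewrite expr1 mulN1r -mulrN; congr ((\1_A (vec3 _ _ _))%:E).
    by rewrite mulr_natl addrC cosD2pi cosN.
  by rewrite mulr_natl addrC sinD2pi sinN.
rewrite h0 h1 /K /fubini_F -ge0_integralD//=.
- by move=> x _; exact: disc_density_ge0.
- exact: (measurableT_comp (measurable_disc_density false mA) (pair1_measurable (cos t))).
- by move=> x _; exact: disc_density_ge0.
- exact: (measurableT_comp (measurable_disc_density true mA) (pair1_measurable (cos t))).
Qed.

(** In disc coordinates the exchange of x and z is the exchange of the two integrations. *)
Lemma sphere_symmetry_swapxz : sphere_symmetry swapxz.
Proof.
move=> A mA; rewrite (sphere_measure_discE (measurable_preim_mulmx swapxz mA)).
rewrite (sphere_measure_discE mA).
pose D p := disc_density false A p + disc_density true A p.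
have mD : @measurable_fun _ _ T2 _ setT D.
  by apply: emeasurable_funD; exact: measurable_disc_density.
have D0 p : 0 <= D p by apply: adde_ge0; exact: disc_density_ge0.
have := @fubini_tonelli _ _ _ _ _ lam lam _ mD D0.
rewrite /fubini_F /fubini_G => ->.
apply: eq_integral => z _; apply: eq_integral => x _.
rewrite /D /disc_density /= [(z ^+ 2 + _)%R]addrC.
rewrite (_ : 1 - z ^+ 2 - x ^+ 2 = 1 - x ^+ 2 - z ^+ 2)%R; last by rewrite addrAC.
by rewrite !(indic_preim (fun y => swapxz *m y)) !swapxz_vec3.
Qed.

End SphereSymmetries.

(** * From axial rotations to the whole of SO(3) *)

Section Rotations.
Context (R : realType).
Implicit Types (u g : 'M[R]_3) (x : 'cV[R]_3).

Lemma det3E u : \det u =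
  u 0 0 * (u 1 1 * u 2 2 - u 1 2 * u 2 1) - u 0 1 * (u 1 0 * u 2 2 - u 1 2 * u 2 0)
  + u 0 2 * (u 1 0 * u 2 1 - u 1 1 * u 2 0).
Proof.
have [F E] : exists F : nat -> nat -> R, forall i j, u i j = F i j.
  by exists (fun a b => u (inord a) (inord b)) => i j; rewrite !inord_val.
have det2 (M : 'M[R]_2) : \det M = M 0 0 * M 1 1 - M 0 1 * M 1 0.
  rewrite (expand_det_row _ 0) !big_ord_recl big_ord0 addr0 /cofactor.
  rewrite !det_mx11 !mxE /= expr0 expr1 mul1r mulN1r mulrN.
  by congr (M _ _ * M _ _ - M _ _ * M _ _); exact/val_inj.
rewrite (expand_det_row _ 0) sum3 /cofactor !det2 !mxE !E /= /bump /=.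
by rewrite -signr_odd /= expr0 expr1 -signr_odd /= expr0; ring.
Qed.

Lemma SO3_mul u g : SO3 u -> SO3 g -> SO3 (u *m g).
Proof.
move=> [u1 du] [g1 dg]; split; last by rewrite det_mulmx du dg mulr1.
by rewrite trmx_mul mulmxA -(mulmxA u) g1 mulmx1.
Qed.

Lemma SO3_trK u : SO3 u -> u^T *m u = 1%:M.
Proof. by move=> [/mulmx1C]. Qed.

Lemma SO3_tr u : SO3 u -> SO3 u^T.
Proof. by move=> su; split; rewrite ?trmxK ?SO3_trK// det_tr; case: su. Qed.

Lemma sphereE x : sphere x <-> x 0 0 ^+ 2 + x 1 0 ^+ 2 + x 2 0 ^+ 2 = 1.
Proof. by rewrite /sphere /= sum3. Qed.

Lemma mx11_norm x : (x^T *m x) 0 0 = \sum_(i < 3) x i 0 ^+ 2.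
Proof. by rewrite mxE; apply: eq_bigr => i _; rewrite mxE expr2. Qed.

Lemma sphere_mulmx u x : u^T *m u = 1%:M -> sphere (u *m x) = sphere x.
Proof.
by move=> u1; rewrite /sphere /= -!mx11_norm trmx_mul mulmxA -(mulmxA _ u^T) u1 mulmx1.
Qed.

Lemma rotz_SO3 (a : R) : SO3 (rotz a).
Proof.
split; last first.
  by rewrite det3E !mxE /= -[RHS](cos2Dsin2 a); ring.
apply/matrixP => i j; rewrite !mxE sum3 !mxE.
have h := cos2Dsin2 a; case: i => [[|[|[|//]]] hi]; case: j => [[|[|[|//]]] hj] /=; lra.
Qed.

Lemma swapxz_tr : swapxz R *m (swapxz R)^T = 1%:M.
Proof.
apply/matrixP => i j; rewrite !mxE sum3 !mxE.
by case: i => [[|[|[|//]]] hi]; case: j => [[|[|[|//]]] hj] /=; ring.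
Qed.

Lemma swapxzK : swapxz R *m swapxz R = 1%:M.
Proof.
apply/matrixP => i j; rewrite !mxE sum3 !mxE.
by case: i => [[|[|[|//]]] hi]; case: j => [[|[|[|//]]] hj] /=; ring.
Qed.

(** Conjugation by the reflection [swapxz] turns the axis z into the axis x. The reflection occurs
    twice, so the determinant is one, and the invariance of the surface measure is inherited from
    the three factors. *)
Definition rotx (a : R) := swapxz R *m rotz a *m swapxz R.

Lemma rotx_SO3 (a : R) : SO3 (rotx a).
Proof.
have [h d] := rotz_SO3 a; split.
  rewrite /rotx !trmx_mul !mulmxA -[X in X *m _ *m _]mulmxA swapxz_tr mulmx1.
  by rewrite -[X in X *m _]mulmxA h mulmx1 swapxz_tr.
by rewrite /rotx !det_mulmx d mulr1 -det_mulmx swapxzK det1.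
Qed.

Lemma sphere_symmetry_rotx (a : R) : 0 <= a < 2 * pi -> sphere_symmetry (rotx a).
Proof.
move=> h; apply: sphere_symmetryM; last exact: sphere_symmetry_swapxz.
apply: sphere_symmetryM; first exact: sphere_symmetry_swapxz.
exact: sphere_symmetry_rotz.
Qed.

Lemma unit_circle_angle (c s : R) : c ^+ 2 + s ^+ 2 = 1 ->
  exists2 a : R, 0 <= a < 2 * pi & cos a = c /\ sin a = s.
Proof.
move=> cs.
have c11 : -1 <= c <= 1.
  by rewrite -ler_norml -(ler_pXn2r (_ : 0 < 2)%N) ?nnegrE// real_normK ?num_real// expr1n; nra.
have Es : Num.sqrt (1 - c ^+ 2) = `|s| by rewrite -sqrtr_sqr; congr Num.sqrt; lra.
have ca : cos (acos c) = c by rewrite acosK.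
have sa : sin (acos c) = `|s| by rewrite sin_acos.
have a0 := acos_ge0 c11; have api := acos_lepi c11; have p0 := pi_gt0 R.
have [s0|s0] := leP 0 s.
  exists (acos c); last by rewrite ca sa ger0_norm.
  by rewrite a0; lra.
exists (2 * pi - acos c).
  have : 0 < acos c.
    rewrite acos_gt0//; case/andP: c11 => -> c1 /=; rewrite lt_neqAle c1 andbT.
    by apply/eqP => c1'; move: cs s0; rewrite c1'; nra.
  by move=> h; apply/andP; split; lra.
have e : 2 * pi - acos c = - acos c + pi *+ 2 by rewrite mulr_natl addrC.
by rewrite e cosD2pi sinD2pi cosN sinN ca sa ltr0_norm ?opprK.
Qed.

Definition e3 : 'cV[R]_3 := vec3 0 0 1.

Lemma rotz_rotx_e3 (a t : R) :
  (rotz a *m rotx t) *m e3 = vec3 (- (sin t * sin a)) (sin t * cos a) (cos t).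
Proof.
rewrite /rotx /e3 -!mulmxA swapxz_vec3 rotz_vec3 swapxz_vec3 rotz_vec3.
congr vec3; ring.
Qed.

Lemma sphere_orbit x : sphere x -> exists a t : R, [/\ 0 <= a < 2 * pi,
  0 <= t < 2 * pi & (rotz a *m rotx t) *m e3 = x].
Proof.
move=> /sphereE sx; have z11 : -1 <= x 2 0 <= 1.
  by rewrite -ler_norml -(ler_pXn2r (_ : 0 < 2)%N) ?nnegrE// real_normK ?num_real// expr1n; nra.
have p0 := pi_gt0 R.
have tpi : 0 <= acos (x 2 0) < 2 * pi.
  have := acos_ge0 z11; have := acos_lepi z11; move=> h1 h2; rewrite h2; lra.
pose t := acos (x 2 0).
have ct : cos t = x 2 0 by rewrite acosK.
have st : sin t ^+ 2 = x 0 0 ^+ 2 + x 1 0 ^+ 2 by rewrite sin2cos2 ct; lra.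
(* At the poles the longitude is undetermined, and the angle 0 is taken. *)
have [s0|s0] := eqVneq (sin t) 0.
  exists 0, t; split => //; first by lra.
  have [x0 x1] : x 0 0 = 0 /\ x 1 0 = 0.
    by move: st; rewrite s0 expr0n/=; split; nra.
  by rewrite rotz_rotx_e3 s0 ct [RHS]vec3_eta x0 x1; congr vec3; ring.
(* The image of the pole has longitude a + pi / 2, whence the exchanged coordinates and the sign. *)
have [|a ha [ca sa]] := @unit_circle_angle (x 1 0 / sin t) (- x 0 0 / sin t).
  by rewrite !expr_div_n sqrrN -mulrDl addrC -st divff// expf_neq0.
exists a, t; split => //.
rewrite rotz_rotx_e3 ca sa ct [RHS]vec3_eta; congr vec3.
  by rewrite mulrC divfK// opprK.
by rewrite mulrC divfK.
Qed.

Lemma SO3_fix_e3 u : SO3 u -> u *m e3 = e3 -> exists2 c, 0 <= c < 2 * pi & u = rotz c.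
Proof.
move=> [u1 du] ue.
have u02 : u 0 2 = 0 by have /matrixP/(_ 0 0) := ue; rewrite mulmx3E /e3 !vec3E; lra.
have u12 : u 1 2 = 0 by have /matrixP/(_ 1 0) := ue; rewrite mulmx3E /e3 !vec3E; lra.
have u22 : u 2 2 = 1 by have /matrixP/(_ 2 0) := ue; rewrite mulmx3E /e3 !vec3E; lra.
have r i j : u i 0 * u j 0 + u i 1 * u j 1 + u i 2 * u j 2 = (i == j)%:R.
  by have /matrixP/(_ i j) := u1; rewrite !mxE sum3 !mxE.
have := r 2 2; rewrite u22 /= => h22.
have u20 : u 2 0 = 0 by nra.
have u21 : u 2 1 = 0 by nra.
have h00 := r 0 0; have h11 := r 1 1; have h01 := r 0 1.
move: h00 h11 h01; rewrite u02 u12 /= => h00 h11 h01.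
move: du; rewrite det3E u02 u12 u22 u20 u21 => du.
(* The two rows have norm one and the block has determinant one, so this sum of squares is 2 - 2;
   its vanishing makes the block a plane rotation. *)
have S : (u 1 1 - u 0 0) ^+ 2 + (u 0 1 + u 1 0) ^+ 2 = 0 by lra.
have /eqP := S; rewrite paddr_eq0 ?sqr_ge0// !sqrf_eq0 subr_eq0 addr_eq0.
move=> /andP[/eqP e1 /eqP e2].
have [|c hc [cc sc]] := @unit_circle_angle (u 0 0) (u 1 0); first by rewrite -e1; nra.
exists c => //; apply/matrixP => i j; rewrite mxE cc sc.
case: i => [[|[|[|//]]] hi]; case: j => [[|[|[|//]]] hj] /=.
- by rewrite -[RHS]/(u 0 0); congr (u _ _); exact/val_inj.
- by rewrite -e2; congr (u _ _); exact/val_inj.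
- by rewrite -u02; congr (u _ _); exact/val_inj.
- by congr (u _ _); exact/val_inj.
- by rewrite -e1; congr (u _ _); exact/val_inj.
- by rewrite -u12; congr (u _ _); exact/val_inj.
- by rewrite -u20; congr (u _ _); exact/val_inj.
- by rewrite -u21; congr (u _ _); exact/val_inj.
- by rewrite -u22; congr (u _ _); exact/val_inj.
Qed.

Lemma sphere_e3 : sphere e3.
Proof. by apply/sphereE; rewrite /e3 !vec3E; ring. Qed.

(** Euler decomposition: some v = rotz a rotx t agrees with u at the pole, so v^T u fixes the pole
    and is a rotation about the axis z. *)
Lemma sphere_symmetry_SO3 u : SO3 u -> sphere_symmetry u.
Proof.
move=> su.
have sx : sphere (u *m e3) by rewrite sphere_mulmx ?SO3_trK//; exact: sphere_e3.
have [a [t [ha ht]]] := sphere_orbit sx; set v := _ *m rotx t => vE.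
have sv : SO3 v by apply: SO3_mul; [exact: rotz_SO3|exact: rotx_SO3].
have [c hc wE] : exists2 c, 0 <= c < 2 * pi & v^T *m u = rotz c.
  apply: SO3_fix_e3; first by apply: SO3_mul => //; exact: SO3_tr.
  by rewrite -mulmxA -vE mulmxA SO3_trK// mul1mx.
have -> : u = v *m rotz c by rewrite -wE mulmxA; case: sv => -> _; rewrite mul1mx.
apply: sphere_symmetryM; last exact: sphere_symmetry_rotz.
apply: sphere_symmetryM; first exact: sphere_symmetry_rotz.
exact: sphere_symmetry_rotx.
Qed.

End Rotations.

(** * Orthonormality of the spherical harmonics *)

Section ComplexIntegral.
Local Open Scope complex_scope.
Local Open Scope ring_scope.
Context (R : realType).
Local Notation C := R[i].
Local Notation Re := (@complex.Re R).
Local Notation Im := (@complex.Im R).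

Lemma ReD (a b : C) : Re (a + b) = Re a + Re b. Proof. by case: a; case: b. Qed.
Lemma ImD (a b : C) : Im (a + b) = Im a + Im b. Proof. by case: a; case: b. Qed.
Lemma ReM (a b : C) : Re (a * b) = Re a * Re b - Im a * Im b.
Proof. by case: a; case: b. Qed.
Lemma ImM (a b : C) : Im (a * b) = Re a * Im b + Im a * Re b.
Proof. by case: a; case: b. Qed.
Lemma ReJ (a : C) : Re a^* = Re a. Proof. by case: a. Qed.
Lemma ImJ (a : C) : Im a^* = - Im a. Proof. by case: a. Qed.

Lemma conjCM (a b : C) : (a * b)^* = a^* * b^*.
Proof. exact: rmorphM. Qed.

Lemma conjCX (a : C) n : (a ^+ n)^* = a^* ^+ n.
Proof. exact: rmorphXn. Qed.

Lemma conjCK' (a : C) : (a^*)^* = a.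
Proof. exact: conjCK. Qed.

Lemma conjC_real (a : R) : (a%:C)^* = a%:C.
Proof. by congr (_ +i* _); exact: oppr0. Qed.

Lemma complex_eq (a b : C) : Re a = Re b -> Im a = Im b -> a = b.
Proof. by case: a => a1 a2; case: b => b1 b2 /= -> ->. Qed.

Context d (T : measurableType d) (mu : {measure set T -> \bar R}) (D : set T).
Hypothesis mD : measurable D.

(** Spherical harmonics are polynomial in the coordinates, hence bounded on the sphere, which has
    finite measure. Integrability then reduces to closure of this class under ring operations and
    conjugation. *)
Definition bounded_measurable (f : T -> R) :=
  measurable_fun D f /\ exists M, forall x, D x -> `|f x| <= M.

Definition Cbounded_measurable (f : T -> C) :=
  bounded_measurable (fun x => Re (f x)) /\ bounded_measurable (fun x => Im (f x)).

Definition Cintegrable (f : T -> C) :=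
  mu.-integrable D (fun x => (Re (f x))%:E) /\ mu.-integrable D (fun x => (Im (f x))%:E).

Lemma bounded_measurable_cst c : bounded_measurable (fun=> c).
Proof. by split => //; exists `|c|. Qed.

Lemma bounded_measurableD f g : bounded_measurable f -> bounded_measurable g ->
  bounded_measurable (fun x => f x + g x).
Proof.
move=> [mf [M fM]] [mg [N gN]]; split; first exact: measurable_funD.
by exists (M + N) => x Dx; rewrite (le_trans (ler_normD _ _))// lerD ?fM ?gN.
Qed.

Lemma bounded_measurableM f g : bounded_measurable f -> bounded_measurable g ->
  bounded_measurable (fun x => f x * g x).
Proof.
move=> [mf [M fM]] [mg [N gN]]; split; first exact: measurable_funM.
by exists (M * N) => x Dx; rewrite normrM ler_pM ?fM ?gN.
Qed.

Lemma bounded_measurableN f : bounded_measurable f -> bounded_measurable (fun x => - f x).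
Proof.
move=> bf; have := bounded_measurableM (bounded_measurable_cst (-1)) bf.
by under eq_fun do rewrite mulN1r.
Qed.

Lemma Cbounded_measurable_cst c : Cbounded_measurable (fun=> c).
Proof. by split; exact: bounded_measurable_cst. Qed.

Lemma Cbounded_measurable_real f : bounded_measurable f ->
  Cbounded_measurable (fun x => (f x)%:C).
Proof. by move=> bf; split => //; exact: bounded_measurable_cst. Qed.

Lemma Cbounded_measurableD f g : Cbounded_measurable f -> Cbounded_measurable g ->
  Cbounded_measurable (fun x => f x + g x).
Proof.
move=> [f1 f2] [g1 g2]; split.
  by under eq_fun do rewrite ReD; exact: bounded_measurableD.
by under eq_fun do rewrite ImD; exact: bounded_measurableD.
Qed.

Lemma Cbounded_measurableM f g : Cbounded_measurable f -> Cbounded_measurable g ->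
  Cbounded_measurable (fun x => f x * g x).
Proof.
move=> [f1 f2] [g1 g2]; split.
  under eq_fun do rewrite ReM; apply: bounded_measurableD; first exact: bounded_measurableM.
  by apply: bounded_measurableN; exact: bounded_measurableM.
by under eq_fun do rewrite ImM; apply: bounded_measurableD; exact: bounded_measurableM.
Qed.

Lemma Cbounded_measurableJ f : Cbounded_measurable f -> Cbounded_measurable (fun x => (f x)^*).
Proof.
move=> [f1 f2]; split; first by under eq_fun do rewrite ReJ.
by under eq_fun do rewrite ImJ; exact: bounded_measurableN.
Qed.

Lemma Cbounded_measurableX f n : Cbounded_measurable f -> Cbounded_measurable (fun x => f x ^+ n).
Proof.
move=> bf; elim: n => [|n ih].
  by under eq_fun do rewrite expr0; exact: Cbounded_measurable_cst.
by under eq_fun do rewrite exprS; exact: Cbounded_measurableM.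
Qed.

Lemma Cbounded_measurable_sum (I : finType) (F : I -> T -> C) :
  (forall i, Cbounded_measurable (F i)) -> Cbounded_measurable (fun x => \sum_i F i x).
Proof.
move=> bF; elim: (index_enum I) => [|i s ih].
  by under eq_fun do rewrite big_nil; exact: Cbounded_measurable_cst.
by under eq_fun do rewrite big_cons; exact: Cbounded_measurableD.
Qed.

Lemma bounded_measurable_integrable f : (mu D < +oo)%E -> bounded_measurable f ->
  mu.-integrable D (fun x => (f x)%:E).
Proof.
move=> Doo [mf [M fM]]; apply: measurable_bounded_integrable => //.
by exists M; split; [exact: num_real|move=> x Mx y Dy /=; rewrite (le_trans (fM _ Dy))// ltW].
Qed.

Lemma Cbounded_measurable_integrable f : (mu D < +oo)%E -> Cbounded_measurable f ->
  Cintegrable f.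
Proof. by move=> Doo [f1 f2]; split; exact: bounded_measurable_integrable. Qed.

Lemma eq_Cintegral (f g : T -> C) : (forall x, D x -> f x = g x) ->
  Cintegral mu D f = Cintegral mu D g.
Proof.
by move=> fg; congr (_ +i* _); apply: eq_Rintegral => x /[!inE] Dx; rewrite fg.
Qed.

Lemma CintegralD f g : Cintegrable f -> Cintegrable g ->
  Cintegral mu D (fun x => f x + g x) = Cintegral mu D f + Cintegral mu D g.
Proof.
move=> [f1 f2] [g1 g2]; apply: complex_eq; rewrite ?ReD ?ImD /=.
  by under eq_fun do rewrite ReD; exact: RintegralD.
by under eq_fun do rewrite ImD; exact: RintegralD.
Qed.

Lemma CintegralZl c f : Cintegrable f ->
  Cintegral mu D (fun x => c * f x) = c * Cintegral mu D f.
Proof.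
move=> [f1 f2].
have i1 a : mu.-integrable D (fun x => (a * Re (f x))%:E).
  by under eq_fun do rewrite EFinM; exact: integrableZl.
have i2 a : mu.-integrable D (fun x => (a * Im (f x))%:E).
  by under eq_fun do rewrite EFinM; exact: integrableZl.
apply: complex_eq; rewrite ?ReM ?ImM /=.
  by under eq_fun do rewrite ReM; rewrite (RintegralB mD (i1 _) (i2 _)) (RintegralZl _ mD f1) (RintegralZl _ mD f2).
by under eq_fun do rewrite ImM; rewrite (RintegralD mD (i2 _) (i1 _)) (RintegralZl _ mD f1) (RintegralZl _ mD f2).
Qed.

Lemma CintegrableZl c f : Cintegrable f -> Cintegrable (fun x => c * f x).
Proof.
move=> [f1 f2].
have i1 a : mu.-integrable D (fun x => (a * Re (f x))%:E).
  by under eq_fun do rewrite EFinM; exact: integrableZl.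
have i2 a : mu.-integrable D (fun x => (a * Im (f x))%:E).
  by under eq_fun do rewrite EFinM; exact: integrableZl.
split; [under eq_fun do rewrite ReM EFinB|under eq_fun do rewrite ImM EFinD].
  exact: integrableB.
exact: integrableD.
Qed.

Lemma CintegrableD f g : Cintegrable f -> Cintegrable g -> Cintegrable (fun x => f x + g x).
Proof.
move=> [f1 f2] [g1 g2]; split; [under eq_fun do rewrite ReD EFinD|under eq_fun do rewrite ImD EFinD];
  exact: integrableD.
Qed.

Lemma Cintegral0 : Cintegral mu D (fun=> 0) = 0.
Proof. by congr (_ +i* _); rewrite /Rintegral integral0. Qed.

Lemma Cintegrable0 : Cintegrable (fun=> 0).
Proof. by split; exact: integrable0. Qed.

Lemma Cintegral_sum (I : finType) (F : I -> T -> C) : (forall i, Cintegrable (F i)) ->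
  Cintegral mu D (fun x => \sum_i F i x) = \sum_i Cintegral mu D (F i).
Proof.
move=> iF.
have [//] : Cintegrable (fun x => \sum_i F i x) /\
  Cintegral mu D (fun x => \sum_i F i x) = \sum_i Cintegral mu D (F i).
elim: (index_enum I) => [|i s [ih1 ih2]].
  rewrite big_nil; under eq_fun do rewrite big_nil.
  by split; [exact: Cintegrable0|exact: Cintegral0].
rewrite big_cons; under eq_fun do rewrite big_cons.
by split; [exact: CintegrableD|rewrite CintegralD// ih2].
Qed.

Lemma CintegralJ f : Cintegrable f ->
  Cintegral mu D (fun x => (f x)^*) = (Cintegral mu D f)^*.
Proof.
move=> [f1 f2]; apply: complex_eq; rewrite ?ReJ ?ImJ /=.
  by under eq_fun do rewrite ReJ.
under eq_fun do rewrite ImJ -mulN1r.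
by rewrite RintegralZl// mulN1r.
Qed.

End ComplexIntegral.

(** * Integrals over the sphere: functions of the height and rotated functions *)

Section SphereIntegrals.
Local Open Scope complex_scope.
Context (R : realType).
Notation lam := (@lebesgue_measure R).
Notation sigma := (@sphere_measure R).

Lemma measurable_sphere : measurable (@sphere R).
Proof.
have mf : measurable_fun setT (fun x : 'cV[R]_3 => \sum_(i < 3) x i 0 ^+ 2).
  by apply: measurable_sum => i; apply: measurable_funX; exact: measurable_entry.
by have := mf measurableT [set 1] (measurable_set1 _); rewrite setTI.
Qed.

Lemma sphere_sphere_pt (p : R * R) : sphere (sphere_pt p).
Proof.
case: p => t u; rewrite sphere_ptE; apply/sphereE; rewrite !vec3E.
have := cos2Dsin2 t; have := cos2Dsin2 u => h1 h2.
rewrite !exprMn -mulrDr h1 mulr1; lra.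
Qed.

Lemma sphere_measure_setC : sigma (~` @sphere R) = 0%E.
Proof.
rewrite /sphere_measure (_ : _ `&` _ = set0) ?integral_set0//.
by rewrite -subset0 => p [_ /=]; apply; exact: sphere_sphere_pt.
Qed.

Lemma integral_sphereT (f : 'cV[R]_3 -> \bar R) : measurable_fun setT f ->
  (forall x, 0 <= f x)%E ->
  (\int[sigma]_(x in sphere) f x = \int[sigma]_x f x)%E.
Proof.
move=> mf f0; rewrite [RHS](@ge0_negligible_integral _ _ _ _ _ (~` @sphere R))//.
- by rewrite setTD setCK.
- by apply: measurableC; exact: measurable_sphere.
- exact: sphere_measure_setC.
Qed.

(* Archimedes' hat-box theorem *)
Lemma ge0_integral_height (f : R -> \bar R) : measurable_fun setT f ->
  (forall x, 0 <= f x)%E ->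
  (\int[sigma]_(x in sphere) f (x 2 0)%R = (2 * pi)%:E * \int[lam]_(z in `](-1)%R, 1%R[) f z)%E.
Proof.
move=> mf f0.
have mz : @measurable_fun _ _ _ (measurableTypeR R) setT (fun x : 'cV[R]_3 => x 2 0).
  exact: measurable_entry.
pose w : R -> R := fun z => 2 * pi * \1_(`](-1), 1[) z.
have mw : @measurable_fun _ _ (measurableTypeR R) _ setT w.
  by apply: measurable_funM => //; exact: measurable_indic.
have w0 z : 0 <= w z by rewrite /w mulr_ge0// mulr_ge0// pi_ge0.
have mf' : @measurable_fun _ _ (measurableTypeR R) _ setT f := mf.
rewrite (@integral_sphereT (fun x => f (x 2 0)))//; last exact: (measurableT_comp mf' mz).
transitivity (\int[mpushforward sigma mz]_z f z)%E.
  by rewrite ge0_integral_pushforward.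
rewrite (eq_measure_integral (mdensity lam mw w0)).
  rewrite ge0_integral_mdensity// -ge0_integralZl//.
  - rewrite [RHS]integral_mkcond; apply: eq_integral => z _; rewrite patchE /w indicE.
    by case: ifPn => _; rewrite ?mulr1 ?mulr0 ?mule0// muleC.
  - exact: measurable_funTS.
  - by rewrite lee_fin mulr_ge0// pi_ge0.
move=> B mB _ /=; rewrite /pushforward sphere_measureE; last first.
  by rewrite -[X in measurable X]setTI; exact: mz.
have mIB : @measurable_fun _ _ (measurableTypeR R) _ setT (\1_B : _ -> R).
  exact: measurable_indic.
pose k z := ((2 * pi)%:E * (\1_B z)%:E : \bar R)%E.
transitivity (\int[lam]_(t in `]0%R, pi[) (k (1 * cos t)%R * (1 * sin t)%:E))%E.
  apply: eq_integral => t _; rewrite !mul1r muleC; congr (_ * _)%E.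
  under eq_integral do rewrite (indic_preim _ (fun x : 'cV[R]_3 => x 2 0)) sphere_ptE vec3E.
  rewrite integral_cst; last exact: measurable_itv.
  rewrite /= lebesgue_measure_itv/= lte_fin mulr_gt0 ?pi_gt0// sube0 /k muleC//.
rewrite (@ge0_integral_cos _ 1 k)//.
- rewrite /mdensity [LHS]integral_mkcond [RHS]integral_mkcond; apply: eq_integral => z _.
  rewrite !patchE /k /w !indicE.
  by case: (z \in B); case: (z \in `](-1), 1[%classic); rewrite /= ?mule1 ?mule0 ?mulr1 ?mulr0.
- by apply: measurable_funeM; apply/measurable_EFinP; exact: mIB.
- by move=> x; rewrite /k mule_ge0// lee_fin mulr_ge0// pi_ge0.
Qed.

Lemma sphere_measure_sphere : sigma (@sphere R) = (4 * pi)%:E.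
Proof.
have := @ge0_integral_height (cst 1%E); rewrite !integral_cst//=; last exact: measurable_sphere.
rewrite !mul1e => ->//; have lt11 : -1 < 1 :> R by lra.
by rewrite lebesgue_measure_itv/= lte_fin lt11 -EFinB -EFinM; congr EFin; ring.
Qed.

Lemma sphere_measure_lty : (sigma (@sphere R) < +oo)%E.
Proof. by rewrite sphere_measure_sphere ltry. Qed.

Lemma Rintegral_height (f : R -> R) : measurable_fun setT f ->
  (exists M, forall z, -1 <= z <= 1 -> `|f z| <= M) ->
  Rintegral sigma sphere (fun x => f (x 2 0)) = 2 * pi * Rintegral lam `](-1), 1[ f.
Proof.
move=> mf [M fM].
have mfE : measurable_fun setT (EFin \o f) by exact/measurable_EFinP.
have intf : lam.-integrable `](-1), 1[ (EFin \o f).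
  apply: measurable_bounded_integrable => //.
  - by rewrite /= lebesgue_measure_itv/= lte_fin; case: ifP; rewrite // ltry.
  - exact: measurable_funTS.
  - exists M; split; [exact: num_real|move=> x Mx y /= ].
    rewrite in_itv/= => /andP[y1 y2]; rewrite (le_trans (fM _ _)) ?(ltW Mx)//.
    by rewrite !ltW.
rewrite /Rintegral [X in fine X = _]integralE.
have -> : (\int[sigma]_(x in sphere) (fun x0 : 'cV_3 => (f (x0 2 0))%:E)^\+ x =
    \int[sigma]_(x in sphere) (EFin \o f)^\+ (x 2 0)%R)%E.
  by apply: eq_integral => x _; rewrite !funeposE.
have -> : (\int[sigma]_(x in sphere) (fun x0 : 'cV_3 => (f (x0 2 0))%:E)^\- x =
    \int[sigma]_(x in sphere) (EFin \o f)^\- (x 2 0)%R)%E.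
  by apply: eq_integral => x _; rewrite !funenegE.
rewrite !ge0_integral_height//; try exact: measurable_funepos; try exact: measurable_funeneg.
rewrite [in RHS]integralE -muleBr//; last first.
  by apply: fin_num_adde_defr; exact: integrable_pos_fin_num.
rewrite fineM//; rewrite fin_numB.
by rewrite integrable_pos_fin_num// integrable_neg_fin_num.
Qed.

Lemma Cintegral_SO3 (g : 'M[R]_3) (f : 'cV[R]_3 -> R[i]) : SO3 g ->
  Cbounded_measurable sphere f ->
  Cintegral sigma sphere (fun x => f (g *m x)) = Cintegral sigma sphere f.
Proof.
move=> sg bf.
have pre : (fun x => g *m x) @^-1` (@sphere R) = @sphere R.
  by apply/funext => x; rewrite /preimage /= sphere_mulmx// SO3_trK.
have msph := measurable_sphere.
have K (h : 'cV[R]_3 -> R) : bounded_measurable sphere h ->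
    Rintegral sigma sphere (fun x => h (g *m x)) = Rintegral sigma sphere h.
  move=> [mh [M hM]]; rewrite /Rintegral; congr fine.
  (* The function h is measurable on the sphere only; its extension by zero is measurable
     everywhere, and can be integrated against the image measure. *)
  pose k := h \_ (@sphere R).
  have mk : measurable_fun setT k by apply/(measurable_restrictT _ _).1.
  have kE x : sphere x -> k x = h x by move=> sx; rewrite /k patchE mem_set.
  have mg := measurable_mulmx g.
  transitivity (\int[sigma]_(x in sphere) (k (g *m x))%:E)%E.
    apply: eq_integral => x; rewrite inE => sx; rewrite kE//.
    by rewrite -pre in sx.
  transitivity (\int[mpushforward sigma mg]_(x in sphere) (k x)%:E)%E.
    rewrite integral_pushforward//.
    - by rewrite pre.
    - exact/measurable_EFinP.
    - rewrite pre; apply: bounded_measurable_integrable => //.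
      + exact: sphere_measure_lty.
      + split; first by apply: measurable_funTS; exact: (measurableT_comp mk mg).
        exists M => x sx; have sgx : sphere (g *m x) by rewrite -pre in sx.
        by rewrite /= kE// hM.
  transitivity (\int[sigma]_(x in sphere) (k x)%:E)%E.
    apply: eq_measure_integral => A mA _.
    by have := sphere_symmetry_SO3 sg mA.
  by apply: eq_integral => x; rewrite inE => sx; rewrite kE.
by congr (_ +i* _)%C; apply: K => //; case: bf.
Qed.

End SphereIntegrals.

(** * Rodrigues' formula and the orthogonality of associated Legendre functions *)

Section PolynomialIntegral.
Context (R : realType).
Implicit Types p q w : {poly R}.

Definition primitive p : {poly R} := \poly_(i < (size p).+1) (p`_i.-1 / i%:R).

Lemma deriv_primitive p : (primitive p)^`() = p.
Proof.
apply/polyP => i; rewrite coef_deriv coef_poly /= ltnS.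
case: ltnP => ip; last by rewrite mul0rn nth_default.
by rewrite -[LHS]mulr_natr divfK// pnatr_eq0.
Qed.

Lemma deriv_eq0 p : p^`() = 0 -> p = (p`_0)%:P.
Proof.
move=> p0; apply/polyP => -[|i]; rewrite coefC//=.
have /polyP/(_ i) := p0; rewrite coef_deriv coef0 => /eqP.
by rewrite mulrn_eq0/= => /eqP.
Qed.

(** The integral over [-1, 1] in algebraic form: integration by parts and orthogonality become
    polynomial identities, and [Rintegral_horner] returns to the Lebesgue integral. *)
Definition integral11 p : R := (primitive p).[1] - (primitive p).[-1].

Lemma integral11_deriv p : integral11 p^`() = p.[1] - p.[-1].
Proof.
rewrite /integral11; set P := primitive _.
have : (P - p)^`() = 0 by rewrite derivB deriv_primitive subrr.
move/deriv_eq0; set c := _`_0 => /eqP; rewrite subr_eq => /eqP ->.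
by rewrite !hornerD !hornerC; ring.
Qed.

Lemma integral11D p q : integral11 (p + q) = integral11 p + integral11 q.
Proof.
rewrite -[in LHS](deriv_primitive p) -[in LHS](deriv_primitive q) -derivD.
by rewrite integral11_deriv /integral11 !hornerD; ring.
Qed.

Lemma integral11Z c p : integral11 (c *: p) = c * integral11 p.
Proof.
rewrite -[in LHS](deriv_primitive p) -derivZ integral11_deriv /integral11 !hornerZ; ring.
Qed.

Lemma integral11B p q : integral11 (p - q) = integral11 p - integral11 q.
Proof. by rewrite integral11D -scaleN1r integral11Z mulN1r. Qed.

Lemma integral11_by_parts n w q :
  (forall k, (k < n)%N -> (w^`(k)).[1] = 0 /\ (w^`(k)).[-1] = 0) ->
  integral11 (w^`(n) * q) = (-1) ^+ n * integral11 (w * q^`(n)).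
Proof.
elim: n q => [|n ih] q wn; first by rewrite expr0 mul1r.
have [w1 w2] := wn n (leqnn _).
have E : w^`(n.+1) * q = (w^`(n) * q)^`() - w^`(n) * q^`().
  by rewrite derivM derivnS addrK.
rewrite E integral11B integral11_deriv !hornerM w1 w2 !mul0r subrr sub0r.
rewrite ih; last by move=> k kn; apply: wn; exact: ltnW.
by rewrite exprS mulN1r mulNr -derivSn.
Qed.

Lemma Rintegral_horner p :
  Rintegral (@lebesgue_measure R) `](-1), 1[ (fun z => p.[z]) = integral11 p.
Proof.
rewrite /Rintegral -(@integral_itv_bndoo _ _ _ _ true false); last first.
  apply/measurable_EFinP; apply: measurable_funTS; apply: continuous_measurable_fun.
  exact: continuous_horner.
rewrite (@continuous_FTC2 _ _ (horner (primitive p)))//.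
- by apply: continuous_subspaceT => x; exact: continuous_horner.
- split.
  + by move=> x _; exact: derivable_horner.
  + by apply: cvg_at_right_filter; exact: continuous_horner.
  + by apply: cvg_at_left_filter; exact: continuous_horner.
- by move=> x _; rewrite -derivE deriv_primitive.
Qed.

Lemma derivn_root_exp a n q k : (k < n)%N -> (((('X - a%:P) ^+ n) * q)^`(k)).[a] = 0.
Proof.
elim: k n q => [|k ih] n q kn.
  by rewrite derivn0 hornerM horner_exp hornerXsubC subrr expr0n; case: n kn => //= n; rewrite mul0r.
case: n kn => // n kn.
rewrite derivSn (_ : _^`() = ('X - a%:P) ^+ n * (q *+ n.+1 + ('X - a%:P) * q^`())).
  exact: ih.
by rewrite derivM deriv_exp derivXsubC mul1r /= mulrDr mulrnAl mulrnAr mulrA -exprSr.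
Qed.

Definition rodrigues l : {poly R} := ('X^2 - 1) ^+ l.

Lemma rodriguesE l : rodrigues l = ('X - 1%:P) ^+ l * ('X - (-1)%:P) ^+ l.
Proof. by rewrite /rodrigues -exprMn polyCN; congr (_ ^+ _); ring. Qed.

Lemma derivn_rodrigues_root l k q : (k < l)%N ->
  ((rodrigues l * q)^`(k)).[1] = 0 /\ ((rodrigues l * q)^`(k)).[-1] = 0.
Proof.
move=> kl; rewrite rodriguesE; split; first by rewrite -mulrA derivn_root_exp.
by rewrite [X in (X * q)^`(k)]mulrC -mulrA derivn_root_exp.
Qed.

Lemma rodrigues_monic l : rodrigues l \is monic.
Proof. by rewrite monic_exp// -polyC1 monicXnsubC. Qed.

Lemma size_rodrigues l : size (rodrigues l) = (2 * l).+1.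
Proof.
have := size_exp ('X^2 - 1%:P : {poly R}) l; rewrite size_XnsubC// polyC1 -/(rodrigues l) => /= <-.
by rewrite prednK// size_poly_gt0 monic_neq0// rodrigues_monic.
Qed.

Lemma lead_rodrigues l : (rodrigues l)`_(2 * l) = 1.
Proof.
by have /monicP := rodrigues_monic l; rewrite lead_coefE size_rodrigues.
Qed.

Lemma coefM_top p q a b : (size p <= a.+1)%N -> (size q <= b.+1)%N ->
  (p * q)`_(a + b) = p`_a * q`_b.
Proof.
move=> pa qb; have ha : (a < (a + b).+1)%N by rewrite ltnS leq_addr.
rewrite coefM (bigD1 (Ordinal ha))//= addKn big1 ?addr0// => i ia.
have [h|h] := ltnP a i; first by rewrite (nth_default _ (leq_trans pa h)) mul0r.
have {}h : (i < a)%N by rewrite ltn_neqAle h andbT; apply: contra ia => /eqP e; apply/eqP/val_inj.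
rewrite [X in _ * X]nth_default ?mulr0// (leq_trans qb)//.
by rewrite ltn_subRL ltn_add2r.
Qed.

Lemma size_derivn_leq p n : (size p^`(n) <= size p - n)%N.
Proof.
apply/leq_sizeP => j; rewrite leq_subLR => h.
by rewrite coef_derivn nth_default// mul0rn.
Qed.

Definition legendre_coef l : R := ((2 ^ l * l`!)%:R)^-1.

Lemma derivn_legendre l m : (legendre l)^`(m) = legendre_coef l *: (rodrigues l)^`(m + l).
Proof. by rewrite /legendre derivnZ -/(legendre_coef l) /derivn iterD. Qed.

(** The derivative of X (X^2 - 1)^(l+1) is (2l+3)(X^2 - 1)^(l+1) + (2l+2)(X^2 - 1)^l. The primitive
    vanishes at both endpoints, so the integrals satisfy a two-term recursion. *)
Lemma integral_rodrigues l : (2 * l + 1)%:R * integral11 (rodrigues l) =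
  (-1) ^+ l * 2 * (2 ^ l * l`!)%:R ^+ 2 / (2 * l)`!%:R.
Proof.
elim: l => [|l ih].
  rewrite /rodrigues !expr0 mul1n mul1r muln0 fact0 divr1 mul1r expr1n.
  by rewrite -[1 in LHS]derivX integral11_deriv !hornerX; ring.
have rec : (2 * l.+1 + 1)%:R * integral11 (rodrigues l.+1) =
    - (2 * l.+1)%:R * integral11 (rodrigues l).
  have E : ('X * rodrigues l.+1)^`() =
      (2 * l.+1 + 1)%:R *: rodrigues l.+1 + (2 * l.+1)%:R *: rodrigues l.
    rewrite derivM derivX mul1r /rodrigues deriv_exp derivB derivXn -polyC1 derivC subr0 /=.
    rewrite !scaler_nat polyC1 expr1 exprS; set y := _ ^+ l; ring.
  have := integral11_deriv ('X * rodrigues l.+1); rewrite E integral11D !integral11Z.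
  have [] := @derivn_rodrigues_root l.+1 0 1 isT; rewrite mulr1 derivn0 => r1 r2.
  rewrite !hornerM r1 r2 !mulr0 subrr.
  by move/eqP; rewrite addr_eq0 => /eqP ->; rewrite mulNr.
rewrite rec; have l1 : (2 * l + 1)%:R != 0 :> R by rewrite pnatr_eq0 addn1.
have f0 : (2 * l)`!%:R != 0 :> R by rewrite pnatr_eq0 -lt0n fact_gt0.
rewrite (canRL (mulKf l1) ih) mulnS !add2n !factS expnS (exprS (-1)) !natrM !natrX.
have l2 : (2 * l).+1%:R != 0 :> R by rewrite pnatr_eq0.
have l3 : (2 * l).+2%:R != 0 :> R by rewrite pnatr_eq0.
field; rewrite f0 /=.
by apply/andP; split; apply: lt0r_neq0; have := ler0n R l; lra.
Qed.

(** Integration by parts m times moves the m-th derivative from P_l' to A = (X^2 - 1)^m P_l^(m),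
    with a sign that cancels the one of (1 - X^2)^m. By Rodrigues' formula, l' further integrations
    put l' + m derivatives on A, whose degree is at most l + m: the result is zero if l < l' and the
    integral of (X^2 - 1)^l up to a constant if l = l'. *)
Lemma integral_legendre l l' m : (m <= l)%N -> (l <= l')%N ->
  integral11 ((1 - 'X^2) ^+ m * (legendre l)^`(m) * (legendre l')^`(m)) =
  (l == l')%:R * (2 / (2 * l + 1)%:R * ((l + m)`!%:R / (l - m)`!%:R)).
Proof.
move=> ml ll'; pose A := rodrigues m * (legendre l)^`(m).
have -> : (1 - 'X^2) ^+ m * (legendre l)^`(m) = (-1) ^+ m *: A.
  have -> : 1 - 'X^2 = (-1 : R) *: ('X^2 - 1) by rewrite scaleN1r opprB.
  by rewrite exprZn scalerAl.
rewrite -scalerAl integral11Z.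
have h1 := @integral11_by_parts m A (legendre l') (fun k km => derivn_rodrigues_root _ km).
have h2 := @integral11_by_parts l' (rodrigues l') A^`(m).
have -> : integral11 (A * (legendre l')^`(m)) = (-1) ^+ m * integral11 (A^`(m) * legendre l').
  by rewrite h1 mulrA -exprMn mulrNN mulr1 expr1n mul1r.
have sgn n : (-1) ^+ n * (-1) ^+ n = 1 :> R by rewrite -exprMn mulrNN mulr1 expr1n.
rewrite [LHS]mulrA sgn mul1r mulrC.
rewrite -[legendre l']derivn0 derivn_legendre add0n -scalerAl integral11Z h2; last first.
  by move=> k kl; have := derivn_rodrigues_root 1 kl; rewrite mulr1.
have sP : (size (@legendre R l)^`(m) <= (l - m).+1)%N.
  rewrite derivn_legendre (leq_trans (size_scale_leq _ _))// (leq_trans (size_derivn_leq _ _))//.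
  by rewrite size_rodrigues; lia.
have sA : (size A <= (l + m).+1)%N.
  by rewrite (leq_trans (size_polyMleq _ _))// size_rodrigues; lia.
have EA : (A^`(m))^`(l') = A^`(l' + m) by rewrite /derivn -iterD.
rewrite EA; have [lE|nl] := eqVneq l l'; last first.
  have ll : (l < l')%N by rewrite ltn_neqAle nl.
  have -> : A^`(l' + m) = 0.
    by apply/eqP; rewrite -size_poly_eq0 -leqn0 (leq_trans (size_derivn_leq _ _))//; lia.
  by rewrite mulr0 -(scale0r (0 : {poly R})) integral11Z mul0r !mulr0 mul0r.
rewrite -{l'}lE in ll' h1 h2 EA *.
have -> : A^`(l + m) = ((l + m)`!%:R * A`_(l + m))%:P.
  apply/polyP => i; rewrite coef_derivn coefC; case: i => [|i] /=.
    by rewrite addn0 ffactnn -[LHS]mulr_natl.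
  by rewrite nth_default ?mul0rn// (leq_trans sA)//; lia.
(* A is the product of a monic factor of degree 2 m and of P_l^(m), of degree l - m, so its top
   coefficient is that of P_l^(m). *)
have -> : A`_(l + m) = legendre_coef l * ((2 * l)`!%:R / (l - m)`!%:R).
  have -> : (l + m = 2 * m + (l - m))%N by lia.
  rewrite coefM_top// ?size_rodrigues// lead_rodrigues mul1r derivn_legendre coefZ coef_derivn.
  have -> : (m + l + (l - m) = 2 * l)%N by lia.
  rewrite lead_rodrigues; congr (_ * _).
  have f0 : (l - m)`!%:R != 0 :> R by rewrite pnatr_eq0 -lt0n fact_gt0.
  rewrite -[RHS](mulfK f0) mulfVK//; apply: (mulIf f0); rewrite mulfVK//.
  rewrite -natrM -[in RHS](@ffact_fact (2 * l) (m + l)); last by lia.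
  by congr (_ * _`!)%:R; lia.
rewrite mulrC [X in integral11 X]mulrC mul_polyC integral11Z mulr1n mul1r.
have l1 : (2 * l + 1)%:R != 0 :> R by rewrite pnatr_eq0 addn1.
rewrite (canRL (mulKf l1) (integral_rodrigues l)) /legendre_coef.
have f0 : (2 * l)`!%:R != 0 :> R by rewrite pnatr_eq0 -lt0n fact_gt0.
have f1 : (l - m)`!%:R != 0 :> R by rewrite pnatr_eq0 -lt0n fact_gt0.
have f2 : (2 ^ l * l`!)%:R != 0 :> R.
  by rewrite pnatr_eq0 -lt0n muln_gt0 expn_gt0 fact_gt0.
have := sgn l; set e := (-1) ^+ l => ee.
set a := (2 ^ l * l`!)%:R in f2 *; set b := (2 * l)`!%:R in f0 *.
set c := (2 * l + 1)%:R in l1 *; set u := (l - m)`!%:R in f1 *; set v := (l + m)`!%:R.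
transitivity ((e * e) * (2 / c * (v / u))); last by rewrite ee mul1r.
clearbody e a b c u v; field; exact/and4P.
Qed.

End PolynomialIntegral.

(** * Boundedness and orthonormality of the harmonics *)

Section Harmonics.
Local Open Scope complex_scope.
Local Open Scope ring_scope.
Context (R : realType).
Local Notation C := R[i].
Notation sigma := (@sphere_measure R).
Notation Yn := (@spherical_harmonic_nat R).
Notation Y := (@spherical_harmonic R).
Notation CS := (Cintegral sigma (@sphere R)).
Notation bmS := (Cbounded_measurable (@sphere R)).

Lemma sphere_entry_le1 (x : 'cV[R]_3) i : sphere x -> `|x i 0| <= 1.
Proof.
rewrite /sphere /= => sx.
rewrite -(ler_pXn2r (_ : 0 < 2)%N) ?nnegrE// real_normK ?num_real// expr1n -sx.
by rewrite (bigD1 i)//= lerDl sumr_ge0// => j _; exact: sqr_ge0.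
Qed.

Lemma bounded_measurable_entry i : bounded_measurable (@sphere R) (fun x => x i 0).
Proof.
split; first by apply: measurable_funTS; exact: measurable_entry.
by exists 1 => x; exact: sphere_entry_le1.
Qed.

Lemma Cbounded_measurable_horner (p : {poly R}) : bmS (fun x => (p.[x 2 0])%:C).
Proof.
under eq_fun do rewrite horner_coef rmorph_sum/=.
apply: Cbounded_measurable_sum => i.
under eq_fun do rewrite rmorphM rmorphXn.
apply: Cbounded_measurableM; first exact: Cbounded_measurable_cst.
apply: Cbounded_measurableX; apply: Cbounded_measurable_real.
exact: bounded_measurable_entry.
Qed.

Definition xyC (x : 'cV[R]_3) : C := x 0 0 +i* x 1 0.

Lemma Cbounded_measurable_xyC : bmS xyC.
Proof. by split; exact: bounded_measurable_entry. Qed.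

Lemma xyC_sphere (x : 'cV[R]_3) : sphere x -> xyC x * (xyC x)^* = ((1 - 'X^2).[x 2 0])%:C.
Proof.
move=> /sphereE sx; rewrite hornerD hornerN hornerXn hornerC -sx.
by apply: complex_eq; rewrite ?ReM ?ImM /=; ring.
Qed.

Definition harmonic_coef l m : R :=
  (-1) ^+ m * Num.sqrt ((2 * l + 1)%:R / (4 * pi) * ((l - m)`!%:R / (l + m)`!%:R)).

Lemma spherical_harmonic_natE l m x :
  Yn l m x = (harmonic_coef l m)%:C * ((legendre l)^`(m).[x 2 0])%:C * xyC x ^+ m.
Proof. by rewrite /spherical_harmonic_nat rmorphM. Qed.

Lemma harmonic_coef_sqr l m : harmonic_coef l m ^+ 2 =
  (2 * l + 1)%:R / (4 * pi) * ((l - m)`!%:R / (l + m)`!%:R).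
Proof.
rewrite exprMn -exprM mulnC exprM sqrrN !expr1n mul1r sqr_sqrtr//.
by rewrite mulr_ge0// divr_ge0// mulr_ge0// pi_ge0.
Qed.

Lemma Cbounded_measurable_harmonic l m : bmS (Y l m).
Proof.
have b k : bmS (Yn l k).
  rewrite (funext (spherical_harmonic_natE l k)).
  apply: Cbounded_measurableM; last first.
    by apply: Cbounded_measurableX; exact: Cbounded_measurable_xyC.
  by apply: Cbounded_measurableM;
    [exact: Cbounded_measurable_cst|exact: Cbounded_measurable_horner].
case: m => k; first exact: b.
apply: Cbounded_measurableM; first exact: Cbounded_measurable_cst.
exact: Cbounded_measurableJ.
Qed.

Lemma sphere_Cintegrable (f : 'cV[R]_3 -> C) : bmS f -> Cintegrable sigma (@sphere R) f.
Proof.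
by apply: Cbounded_measurable_integrable; [exact: measurable_sphere|exact: sphere_measure_lty].
Qed.

Lemma Cintegral_height (q : {poly R}) : CS (fun x => (q.[x 2 0])%:C) = (2 * pi * integral11 q)%:C.
Proof.
have [[_ [M bM]] _] := Cbounded_measurable_horner q.
apply: complex_eq => /=; last by rewrite /Rintegral integral0.
rewrite (Rintegral_height (f := fun z => q.[z])) ?Rintegral_horner//.
  by apply: continuous_measurable_fun; exact: continuous_horner.
exists M => z z11; have := bM (vec3 (Num.sqrt (1 - z ^+ 2)) 0 z); rewrite vec3E; apply.
apply/sphereE; rewrite !vec3E sqr_sqrtr; first by ring.
by case/andP: z11 => *; nra.
Qed.

(** For equal orders the factors (x + i y)^k and its conjugate multiply to (1 - z^2)^k. The
    integrand depends on the height alone, and the hat-box theorem reduces the integral to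
    [integral_legendre]. *)
Lemma harmonic_nat_orthonormal l l' k : (k <= l)%N -> (k <= l')%N ->
  CS (fun x => Yn l k x * (Yn l' k x)^*) = (l == l')%:R.
Proof.
wlog ll' : l l' / (l <= l')%N => [h|] kl kl'.
  have [ll'|l'l] := leqP l l'; first exact: h.
  have := h _ _ (ltnW l'l) kl' kl; rewrite eq_sym => /(congr1 Num.conj).
  rewrite -CintegralJ; last first.
  - apply: sphere_Cintegrable; apply: Cbounded_measurableM.
      exact: (Cbounded_measurable_harmonic l' (Posz k)).
    by apply: Cbounded_measurableJ; exact: (Cbounded_measurable_harmonic l (Posz k)).
  - exact: measurable_sphere.
  rewrite conjC_nat => <-; apply: eq_Cintegral => x _.
  by rewrite (@conjCM R) (@conjCK' R) mulrC.
pose q := (harmonic_coef l k * harmonic_coef l' k) *: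
  ((1 - 'X^2) ^+ k * (legendre l)^`(k) * (legendre l')^`(k)).
transitivity (CS (fun x => (q.[x 2 0])%:C)).
  apply: eq_Cintegral => x sx; rewrite !spherical_harmonic_natE.
  rewrite !(@conjCM R) !(@conjCX R) !(@conjC_real R) hornerZ !hornerM horner_exp.
  rewrite !rmorphM !rmorphXn /= -(xyC_sphere sx) exprMn; ring.
rewrite Cintegral_height integral11Z integral_legendre//.
have [->|_] := eqVneq l l'; last by rewrite mul0r !mulr0.
rewrite mul1r -expr2 harmonic_coef_sqr mulr1n -[RHS]/(1%:C); congr (_%:C).
have l1 : (2 * l' + 1)%:R != 0 :> R by rewrite pnatr_eq0 addn1.
have f0 : (l' + k)`!%:R != 0 :> R by rewrite pnatr_eq0 -lt0n fact_gt0.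
have f1 : (l' - k)`!%:R != 0 :> R by rewrite pnatr_eq0 -lt0n fact_gt0.
have p0 : pi != 0 :> R by rewrite gt_eqF// pi_gt0.
set c := (2 * l' + 1)%:R in l1 *; set u := (l' - k)`!%:R in f1 *.
set v := (l' + k)`!%:R in f0 *; set P := pi in p0 *; clearbody c u v P; field.
by do ?[apply/andP; split].
Qed.

Definition cis (a : R) : C := cos a +i* sin a.

Lemma cisD a b : cis (a + b) = cis a * cis b.
Proof. by rewrite /cis cosD sinD; congr (_ +i* _); ring. Qed.

Lemma cisJ a : (cis a)^* = cis (- a).
Proof. by rewrite /cis cosN sinN. Qed.

Lemma cisX a n : cis a ^+ n = cis (n%:R * a).
Proof.
elim: n => [|n ih]; first by rewrite mul0r /cis cos0 sin0.
by rewrite exprS ih -cisD -natr1 mulrDl mul1r addrC.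
Qed.

Lemma cis_pi (e : bool) : cis ((-1) ^+ e * pi) = -1.
Proof.
rewrite /cis; case: e; rewrite ?expr1 ?mulN1r ?expr0 ?mul1r ?cosN ?sinN cospi sinpi ?oppr0.
  by congr (_ +i* _); rewrite oppr0.
by congr (_ +i* _); rewrite oppr0.
Qed.

Lemma rotz_z (a : R) (x : 'cV[R]_3) : (rotz a *m x) 2 0 = x 2 0.
Proof. by rewrite {1}(vec3_eta x) rotz_vec3 vec3E. Qed.

Lemma xyC_rotz (a : R) (x : 'cV[R]_3) : xyC (rotz a *m x) = cis a * xyC x.
Proof. by rewrite {1}(vec3_eta x) rotz_vec3 /xyC !vec3E /cis; congr (_ +i* _); ring. Qed.

Lemma harmonic_rotz l (m : int) a x : Y l m (rotz a *m x) = cis (m%:~R * a) * Y l m x.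
Proof.
have E k : Yn l k (rotz a *m x) = cis (k%:R * a) * Yn l k x.
  by rewrite !spherical_harmonic_natE rotz_z xyC_rotz exprMn cisX; ring.
case: m => k; first exact: E.
by rewrite /spherical_harmonic E (@conjCM R) cisJ NegzE mulrNz mulNr; ring.
Qed.

Lemma harmonic_orthogonal l l' (m m' : int) : m != m' ->
  CS (fun x => Y l m x * (Y l' m' x)^*) = 0.
Proof.
move=> mm'; set f := fun x => _.
have bf : bmS f.
  apply: Cbounded_measurableM; first exact: Cbounded_measurable_harmonic.
  by apply: Cbounded_measurableJ; exact: Cbounded_measurable_harmonic.
have n0 : m - m' != 0 by rewrite subr_eq0.
(* The rotation of angle pi / |m - m'| about the axis changes the sign of f. *)
pose a : R := pi / `|m - m'|%:~R.
have E x : f (rotz a *m x) = -1 * f x.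
  rewrite /f !harmonic_rotz (@conjCM R) cisJ mulrACA -cisD -mulrBl -rmorphB /=; congr (_ * _).
  rewrite -(cis_pi (m - m' < 0)); congr cis.
  rewrite /a -{1}[m - m']mulr_sign_norm intrM rmorph_sign mulrACA mulrAC.
  by rewrite divff ?mulr1 ?mul1r// ?intr_eq0 ?normr_eq0.
have h : CS (fun x => f (rotz a *m x)) = CS (fun x => -1 * f x).
  by apply: eq_Cintegral => x _; exact: E.
have := Cintegral_SO3 (rotz_SO3 a) bf.
rewrite h CintegralZl; [|exact: measurable_sphere|exact: sphere_Cintegrable].
by rewrite mulN1r => /esym/eqP; rewrite -subr_eq0 opprK -mulr2n mulrn_eq0/= => /eqP.
Qed.

Lemma harmonic_orthonormal l l' (m m' : int) : (`|m| <= l)%N -> (`|m'| <= l')%N ->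
  CS (fun x => Y l m x * (Y l' m' x)^*) = ((l == l') && (m == m'))%:R.
Proof.
have [<-{m'}|mm'] := eqVneq m m'; last first.
  by move=> _ _; rewrite andbF; exact: harmonic_orthogonal.
rewrite andbT; case: m => k /=; first exact: harmonic_nat_orthonormal.
move=> kl kl'; rewrite -[RHS]conjC_nat -(harmonic_nat_orthonormal kl kl').
rewrite -CintegralJ; last first.
- apply: sphere_Cintegrable; apply: Cbounded_measurableM.
    exact: (Cbounded_measurable_harmonic l (Posz k.+1)).
  by apply: Cbounded_measurableJ; exact: (Cbounded_measurable_harmonic l' (Posz k.+1)).
- exact: measurable_sphere.
apply: eq_Cintegral => x _ /=; set y := Yn l _ x; set y' := Yn l' _ x.
have e : ((-1) ^+ k.+1 : C)^* = (-1) ^+ k.+1 by exact: rmorph_sign.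
rewrite !(@conjCM R) !(@conjCK' R) e mulrACA -exprMn mulrNN mulr1 expr1n mul1r//.
Qed.

End Harmonics.

(** * Convolution of the noise with a harmonic *)

Section RotationalHarmonics.
Local Open Scope complex_scope.
Local Open Scope ring_scope.
Context (R : realType).
Local Notation C := R[i].
Notation sigma := (@sphere_measure R).
Notation Y := (@spherical_harmonic R).
Notation CS := (Cintegral sigma (@sphere R)).
Notation bmS := (Cbounded_measurable (@sphere R)).
Notation normc := Normc.normc.

Lemma sphere_measureT : (sigma setT = (4 * pi)%:E)%E.
Proof.
rewrite -sphere_measure_sphere -(setUv (@sphere R)) measureU//.
- by rewrite [X in (_ + X)%E]sphere_measure_setC adde0.
- exact: measurable_sphere.
- by apply: measurableC; exact: measurable_sphere.
- exact: setICr.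
Qed.

Let sphere_measure_finite : fin_num_fun sigma.
Proof.
move=> A mA; rewrite ge0_fin_numE//.
rewrite (@le_lt_trans _ _ (sigma setT))//; first by rewrite le_measure ?inE.
by rewrite sphere_measureT ltry.
Qed.

HB.instance Definition _ := Measure_isFinite.Build _ _ _ sigma sphere_measure_finite.

Lemma normc_sqr (z : C) : normc z ^+ 2 = complex.Re z ^+ 2 + complex.Im z ^+ 2.
Proof. by case: z => a b /=; rewrite sqr_sqrtr// addr_ge0 ?sqr_ge0. Qed.

Lemma normc_ge0 (z : C) : 0 <= normc z.
Proof. by case: z => a b; exact: sqrtr_ge0. Qed.

Lemma normcJ (z : C) : normc z^* = normc z.
Proof. by case: z => a b /=; rewrite sqrrN. Qed.

Lemma mulC_conj (z : C) : z * z^* = (normc z ^+ 2)%:C.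
Proof. by rewrite normc_sqr; case: z => a b; apply: complex_eq; rewrite ?ReM ?ImM /=; ring. Qed.

Lemma Re_le_normc (z : C) : `|complex.Re z| <= normc z.
Proof.
rewrite -(ler_pXn2r (_ : 0 < 2)%N) ?nnegrE ?normc_ge0// real_normK ?num_real//.
by rewrite normc_sqr lerDl sqr_ge0.
Qed.

Lemma Im_le_normc (z : C) : `|complex.Im z| <= normc z.
Proof.
rewrite -(ler_pXn2r (_ : 0 < 2)%N) ?nnegrE ?normc_ge0// real_normK ?num_real//.
by rewrite normc_sqr lerDr sqr_ge0.
Qed.

Lemma normc_sum (I : finType) (F : I -> C) : normc (\sum_i F i) <= \sum_i normc (F i).
Proof.
elim/big_ind2 : _ => [|x1 x2 y1 y2 h1 h2|//]; first by rewrite Normc.normc0.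
by rewrite (le_trans (le_normcD _ _))// lerD.
Qed.

Lemma euclidean_norm_ge n (v : 'cV[C]_n) i : normc (v i 0) <= euclidean_norm v.
Proof.
rewrite /euclidean_norm -[leLHS]ger0_norm ?normc_ge0// -sqrtr_sqr ler_wsqrtr//.
by rewrite (bigD1 i)//= lerDl sumr_ge0// => j _; exact: sqr_ge0.
Qed.

Lemma euclidean_norm_le n (v : 'cV[C]_n) M : 0 <= M -> (forall i, normc (v i 0) <= M) ->
  euclidean_norm v <= n%:R * M.
Proof.
move=> M0 vM; rewrite /euclidean_norm -[leRHS]ger0_norm ?mulr_ge0// -sqrtr_sqr ler_wsqrtr//.
apply: (@le_trans _ _ (\sum_(i < n) M ^+ 2)).
  by apply: ler_sum => i _; rewrite ler_pXn2r ?nnegrE ?normc_ge0.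
rewrite sumr_const card_ord -[leLHS]mulr_natl exprMn ler_wpM2r ?sqr_ge0//.
by rewrite -natrX ler_nat; nia.
Qed.

Lemma op_norm_entry n (A : 'M[C]_n) i j : normc (A i j) <= op_norm A.
Proof.
pose e : 'cV[C]_n := \col_k (k == j)%:R.
have Ae : A i j = (A *m e) i 0.
  rewrite mxE (bigD1 j)//= mxE eqxx mulr1 big1 ?addr0// => k kj.
  by rewrite mxE (negbTE kj) mulr0.
rewrite Ae (le_trans (euclidean_norm_ge _ i))// /op_norm.
apply: sup_ubound; last first.
  exists e => //=; rewrite /euclidean_norm (bigD1 j)//= big1 => [|k kj].
    by rewrite mxE eqxx Normc.normc1 expr1n addr0 sqrtr1.
  by rewrite mxE (negbTE kj) Normc.normc0 expr0n.
(* [sup] is an upper bound only for a set bounded above; on the unit ball the sum of the moduli of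
   all entries bounds each coordinate of the image. *)
exists (n%:R * (\sum_k \sum_l normc (A k l))) => _ [v v1 <-].
have S0 : 0 <= \sum_k \sum_l normc (A k l).
  by apply: sumr_ge0 => k _; apply: sumr_ge0 => l _; exact: normc_ge0.
apply: euclidean_norm_le => // k; rewrite mxE (le_trans (normc_sum _))//.
rewrite [leRHS](bigD1 k)//= ler_wpDr//.
  by apply: sumr_ge0 => l _; apply: sumr_ge0 => m _; exact: normc_ge0.
apply: ler_sum => l _; rewrite Normc.normcM ler_piMr ?normc_ge0//.
by rewrite (le_trans (euclidean_norm_ge _ l)).
Qed.

Lemma order_of_le l (i : 'I_(2 * l).+1) : (`|order_of i| <= l)%N.
Proof. by rewrite /order_of; have := ltn_ord i; lia. Qed.

Lemma order_of_inj l (i j : 'I_(2 * l).+1) : (order_of i == order_of j) = (i == j).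
Proof.
apply/eqP/eqP => [|->//]; rewrite /order_of => h; apply/val_inj => /=.
by have := h; lia.
Qed.

Variable D : forall l : nat, 'M[R]_3 -> 'M[C]_((2 * l).+1).
Hypothesis hD : is_rotational_harmonics D.
Variable l : nat.
Implicit Types (g : 'M[R]_3) (i j k : 'I_(2 * l).+1).

Notation Yi i := (Y l (order_of i)).

Let bY i : bmS (Yi i). Proof. exact: Cbounded_measurable_harmonic. Qed.

Let orth i j : CS (fun x => Yi i x * (Yi j x)^*) = (i == j)%:R.
Proof. by rewrite harmonic_orthonormal ?order_of_le// eqxx order_of_inj. Qed.

Lemma rotated_harmonic g i x : SO3 g -> sphere x ->
  (Yi i (g *m x))^* = \sum_j D l g i j * (Yi j x)^*.
Proof. by move=> sg sx; exact: hD. Qed.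

Lemma sphere_SO3 g x : SO3 g -> sphere (g *m x) = sphere x.
Proof. by move=> sg; rewrite sphere_mulmx// SO3_trK. Qed.

Lemma Cbounded_measurable_rotated g (f : 'cV[R]_3 -> C) : SO3 g -> bmS f ->
  bmS (fun x => f (g *m x)).
Proof.
move=> sg.
have b (h : 'cV[R]_3 -> R) : bounded_measurable (@sphere R) h ->
    bounded_measurable (@sphere R) (fun x => h (g *m x)).
  move=> [mh [M hM]]; split; last by exists M => x sx; apply: hM; rewrite sphere_SO3.
  apply: (@measurable_comp _ _ _ _ _ _ (@sphere R) h sphere (fun x => g *m x)) => //.
  - exact: measurable_sphere.
  - by move=> _ [x sx <-]; rewrite sphere_SO3.
  by apply: measurable_funTS; exact: measurable_mulmx.
move=> [f1 f2]; split; [exact: (b (fun x => complex.Re (f x)))|].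
exact: (b (fun x => complex.Im (f x))).
Qed.

(** Pairing the transformation rule with one harmonic isolates one entry, by orthonormality. All
    that is needed of D on SO3 is read off this formula. *)
Lemma rotational_harmonicE g i j : SO3 g ->
  D l g i j = CS (fun x => (Yi i (g *m x))^* * Yi j x).
Proof.
move=> sg; rewrite (@eq_Cintegral _ _ _ _ _ _
  (fun x => \sum_k D l g i k * ((Yi k x)^* * Yi j x))) => [|x sx]; last first.
  by rewrite rotated_harmonic// mulr_suml; apply: eq_bigr => k _; rewrite mulrA.
have ck k : Cintegrable sigma (@sphere R) (fun x => (Yi k x)^* * Yi j x).
  by apply: sphere_Cintegrable; apply: Cbounded_measurableM => //; exact: Cbounded_measurableJ.
rewrite Cintegral_sum//; last 2 first.
- exact: measurable_sphere.
- by move=> k; apply: CintegrableZl => //; exact: measurable_sphere.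
rewrite (bigD1 j)//= big1 => [|k kj].
  rewrite CintegralZl//; last exact: measurable_sphere.
  rewrite (@eq_Cintegral _ _ _ _ _ _ (fun x => Yi j x * (Yi j x)^*)) => [|x _]; last by rewrite mulrC.
  by rewrite orth eqxx mulr1 addr0.
rewrite CintegralZl//; last exact: measurable_sphere.
rewrite (@eq_Cintegral _ _ _ _ _ _ (fun x => Yi j x * (Yi k x)^*)) => [|x _]; last by rewrite mulrC.
by rewrite orth eq_sym (negbTE kj) mulr0.
Qed.

(** The substitution of g x for x in the integral formula moves the rotation from one factor to the
    other. *)
Lemma rotational_harmonic_tr g i j : SO3 g -> D l g^T i j = (D l g j i)^*.
Proof.
move=> sg; have sgT := SO3_tr sg.
rewrite !rotational_harmonicE// -CintegralJ; last 2 first.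
- exact: measurable_sphere.
- apply: sphere_Cintegrable; apply: Cbounded_measurableM => //; apply: Cbounded_measurableJ.
  exact: Cbounded_measurable_rotated.
rewrite -(Cintegral_SO3 sg); last first.
  by apply: Cbounded_measurableM => //; apply: Cbounded_measurableJ; exact: Cbounded_measurable_rotated.
apply: eq_Cintegral => x sx; rewrite mulmxA SO3_trK// mul1mx.
by rewrite (@conjCM R) (@conjCK' R) mulrC.
Qed.

(** Writing x = g (g^T x), the conjugate of Y_i at x expands in the harmonics at g^T x. Their
    pairings with Y_k are the entries of D at g^T, that is, of the adjoint. *)
Lemma rotational_harmonic_unitary g i k : SO3 g ->
  \sum_j D l g i j * (D l g k j)^* = (i == k)%:R.
Proof.
move=> sg; have sgT := SO3_tr sg; rewrite eq_sym -(orth k i).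
rewrite (@eq_Cintegral _ _ _ _ _ _
  (fun x => \sum_j D l g i j * ((Yi j (g^T *m x))^* * Yi k x))) => [|x sx]; last first.
  rewrite mulrC -{1}[x]mul1mx -{1}(sg.1) -mulmxA rotated_harmonic ?sphere_SO3//.
  by rewrite mulr_suml; apply: eq_bigr => j _; rewrite mulrA.
have ck j : Cintegrable sigma (@sphere R) (fun x => (Yi j (g^T *m x))^* * Yi k x).
  apply: sphere_Cintegrable; apply: Cbounded_measurableM => //; apply: Cbounded_measurableJ.
  exact: Cbounded_measurable_rotated.
rewrite Cintegral_sum//; last 2 first.
- exact: measurable_sphere.
- by move=> j; apply: CintegrableZl => //; exact: measurable_sphere.
apply: eq_bigr => j _; rewrite CintegralZl//; last exact: measurable_sphere.
by rewrite -rotational_harmonicE// rotational_harmonic_tr.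
Qed.

Lemma normc_rotational_harmonic g i j : SO3 g -> normc (D l g i j) <= 1.
Proof.
move=> sg; have := rotational_harmonic_unitary i i sg.
rewrite eqxx; under eq_bigr do rewrite mulC_conj.
rewrite -rmorph_sum/= => /(congr1 (@complex.Re R)) /= e.
rewrite -(ler_pXn2r (_ : 0 < 2)%N) ?nnegrE ?normc_ge0// expr1n -e.
by rewrite (bigD1 j)//= lerDl sumr_ge0// => k _; exact: sqr_ge0.
Qed.

End RotationalHarmonics.

(** * Bounds on the harmonics and on their convolution with the noise *)

Section NoiseBound.
Local Open Scope complex_scope.
Local Open Scope ring_scope.
Context (R : realType).
Local Notation C := R[i].
Notation sigma := (@sphere_measure R).
Notation Y := (@spherical_harmonic R).
Notation CS := (Cintegral sigma (@sphere R)).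
Notation bmS := (Cbounded_measurable (@sphere R)).
Notation normc := Normc.normc.

Lemma derivn_exp_root (a : R) n (q : {poly R}) :
  ((('X - a%:P) ^+ n * q)^`(n)).[a] = n`!%:R * q.[a].
Proof.
elim: n q => [|n ih] q; first by rewrite expr0 mul1r derivn0 mul1r.
rewrite derivSn (_ : _^`() = ('X - a%:P) ^+ n * (q *+ n.+1 + ('X - a%:P) * q^`())).
  rewrite ih hornerD hornerM hornerXsubC subrr mul0r addr0 hornerMn factS natrM.
  by rewrite -[X in _ * X]mulr_natl; ring.
by rewrite derivM deriv_exp derivXsubC mul1r /= mulrDr mulrnAl mulrnAr mulrA -exprSr.
Qed.

Lemma legendre1 l : (@legendre R l).[1] = 1.
Proof.
rewrite -[legendre l]derivn0 derivn_legendre add0n hornerZ rodriguesE derivn_exp_root.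
rewrite horner_exp hornerXsubC opprK /legendre_coef natrM natrX [X in _^-1 * X]mulrC.
by rewrite mulVf// mulf_neq0 ?expf_neq0 ?pnatr_eq0// -lt0n fact_gt0.
Qed.

(** At the pole x + i y = 0, so only the order 0 survives, where P_l(1) = 1 leaves the square root
    of (2l+1) / (4 pi). *)
Lemma harmonic_e3 l m : (`|m| <= l)%N -> normc (Y l m (e3 R)) <= (2 * l + 1)%:R.
Proof.
have xy0 : xyC (e3 R) = 0 by rewrite /xyC /e3 !vec3E.
have E k : (0 < k)%N -> spherical_harmonic_nat l k (e3 R) = 0.
  by move=> k0; rewrite spherical_harmonic_natE xy0 expr0n eqn0Ngt k0 mulr0.
have E0 : normc (spherical_harmonic_nat l 0 (e3 R)) <= (2 * l + 1)%:R.
  rewrite spherical_harmonic_natE expr0 mulr1 /e3 vec3E derivn0 legendre1 mulr1.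
  have -> : normc (harmonic_coef R l 0)%:C = `|harmonic_coef R l 0|.
    by rewrite /= expr0n/= addr0 sqrtr_sqr.
  rewrite -(ler_pXn2r (_ : 0 < 2)%N) ?nnegrE// real_normK ?num_real// harmonic_coef_sqr.
  rewrite subn0 addn0 divff ?mulr1; last by rewrite pnatr_eq0 -lt0n fact_gt0.
  rewrite ler_pdivrMr ?mulr_gt0 ?pi_gt0//.
  have := pi_ge2 R; have : 1 <= (2 * l + 1)%:R :> R by rewrite ler1n addn1.
  by set c := _%:R; set p := pi => c1 p2; nra.
case: m => [[//|k]|k] _.
  by rewrite /spherical_harmonic E// Normc.normc0.
by rewrite /spherical_harmonic E// conjC0 mulr0 Normc.normc0.
Qed.

Lemma measurable_SO3 : measurable (@SO3 R).
Proof.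
have me i j : measurable_fun setT (fun u : 'M[R]_3 => u i j) by exact: measurable_entry.
(* A sum of squares, polynomial in the entries, whose zero set is SO3. *)
pose N (u : 'M[R]_3) := \sum_(i < 3) \sum_(j < 3)
  ((u *m u^T) i j - (1%:M : 'M[R]_3) i j) ^+ 2 + (\det u - 1) ^+ 2.
have mN : measurable_fun setT N.
  apply: measurable_funD.
    apply: measurable_sum => i; apply: measurable_sum => j; apply: measurable_funX.
    apply: measurable_funB => //; under eq_fun do rewrite mxE.
    apply: measurable_sum => k; under eq_fun do rewrite mxE.
    exact: measurable_funM.
  apply: measurable_funX; apply: measurable_funB => //.
  rewrite (funext (@det3E R)).
  by do ?[exact: me|apply: measurable_funB|apply: measurable_funD|apply: measurable_funM].
have -> : @SO3 R = N @^-1` [set 0].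
  apply/seteqP; split => u /=.
    move=> [u1 du]; rewrite /N du subrr expr0n/= addr0 big1// => i _; rewrite big1// => j _.
    by rewrite u1 subrr expr0n.
  have s0 i j : true -> 0 <= ((u *m u^T) i j - (1%:M : 'M[R]_3) i j) ^+ 2.
    by rewrite sqr_ge0.
  have s1 i : true -> 0 <= \sum_j ((u *m u^T) i j - (1%:M : 'M[R]_3) i j) ^+ 2.
    by move=> _; apply: sumr_ge0 => j; exact: s0.
  move/eqP; rewrite paddr_eq0 ?sqr_ge0//; last exact: sumr_ge0.
  move=> /andP[/eqP h]; rewrite sqrf_eq0 subr_eq0 => /eqP du; split => //.
  apply/matrixP => i j; apply/eqP; rewrite -subr_eq0 -sqrf_eq0; apply/eqP.
  exact: (psumr_eq0P (s0 i) (psumr_eq0P s1 h isT) isT).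
by have := mN measurableT [set 0] (measurable_set1 _); rewrite setTI.
Qed.

(** Every point is a rotation of the pole. The transformation rule writes the value there as 2l + 1
    terms, each an entry of modulus at most one times a value at the pole of modulus at most 2l +
    1. *)
Lemma harmonic_bound (D : forall l : nat, 'M[R]_3 -> 'M[C]_((2 * l).+1)) l
    (i : 'I_(2 * l).+1) y : is_rotational_harmonics D -> sphere y ->
  normc (Y l (order_of i) y) <= (2 * l + 1)%:R ^+ 2.
Proof.
move=> hD sy; have [a [t [_ _ <-]]] := sphere_orbit sy.
set g := _ *m rotx t.
have sg : SO3 g by apply: SO3_mul; [exact: rotz_SO3|exact: rotx_SO3].
rewrite -normcJ (rotated_harmonic hD _ sg (sphere_e3 R)) (le_trans (normc_sum _))//.
rewrite (@le_trans _ _ (\sum_(j < (2 * l).+1) (2 * l + 1)%:R))//.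
  apply: ler_sum => j _; rewrite Normc.normcM normcJ -[leRHS]mul1r.
  apply: ler_pM; rewrite ?normc_ge0//; first exact: normc_rotational_harmonic.
  by apply: harmonic_e3; exact: order_of_le.
by rewrite sumr_const card_ord -[leLHS]mulr_natl -addn1 expr2.
Qed.

Lemma measurable_mulmx2 :
  measurable_fun setT (fun p : 'M[R]_3 * 'cV[R]_3 => p.1 *m p.2).
Proof.
apply/measurable_fun_matrixP => i j; under eq_fun do rewrite mxE.
apply: measurable_sum => k; apply: measurable_funM.
  exact: (measurableT_comp (measurable_entry i k) measurable_fst).
exact: (measurableT_comp (measurable_entry k j) measurable_snd).
Qed.

Lemma bounded_measurable_extend d (T : measurableType d) (D : set T) (h : T -> R) :
  measurable D -> bounded_measurable D h -> bounded_measurable setT (h \_ D).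
Proof.
move=> mD [mh [M hM]]; split; first exact/(measurable_restrictT _ _).1.
exists `|M| => x _; rewrite patchE; case: ifPn => [|_]; last by rewrite normr0.
by rewrite inE => Dx; rewrite (le_trans (hM _ Dx))// ler_norm.
Qed.

Lemma bounded_measurable_comp d1 d2 (T1 : measurableType d1) (T2 : measurableType d2)
    (h : T2 -> R) (f : T1 -> T2) : measurable_fun setT f ->
  bounded_measurable setT h -> bounded_measurable setT (fun x => h (f x)).
Proof.
move=> mf [mh [M hM]]; split; first exact: (measurableT_comp mh mf).
by exists M => x _; exact: hM.
Qed.

Variables (haar : probability 'M[R]_3 R)
  (D : forall l : nat, 'M[R]_3 -> 'M[C]_((2 * l).+1)).
Hypothesis hD : is_rotational_harmonics D.
Variable l : nat.
Implicit Types i j : 'I_(2 * l).+1.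

(** D is given by its transformation rule, so its measurability comes from the integral formula: a
    bounded kernel, jointly measurable in the rotation and the point, is integrated over the
    point. *)
Lemma Cbounded_measurable_rotational i j :
  Cbounded_measurable (@SO3 R) (fun g => D l g i j).
Proof.
(* Harmonics are unbounded off the sphere; extension by zero makes the kernel bounded on the whole
   product space. *)
pose ext (f : 'cV[R]_3 -> C) x : C :=
  ((fun y => complex.Re (f y)) \_ (@sphere R)) x +i*
  ((fun y => complex.Im (f y)) \_ (@sphere R)) x.
have extE f x : sphere x -> ext f x = f x.
  by move=> sx; rewrite /ext !patchE mem_set//; case: (f x).
have ext0 f x : ~ sphere x -> ext f x = 0.
  by move=> sx; rewrite /ext !patchE memNset.
have bext m : Cbounded_measurable setT (ext (Y l m)).
  by have [b1 b2] := Cbounded_measurable_harmonic R l m; split;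
    apply: bounded_measurable_extend => //; exact: measurable_sphere.
pose T := ('M[R]_3 * 'cV[R]_3)%type.
pose K (p : T) := (ext (Y l (order_of i)) (p.1 *m p.2))^* * ext (Y l (order_of j)) p.2.
have bK : Cbounded_measurable setT K.
  apply: Cbounded_measurableM.
    apply: Cbounded_measurableJ; have [b1 b2] := bext (order_of i).
    by split; apply: (bounded_measurable_comp (T1 := T) measurable_mulmx2).
  have [b1 b2] := bext (order_of j).
  by split; apply: (bounded_measurable_comp (T1 := T) measurable_snd).
have DK g : SO3 g -> D l g i j = Cintegral sigma setT (fun x => K (g, x)).
  move=> sg; rewrite rotational_harmonicE//.
  have E (h1 h2 : 'cV[R]_3 -> R) : (forall x, sphere x -> h1 x = h2 x) ->
      (forall x, ~ sphere x -> h2 x = 0) ->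
      Rintegral sigma (@sphere R) h1 = Rintegral sigma setT h2.
    move=> h12 h20; rewrite Rintegral_mkcond; apply: eq_Rintegral => x _.
    rewrite patchE; case: ifPn => [/set_mem|/negP nx]; first exact: h12.
    by rewrite h20// => sx; apply: nx; exact/mem_set.
  have KE x : K (g, x) = (ext (Y l (order_of i)) (g *m x))^* * ext (Y l (order_of j)) x by [].
  congr (_ +i* _); apply: E => x sx; rewrite KE.
  - by rewrite !extE// sphere_SO3.
  - by rewrite [X in _ * X]ext0// mulr0.
  - by rewrite !extE// sphere_SO3.
  - by rewrite [X in _ * X]ext0// mulr0.
have mI (h : T -> R) : bounded_measurable setT h ->
    measurable_fun setT (fun g => Rintegral sigma setT (fun x => h (g, x))).
  move=> bh.
  have ih : (haar \x sigma)%E.-integrable setT (EFin \o h).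
    apply: bounded_measurable_integrable => //.
    have := @product_measure1E _ _ _ _ R haar (@sphere_measure R) setT setT measurableT measurableT.
    rewrite setXTT => e; apply: (@le_lt_trans _ _ _ _ _ _ _).
      by rewrite le_eqVlt; apply/orP; left; apply/eqP; exact: e.
    apply: lte_mul_pinfty => //; last by rewrite [X in (X < _)%E]sphere_measureT ltry.
    rewrite ge0_fin_numE//; apply: (le_lt_trans (probability_le1 haar measurableT)).
    exact: ltry.
  apply: (measurableT_comp (fine_measurable measurableT)) => //.
  exact: (measurable_fubini_F ih).
split.
- split; last by exists 1 => g sg; rewrite (le_trans (Re_le_normc _))// normc_rotational_harmonic.
  apply: (@eq_measurable_fun _ _ _ _ _
    (fun g => Rintegral sigma setT (fun x => complex.Re (K (g, x))))).
    by move=> g /[!inE] sg; rewrite DK.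
  by apply: measurable_funTS; apply: (mI (fun p => complex.Re (K p))); case: bK.
- split; last first.
    exists 1 => g sg; rewrite (le_trans _ (normc_rotational_harmonic hD i j sg))//.
    exact: Im_le_normc.
  apply: (@eq_measurable_fun _ _ _ _ _
    (fun g => Rintegral sigma setT (fun x => complex.Im (K (g, x))))).
    by move=> g /[!inE] sg; rewrite DK.
  by apply: measurable_funTS; apply: (mI (fun p => complex.Im (K p))); case: bK.
Qed.

Variable feps : 'M[R]_3 -> R.
Hypothesis hfeps : is_density haar (@SO3 R) feps.

Lemma noise_integrable : haar.-integrable (@SO3 R) (EFin \o feps).
Proof.
have [mf f0 f1] := hfeps; apply/integrableP; split; first exact/measurable_EFinP.
rewrite (_ : (\int[haar]_(x in SO3) _ = 1)%E) ?ltry// -[RHS]f1.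
by apply: eq_integral => x /[!inE] sx; rewrite /= ger0_norm// f0.
Qed.

Lemma noise_Cintegrable h : Cbounded_measurable (@SO3 R) h ->
  Cintegrable haar (@SO3 R) (fun u => (feps u)%:C * h u).
Proof.
have b (k : 'M[R]_3 -> R) : bounded_measurable (@SO3 R) k ->
    haar.-integrable (@SO3 R) (fun u => (feps u * k u)%:E).
  move=> [mk [M kM]]; apply: (integrableMl measurable_SO3 noise_integrable mk).
  by exists M; split; [exact: num_real|move=> x Mx y sy /=; rewrite (le_trans (kM _ sy))// ltW].
move=> [h1 h2]; split.
  by under eq_fun do rewrite ReM /= mul0r subr0; exact: b.
by under eq_fun do rewrite ImM /= mul0r addr0; exact: b.
Qed.

Lemma harmonic_tr_rotated i u y : SO3 u -> sphere y ->
  Y l (order_of i) (u^T *m y) = \sum_j Y l (order_of j) y * D l u j i.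
Proof.
move=> su sy; rewrite -[Y l _ (_ *m y)](@conjCK' R) (rotated_harmonic hD _ (SO3_tr su) sy).
rewrite rmorph_sum; apply: eq_bigr => j _.
by rewrite rmorphM /= (@conjCK' R) (rotational_harmonic_tr hD _ _ su) (@conjCK' R) mulrC.
Qed.

(** Rotated harmonics stay in the finite span of their degree, so the noise enters only through one
    column of its Fourier matrix; integrability of [feps] suffices to exchange the sum and the
    integral. *)
Lemma noise_harmonic i y : sphere y ->
  Cintegral haar (@SO3 R) (fun u => (feps u)%:C * Y l (order_of i) (u^T *m y)) =
  \sum_j rot_fourier haar D feps l j i * Y l (order_of j) y.
Proof.
move=> sy; have mS := measurable_SO3.
rewrite (@eq_Cintegral _ _ _ _ _ _
  (fun u => \sum_j Y l (order_of j) y * ((feps u)%:C * D l u j i))) => [|u su].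
  have ci j : Cintegrable haar (@SO3 R) (fun u => (feps u)%:C * D l u j i).
    by apply: noise_Cintegrable; exact: Cbounded_measurable_rotational.
  rewrite Cintegral_sum//; last by move=> j; exact: CintegrableZl.
  by apply: eq_bigr => j _; rewrite CintegralZl// mulrC mxE.
by rewrite harmonic_tr_rotated// mulr_sumr; apply: eq_bigr => j _; rewrite mulrCA.
Qed.

Lemma noise_harmonic_integrable i y : sphere y ->
  haar.-integrable (@SO3 R) (fun u => (feps u * complex.Re (Y l (order_of i) (u^T *m y)))%:E).
Proof.
move=> sy.
have bh : Cbounded_measurable (@SO3 R) (fun u => \sum_j Y l (order_of j) y * D l u j i).
  apply: Cbounded_measurable_sum => j; apply: Cbounded_measurableM.
    exact: Cbounded_measurable_cst.
  exact: Cbounded_measurable_rotational.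
have [+ _] := noise_Cintegrable bh; apply: eq_integrable; first exact: measurable_SO3.
by move=> u /set_mem su; rewrite ReM /= mul0r subr0 harmonic_tr_rotated.
Qed.

(** The cube counts 2l + 1 terms, each at most the operator norm times the bound (2l + 1)^2 on a
    harmonic. *)
Lemma noise_harmonic_bound i y : sphere y ->
  `|Rintegral haar (@SO3 R) (fun u => feps u * complex.Re (Y l (order_of i) (u^T *m y)))| <=
  (2 * l + 1)%:R ^+ 3 * op_norm (rot_fourier haar D feps l).
Proof.
move=> sy; set F := rot_fourier haar D feps l.
have F0 : 0 <= op_norm F by rewrite (le_trans (normc_ge0 _) (op_norm_entry F i i)).
set z := Cintegral haar (@SO3 R) (fun u => (feps u)%:C * Y l (order_of i) (u^T *m y)).
have -> : Rintegral haar (@SO3 R) (fun u => feps u * complex.Re (Y l (order_of i) (u^T *m y))) =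
    complex.Re z.
  by apply: eq_Rintegral => u _; rewrite ReM /= mul0r subr0.
rewrite (le_trans (Re_le_normc _))// /z noise_harmonic// (le_trans (normc_sum _))//.
rewrite (@le_trans _ _ (\sum_(j < (2 * l).+1) (op_norm F * (2 * l + 1)%:R ^+ 2)))//.
  apply: ler_sum => j _; rewrite Normc.normcM ler_pM ?normc_ge0//.
    exact: op_norm_entry.
  exact: harmonic_bound hD sy.
rewrite sumr_const card_ord -[leLHS]mulr_natl; set o := op_norm F.
by rewrite -addn1 mulrCA -exprS mulrC.
Qed.

End NoiseBound.

(** * Law of the observations *)

Section PushforwardProbability.
Context d1 d2 (T1 : measurableType d1) (T2 : measurableType d2) (R : realType).

Definition ppush (P : probability T1 R) (f : T1 -> T2) (mf : measurable_fun setT f) :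
  probability T2 R := distribution P (mfun_Sub (mem_set mf)).

Lemma ppushE P f (mf : measurable_fun setT f) A : ppush P mf A = P (f @^-1` A).
Proof. by []. Qed.

End PushforwardProbability.

(** * Domination of product laws *)

Section Domination.
Local Open Scope ereal_scope.
Context d (T : measurableType d) (R : realType).
Import HBNNSimple.
Implicit Types m : {measure set T -> \bar R}.

Lemma le_measure_integral m1 m2 (c : R) (g : T -> \bar R) : (0 <= c)%R ->
  (forall A, measurable A -> c%:E * m1 A <= m2 A) ->
  measurable_fun setT g -> (forall x, 0 <= g x) ->
  c%:E * \int[m1]_x g x <= \int[m2]_x g x.
Proof.
rewrite le_eqVlt => /predU1P[<- _ mg g0|c0 m12 mg g0].
  by rewrite mul0e integral_ge0.
rewrite -lee_pdivlMl// [leLHS]ge0_integralTE//; apply: ge_ereal_sup => _ [h hg <-].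
rewrite lee_pdivlMl// [leRHS]ge0_integralTE//.
apply: (@le_trans _ _ (sintegral m2 h)); last by apply: ereal_sup_ubound; exists h.
rewrite !sintegralE ge0_mule_fsumr; last by move=> r; exact: nnsfun_mulemu_ge0.
apply: lee_fsum => // r _; have [r0|r0] := ltP r 0%R; first by rewrite preimage_nnfun0// !measure0 !mule0.
by rewrite muleCA lee_wpmul2l ?lee_fin// m12.
Qed.

(** The sides are indexed by the naturals, so that one family serves every length and the box of the
    tail is described by a shift. *)
Definition box n (C : nat -> set T) : set (n.-tuple T) :=
  [set t | forall i : 'I_n, C i (tnth t i)].

Lemma measurable_box n C : (forall i, measurable (C i)) -> measurable (@box n C).
Proof.
move=> mC; rewrite (_ : box C = \bigcap_(i : 'I_n) ((fun t => tnth t i) @^-1` C i)).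
  apply: fin_bigcap_measurable => // i _.
  by rewrite -[X in measurable X]setTI; exact: measurable_tnth.
by apply/seteqP; split => [t h i _|t h i]; exact: h.
Qed.

(** Boxes are stable by intersection and generate the sigma-algebra of tuples: a cylinder over one
    coordinate is a box whose other sides are full. *)
Lemma tuple_measure_unique n (m1 m2 : {measure set (n.-tuple T) -> \bar R}) :
  m1 setT < +oo ->
  (forall C, (forall i, measurable (C i)) -> m1 (box C) = m2 (box C)) ->
  forall B, measurable B -> m1 B = m2 B.
Proof.
move=> m1f m12; pose G := [set B | exists2 C, (forall i, measurable (C i)) & B = @box n C].
have boxT : @box n (fun=> setT) = setT by apply/seteqP; split.
apply: (measure_unique G (fun=> setT)) => //.
- apply/seteqP; split.
    apply: smallest_sub; first exact: smallest_sigma_algebra.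
    apply: (big_ind (fun S => S `<=` _)) => [//|A B hA hB|i _]; first by rewrite subUset.
    move=> _ [D mD <-]; rewrite setTI; apply: sub_sigma_algebra.
    exists (fun k => if k == i :> nat then D else setT) => [k|]; first by case: ifP.
    apply/seteqP; split => [t /= tD k|t /= /(_ i)]; last by rewrite eqxx.
    by case: eqVneq => // /val_inj ->.
  apply: smallest_sub.
    by split => // [B mB|F mF]; [rewrite setTD; exact: measurableC|exact: bigcupT_measurable].
  by move=> _ [C mC ->]; exact: measurable_box.
- move=> _ _ [C mC ->] [C' mC' ->]; exists (fun i => C i `&` C' i).
    by move=> i; exact: measurableI.
  by apply/seteqP; split => [t [h h'] i|t h]; [split|split=> i; case: (h i)].
- by move=> _; exists (fun=> setT).
- by rewrite bigcup_const//; exists 0%N.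
- by move=> _ [C mC ->]; exact: m12.
Qed.

(** The set B is not a box, so the factors cannot be compared directly. Slicing B along the first
    coordinate, the tail laws are compared inside the integral by induction, then the head laws by
    [le_measure_integral]. *)
Lemma tuple_domination (Q0 Q1 : probability T R) (c : R) : (0 <= c)%R ->
  (forall A, measurable A -> c%:E * Q0 A <= Q1 A) ->
  forall n (L0 L1 : probability (n.-tuple T) R),
  (forall C, (forall i, measurable (C i)) -> L0 (box C) = \prod_(i < n) Q0 (C i)) ->
  (forall C, (forall i, measurable (C i)) -> L1 (box C) = \prod_(i < n) Q1 (C i)) ->
  forall B, measurable B -> (c ^+ n)%:E * L0 B <= L1 B.
Proof.
move=> c0 Q01; elim=> [|n ih] L0 L1 hL0 hL1 B mB.
  (* For empty tuples both laws give every box the empty product, so they coincide. *)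
  rewrite expr0 mul1e (tuple_measure_unique (m1 := L0) (m2 := L1))//.
    by rewrite (le_lt_trans (probability_le1 _ _))// ltry.
  move=> C mC; move: (hL0 C mC) (hL1 C mC); rewrite !big_ord0 => a b.
  exact: etrans a (esym b).
have mbehead : measurable_fun setT (fun t : n.+1.-tuple T => [tuple of behead t]).
  exact: measurable_behead.
have tnthB (t : n.+1.-tuple T) (j : 'I_n) : tnth [tuple of behead t] j = tnth t (lift ord0 j).
  by rewrite tnth_behead (_ : inord _ = lift ord0 j)//; apply: val_inj; rewrite /= inordK// ltnS.
have mcons : measurable_fun setT (fun p : T * n.-tuple T => [tuple of p.1 :: p.2]).
  by apply: measurable_cons; [exact: measurable_fst|exact: measurable_snd].
have behead_box (L : probability (n.+1.-tuple T) R) (Q : probability T R) :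
    (forall C, (forall i, measurable (C i)) -> L (box C) = \prod_(i < n.+1) Q (C i)) ->
    forall C, (forall i, measurable (C i)) ->
    ppush L mbehead (box C) = \prod_(i < n) Q (C i).
  move=> hL C mC; pose C' k := if k is k'.+1 then C k' else setT.
  have mC' k : measurable (C' k) by case: k => //=.
  rewrite ppushE (_ : _ @^-1` _ = box C').
    rewrite hL// big_ord_recl /= probability_setT mul1e.
    by apply: eq_bigr => i _.
  apply/seteqP; split => t /= h i.
    case: (unliftP ord0 i) => [j|] -> //=.
    by have := h j; rewrite tnthB.
  by rewrite tnthB; exact: (h (lift ord0 i)).
(* L agrees on boxes with the product of Q and the law of the tail, so it is that product and can be
   sliced. *)
have rec (L : probability (n.+1.-tuple T) R) (Q : probability T R) :
    (forall C, (forall i, measurable (C i)) -> L (box C) = \prod_(i < n.+1) Q (C i)) ->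
    L B = \int[Q]_x ppush L mbehead
      (xsection ((fun p : T * n.-tuple T => [tuple of p.1 :: p.2]) @^-1` B) x).
  move=> hL.
  apply: (@tuple_measure_unique _ L (mpushforward (Q \x ppush L mbehead) mcons)) => //.
    by rewrite (le_lt_trans (probability_le1 _ _))// ltry.
  move=> C mC; apply: (etrans (hL C mC)); rewrite big_ord_recl/= /pushforward.
  rewrite (_ : _ @^-1` _ = C 0%N `*` box (fun i => C i.+1)); last first.
    apply/seteqP; split => [[x t] /= h|[x t] [/= h0 h] i].
      split=> [|i]; first exact: (h ord0).
      by have := h (lift ord0 i); rewrite tnthS.
    case: (unliftP ord0 i) => [j|] ->; last by rewrite tnth0.
    by rewrite tnthS; exact: h.
  rewrite [RHS]product_measure1E//; last by apply: measurable_box => i.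
  by congr (_ * _); apply/esym; exact: (behead_box _ Q hL _ (fun i => mC i.+1)).
have mB' : measurable ((fun p : T * n.-tuple T => [tuple of p.1 :: p.2]) @^-1` B).
  by rewrite -[X in measurable X]setTI; exact: mcons.
rewrite (rec L0 Q0)// (rec L1 Q1)// exprS EFinM -muleA.
have cn0 : (0 <= c ^+ n)%R by exact: exprn_ge0.
have mx (L : probability (n.+1.-tuple T) R) : measurable_fun setT (fun x => ppush L mbehead
      (xsection ((fun p : T * n.-tuple T => [tuple of p.1 :: p.2]) @^-1` B) x)).
  exact: (measurable_fun_xsection (ppush L mbehead) mB').
rewrite -ge0_integralZl//.
apply: (@le_trans _ _ (c%:E * \int[Q0]_x ppush L1 mbehead
      (xsection ((fun p : T * n.-tuple T => [tuple of p.1 :: p.2]) @^-1` B) x))).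
  rewrite lee_wpmul2l ?lee_fin//; apply: ge0_le_integral => //.
  - by move=> x _; rewrite mule_ge0// lee_fin.
  - exact: measurable_funeM.
  - move=> x _; apply: ih; [exact: behead_box|exact: behead_box|].
    exact: measurable_xsection.
exact: le_measure_integral.
Qed.

End Domination.

(** * Independence from a generating class stable by intersection *)

Section IndependenceExtension.
Local Open Scope ereal_scope.
Context d (Om : measurableType d) d' (T : measurableType d') (R : realType).
Variables (P : probability Om R) (W : nat -> Om -> T) (G : set_system T).
Hypotheses (mW : forall i, measurable_fun setT (W i)).
Hypotheses (mG : @measurable _ T = <<s G >>) (GI : setI_closed G) (GT : G setT).
Variable N : nat.

Let evt (E : nat -> set T) := [set w | forall i, (i < N)%N -> E i (W i w)].
Let rule E := P (evt E) = \prod_(i < N) P (W i @^-1` E i).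
Hypothesis indep : forall E, (forall i, G (E i)) -> rule E.

(** The model gives the product rule for rectangles in the pair (noise, signal), but the event that
    an observation falls in a set is not a rectangle; this lemma bridges the gap. *)
Lemma independence_extension (E : nat -> set T) : (forall i, measurable (E i)) -> rule E.
Proof.
have GM A : G A -> measurable A by rewrite mG; exact: sub_sigma_algebra.
have mpre i A : measurable A -> measurable (W i @^-1` A).
  by move=> mA; rewrite -[X in measurable X]setTI; exact: mW.
have mevt F : (forall i, measurable (F i)) -> measurable (evt F).
  move=> mF; rewrite (_ : evt F = \bigcap_(i < N) (W i @^-1` F i)).
    by apply: fin_bigcap_measurable => [|i _]; [exact: finite_II|exact: mpre].
  by apply/seteqP; split.
(* The events of G are replaced by arbitrary ones one coordinate at a time. *)
suff H k : forall F, (forall i, measurable (F i)) -> (forall i, (k <= i)%N -> G (F i)) -> rule F.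
  move=> mE; pose F i := if (i < N)%N then E i else setT.
  have : rule F.
    apply: (H N) => i; first by rewrite /F; case: ifP.
    by rewrite leqNgt /F => /negbTE ->.
  rewrite /rule (_ : evt F = evt E); last first.
    by apply/seteqP; split => w h i iN; have := h i iN; rewrite /F iN.
  by move=> ->; apply: eq_bigr => i _; rewrite /F ltn_ord.
elim: k => [F _ GF|k ih F mF GF]; first by apply: indep => i; exact: GF.
have [kN|Nk] := ltnP k N; last first.
  pose F' i := if i == k then setT else F i.
  have : rule F'.
    apply: ih => i; first by rewrite /F'; case: ifP.
    by rewrite leq_eqVlt eq_sym /F' => /predU1P[->|ki]; [rewrite eqxx|rewrite gtn_eqF//; exact: GF].
  rewrite /rule (_ : evt F' = evt F); last first.
    by apply/seteqP; split => w h i iN; have := h i iN; rewrite /F' ltn_eqF// (leq_trans iN).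
  by move=> ->; apply: eq_bigr => i _; rewrite /F' ltn_eqF// (leq_trans _ Nk).
pose F' A i := if i == k then A else F i.
pose c := \prod_(i < N | i != Ordinal kN) P (W i @^-1` F i).
have c_fin : c \is a fin_num.
  by apply: prode_fin_num => i _; rewrite fin_num_measure//; exact: mpre.
have c0 : (0 <= fine c)%R by rewrite fine_ge0// prode_ge0.
have cE A : \prod_(i < N) P (W i @^-1` F' A i) = c * P (W k @^-1` A).
  rewrite (bigD1 (Ordinal kN))//= {1}/F' eqxx muleC; congr (_ * _).
  by apply: eq_bigr => i ik; rewrite /F' ifN.
have mE' : measurable (evt (F' setT)) by apply: mevt => i; rewrite /F'; case: ifP.
have evtE A : evt (F' A) = W k @^-1` A `&` evt (F' setT).
  apply/seteqP; split => w /=.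
    by move=> h; split => [|i iN]; [have := h k kN|have := h i iN]; rewrite /F' ?eqxx//; case: ifP.
  by move=> [h1 h2] i iN; have := h2 i iN; rewrite /F'; case: eqP => // ->.
have FE : F' (F k) = F by apply/funext => i; rewrite /F'; case: eqP => // ->.
rewrite /rule -FE cE evtE -[c]fineK//.
(* As functions of the k-th event alone, both sides of the product rule are finite measures, and
   they agree on G by induction. *)
pose m1 : {measure set T -> \bar R} := mpushforward (mrestr P mE') (mW k).
pose m2 : {measure set T -> \bar R} := mscale (NngNum c0) (mpushforward P (mW k)).
suff : m1 (F k) = m2 (F k) by [].
apply: (measure_unique G (fun=> setT)) => //.
- by rewrite bigcup_const//; exists 0%N.
- move=> A GA; rewrite /= /mscale/= /mrestr/pushforward fineK// -evtE -cE; apply: ih => i.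
    by rewrite /F'; case: ifP => _; [exact: GM|].
  by rewrite leq_eqVlt eq_sym /F' => /predU1P[->|ki]; [rewrite eqxx|rewrite gtn_eqF//; exact: GF].
- move=> _; apply: (le_lt_trans (probability_le1 P _)); last exact: ltry.
  by rewrite preimage_setT setTI.
Qed.

End IndependenceExtension.

Lemma ge0_integral_SO3 (R : realType) (u : 'M[R]_3) (h : 'cV[R]_3 -> \bar R) : SO3 u ->
  measurable_fun setT h -> (forall x, 0 <= h x)%E ->
  (\int[@sphere_measure R]_x h (u *m x) = \int[@sphere_measure R]_x h x)%E.
Proof.
move=> su mh h0; have mu := measurable_mulmx u.
transitivity (\int[mpushforward (@sphere_measure R) mu]_x h x)%E.
  by rewrite ge0_integral_pushforward// => x _.
by apply: eq_measure_integral => A mA _; exact: sphere_symmetry_SO3 su A mA.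
Qed.

Lemma measurable_trmx_mulmx (R : realType) :
  measurable_fun setT (fun p : 'M[R]_3 * 'cV[R]_3 => p.1^T *m p.2).
Proof.
apply/measurable_fun_matrixP => j k; under eq_fun do rewrite mxE.
apply: measurable_sum => l; apply: measurable_funM.
  under eq_fun do rewrite mxE.
  exact: (measurableT_comp (measurable_entry l j) measurable_fst).
exact: (measurableT_comp (measurable_entry l k) measurable_snd).
Qed.

(** * The density of one observation *)

Section ObservationLaw.
Local Open Scope ereal_scope.
Context (R : realType) d (Om : measurableType d).
Variables (P : ('cV[R]_3 -> R) -> probability Om R)
  (eps : nat -> Om -> 'M[R]_3) (X : nat -> Om -> 'cV[R]_3)
  (haar : probability 'M[R]_3 R) (feps : 'M[R]_3 -> R).
Hypothesis hfeps : is_density haar (@SO3 R) feps.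
Hypothesis model : deconvolution_model P eps X haar feps.
Notation sigma := (@sphere_measure R).

Let meps := model_eps_meas model.
Let mX := model_X_meas model.

Lemma measurable_observation i : measurable_fun setT (fun w => eps i w *m X i w).
Proof.
apply: (@measurableT_comp _ _ _ _ _ _ (fun p : 'M[R]_3 * 'cV[R]_3 => p.1 *m p.2) _
  (fun w => (eps i w, X i w))); first exact: measurable_mulmx2.
exact: measurable_fun_pair (meps i) (mX i).
Qed.

Lemma observation_pair f i (A : set 'M[R]_3) (B : set 'cV[R]_3) : sphere_density f ->
  measurable A -> measurable B ->
  P f (eps i @^-1` A `&` X i @^-1` B) = P f (eps i @^-1` A) * P f (X i @^-1` B).
Proof.
(* Independence inside the i-th pair is the product rule for i + 1 observations with full sets at
   the earlier indices. *)
move=> hf mA mB; pose A' k := if k == i then A else setT.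
pose B' k := if k == i then B else setT.
have := model_indep model hf i.+1 (A := A') (B := B').
rewrite (_ : [set w | _] = eps i @^-1` A `&` X i @^-1` B); last first.
  apply/seteqP; split => [w /(_ i (ltnSn i))|w h k ki]; rewrite /A' /B'; first by rewrite eqxx.
  by case: eqP => // ->.
move=> ->; [|by move=> k; rewrite /A'; case: ifP|by move=> k; rewrite /B'; case: ifP].
rewrite big_ord_recr /= big1 ?mul1e => [|k _]; first by rewrite /A' /B' eqxx.
by rewrite /A' /B' ltn_eqF// !preimage_setT probability_setT mule1.
Qed.

Lemma observations_indep f N (C : nat -> set 'cV[R]_3) : sphere_density f ->
  (forall i, measurable (C i)) ->
  P f [set w | forall i, (i < N)%N -> C i (eps i w *m X i w)] =
  \prod_(i < N) P f [set w | C i (eps i w *m X i w)].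
Proof.
move=> hf mC.
pose W i w := (eps i w, X i w).
have mW i : measurable_fun setT (W i) by exact: measurable_fun_pair (meps i) (mX i).
pose G : set_system ('M[R]_3 * 'cV[R]_3) :=
  [set A `*` B | A in measurable & B in measurable].
have GI : setI_closed G.
  move=> _ _ [A mA [B mB <-]] [A' mA' [B' mB' <-]].
  exists (A `&` A'); first exact: measurableI.
  by exists (B `&` B'); [exact: measurableI|rewrite setXI].
have GT : G setT by exists setT => //; exists setT => //; rewrite setXTT.
apply: (@independence_extension _ _ _ _ _ (P f) W G mW
  (measurable_prod_measurableType _ _) GI GT N _
  (fun i => (fun p : 'M[R]_3 * 'cV[R]_3 => p.1 *m p.2) @^-1` C i)) => [E GE|i]; last first.
  by rewrite -[X in measurable X]setTI; exact: measurable_mulmx2.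
have /choice[A hA] i : exists A, measurable A /\ exists2 B, measurable B & E i = A `*` B.
  by have [A mA [B mB AB]] := GE i; exists A; split => //; exists B.
have /choice[B hB] i : exists B, measurable B /\ E i = A i `*` B.
  by have [_ [B mB AB]] := hA i; exists B.
have := model_indep model hf N (fun i => (hA i).1) (fun i => (hB i).1).
have EE i : [set w | E i (W i w)] = eps i @^-1` A i `&` X i @^-1` B i.
  by rewrite (hB i).2.
rewrite (_ : [set w | _] = [set w | forall i, (i < N)%N -> E i (W i w)]); last first.
  by apply/seteqP; split => w h i iN; have := h i iN; rewrite (hB i).2.
move=> ->; apply: eq_bigr => i _; rewrite [W i @^-1` _]EE.
by rewrite observation_pair//; [case: (hA i)|case: (hB i)].
Qed.

(** Under the product law of noise and signal, invariance of the surface measure allows the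
    substitution x = u^T y for each rotation u, and Tonelli then integrates over u first. *)
Lemma observation_law f i (A : set 'cV[R]_3) : sphere_density f -> measurable A ->
  P f [set w | A (eps i w *m X i w)] =
  \int[sigma]_(y in sphere `&` A) \int[haar]_(u in @SO3 R) (feps u * f (u^T *m y))%:E.
Proof.
move=> hf mA; have [mf f0 f1] := hf; have [mfe fe0 fe1] := hfeps.
have mSO := @measurable_SO3 R; have mS := @measurable_sphere R.
(* The densities are constrained only on SO3 and on the sphere; their extensions by zero are
   nonnegative and measurable everywhere. *)
pose fe := feps \_ (@SO3 R); pose ff := f \_ (@sphere R).
have mfe' : measurable_fun setT fe by exact/(measurable_restrictT _ _).1.
have mff : measurable_fun setT ff by exact/(measurable_restrictT _ _).1.
have fe0' u : (0 <= fe u)%R by rewrite /fe patchE; case: ifPn => // /[!inE]; exact: fe0.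
have ff0 x : (0 <= ff x)%R by rewrite /ff patchE; case: ifPn => // /[!inE]; exact: f0.
pose Le := ppush (P f) (meps i); pose LX := ppush (P f) (mX i).
have LeE (B : set 'M[R]_3) : measurable B -> Le B = mdensity haar mfe' fe0' B.
  move=> mB; rewrite /Le ppushE (model_eps_law model hf)// /mdensity.
  rewrite setIC integral_mkcondr; apply: eq_integral => u _.
  by rewrite /fe !patchE; case: ifP.
have LXE (B : set 'cV[R]_3) : measurable B -> LX B = mdensity sigma mff ff0 B.
  move=> mB; rewrite /LX ppushE (model_X_law model hf)// /mdensity.
  rewrite setIC integral_mkcondr; apply: eq_integral => u _.
  by rewrite /ff !patchE; case: ifP.
pose W w := (eps i w, X i w).
have mW : measurable_fun setT W by exact: measurable_fun_pair (meps i) (mX i).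
pose A' := (fun p : 'M[R]_3 * 'cV[R]_3 => p.1 *m p.2) @^-1` A.
have mA' : measurable A'.
  by rewrite -[X in measurable X]setTI; exact: measurable_mulmx2.
have -> : P f [set w | A (eps i w *m X i w)] = (Le \x LX) A'.
  apply/esym; apply: (product_measure_unique (m' := mpushforward (P f) mW)) => //.
  move=> B C mB mC; rewrite [LHS]/=/pushforward.
  exact: observation_pair.
have inner u : SO3 u -> LX (xsection A' u) = \int[sigma]_y (ff (u^T *m y) * \1_A y)%:E.
  move=> su; have mu := measurable_mulmx u^T; rewrite LXE; last exact: measurable_xsection.
  rewrite /mdensity integral_mkcond.
  rewrite -[RHS](ge0_integral_SO3 su).
  - apply: eq_integral => x _; rewrite !patchE mulmxA SO3_trK// mul1mx.
    rewrite indicE.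
    rewrite (_ : (x \in xsection A' u) = (u *m x \in A)).
      by case: ifP => _; rewrite ?mulr1 ?mulr0.
    by rewrite mem_xsection /A'; apply/idP/idP; rewrite !inE.
  - apply/measurable_EFinP; apply: measurable_funM; first exact: (measurableT_comp mff mu).
    exact: measurable_indic.
  - by move=> x; rewrite lee_fin mulr_ge0.
transitivity (\int[Le]_u LX (xsection A' u)) => //.
rewrite (eq_measure_integral (mdensity haar mfe' fe0')); last by move=> B mB _; exact: LeE.
rewrite ge0_integral_mdensity//; last exact: (measurable_fun_xsection LX mA').
pose H (p : 'M[R]_3 * 'cV[R]_3) := (fe p.1 * (ff (p.1^T *m p.2) * \1_A p.2))%:E.
have H0 p : 0 <= H p by rewrite lee_fin !mulr_ge0.
have mH : measurable_fun setT H.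
  apply/measurable_EFinP; apply: measurable_funM.
    exact: (measurableT_comp mfe' measurable_fst).
  apply: measurable_funM; first exact: (measurableT_comp mff (@measurable_trmx_mulmx R)).
  exact: (measurableT_comp (measurable_indic mA) measurable_snd).
transitivity (\int[haar]_u \int[sigma]_y H (u, y)).
  apply: eq_integral => u _; have [su|nsu] := pselect (SO3 u).
    rewrite inner// muleC -ge0_integralZl//; last 2 first.
    - by move=> x _; rewrite lee_fin mulr_ge0.
    - by rewrite lee_fin.
    apply/measurable_EFinP; apply: measurable_funM.
      exact: (measurableT_comp mff (measurable_mulmx u^T)).
    exact: measurable_indic.
  have fu : fe u = 0%R by rewrite /fe patchE memNset.
  by rewrite fu mule0 integral0_eq// => y _; rewrite /H /= fu mul0r.
rewrite (fubini_tonelli _ mH)// [RHS]integral_mkcond; apply: eq_integral => y _.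
rewrite patchE; case: ifPn => [/set_mem[sy Ay]|/negP nAy].
  rewrite [RHS]integral_mkcond; apply: eq_integral => u _; rewrite patchE /H /=.
  rewrite indicE mem_set// mulr1 /fe patchE; case: ifPn => [/set_mem su|_]; last by rewrite mul0r.
  by rewrite /ff patchE mem_set// sphere_SO3//; exact: SO3_tr.
rewrite integral0_eq// => u _; rewrite /H /fe /ff /= !patchE indicE.
have [su|nsu] := pselect (SO3 u); last by rewrite memNset// mul0r.
rewrite (mem_set su); case: ifPn => [/set_mem sy|_]; last by rewrite mul0r mulr0.
rewrite memNset ?mulr0// => Ay; apply: nAy; apply/mem_set; split => //.
by move: sy; rewrite sphere_SO3//; exact: SO3_tr.
Qed.

End ObservationLaw.

(** The convolution of [feps] and f, with u^T for the inverse of u. It is kept in the extended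
    reals, since for general densities it may be infinite at some points. *)
Definition observation_density (R : realType) (haar : probability 'M[R]_3 R)
    (feps : 'M[R]_3 -> R) (f : 'cV[R]_3 -> R) (y : 'cV[R]_3) : \bar R :=
  (\int[haar]_(u in @SO3 R) (feps u * f (u^T *m y))%:E)%E.

Lemma measurable_observation_density (R : realType) (haar : probability 'M[R]_3 R)
    (feps : 'M[R]_3 -> R) (f : 'cV[R]_3 -> R) :
  is_density haar (@SO3 R) feps -> sphere_density f ->
  measurable_fun (@sphere R) (observation_density haar feps f).
Proof.
move=> [mfe fe0 _] [mf f0 _].
have mSO := @measurable_SO3 R; have mS := @measurable_sphere R.
pose fe := feps \_ (@SO3 R); pose ff := f \_ (@sphere R).
have mfe' : measurable_fun setT fe by exact/(measurable_restrictT _ _).1.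
have mff : measurable_fun setT ff by exact/(measurable_restrictT _ _).1.
pose H (p : 'M[R]_3 * 'cV[R]_3) := (fe p.1 * ff (p.1^T *m p.2))%:E.
have H0 p : (0 <= H p)%E.
  rewrite lee_fin mulr_ge0 // /fe /ff patchE; case: ifPn => // /[!inE]; [exact: fe0|exact: f0].
have mH : measurable_fun setT H.
  apply/measurable_EFinP; apply: measurable_funM.
    exact: (measurableT_comp mfe' measurable_fst).
  exact: (measurableT_comp mff (@measurable_trmx_mulmx R)).
apply: (@eq_measurable_fun _ _ _ _ _ (fun y => \int[haar]_u H (u, y))%E).
  move=> y /set_mem sy; rewrite /observation_density [RHS]integral_mkcond.
  apply: eq_integral => u _; rewrite patchE /H /= /fe patchE.
  case: ifPn => [/set_mem su|_]; last by rewrite mul0r.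
  by rewrite /ff patchE mem_set// sphere_SO3//; exact: SO3_tr.
apply: measurable_funTS.
exact: (@measurable_fun_fubini_tonelli_G _ _ _ _ _ haar _ mH H0).
Qed.

(** * From pointwise domination to a lower bound on the risk *)

Section RiskBound.
Local Open Scope ereal_scope.
Context (R : realType) d (Om : measurableType d).
Variables (P : ('cV[R]_3 -> R) -> probability Om R)
  (eps : nat -> Om -> 'M[R]_3) (X : nat -> Om -> 'cV[R]_3)
  (haar : probability 'M[R]_3 R) (feps : 'M[R]_3 -> R).
Hypothesis hfeps : is_density haar (@SO3 R) feps.
Hypothesis model : deconvolution_model P eps X haar feps.
Notation sigma := (@sphere_measure R).
Variables (f0 f1 : 'cV[R]_3 -> R) (c : R).
Hypotheses (hf0 : sphere_density f0) (hf1 : sphere_density f1) (c0 : (0 <= c)%R).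

Notation g := (observation_density haar feps).
Hypothesis g01 : forall y, sphere y -> c%:E * g f0 y <= g f1 y.

Lemma measurable_observations N : measurable_fun setT (observations eps X N).
Proof.
apply/measurable_fun_tnthP => i; rewrite (_ : _ \o _ = fun w => eps i w *m X i w).
  exact: measurable_observation model i.
by apply/funext => w; rewrite /= tnth_mktuple.
Qed.

Lemma observations_domination N (B : set (N.-tuple 'cV[R]_3)) : measurable B ->
  (c ^+ N)%:E * P f0 [set w | B (observations eps X N w)] <=
  P f1 [set w | B (observations eps X N w)].
Proof.
move=> mB.
have mobs := @measurable_observations N.
have mg := measurable_observation_density hfeps.
pose Q f := ppush (P f) (measurable_observation model 0).
have g_ge0 f y : sphere_density f -> sphere y -> 0 <= g f y.
  move=> [_ fge0 _] sy; apply: integral_ge0 => u su; rewrite lee_fin mulr_ge0//.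
    by case: hfeps => _ + _; exact.
  by apply: fge0; rewrite sphere_SO3//; exact: SO3_tr.
have QE f i A : sphere_density f -> measurable A ->
    P f [set w | A (eps i w *m X i w)] = Q f A.
  move=> hf mA; rewrite /Q ppushE; apply: (etrans (observation_law hfeps model _ hf mA)).
  exact: (esym (observation_law hfeps model 0 hf mA)).
have box f : sphere_density f -> forall C, (forall i, measurable (C i)) ->
    ppush (P f) mobs (@box _ _ N C) = \prod_(i < N) Q f (C i).
  move=> hf C mC; transitivity (\prod_(i < N) P f [set w | C i (eps i w *m X i w)]); last first.
    by apply: eq_bigr => i _; exact: QE.
  rewrite -(observations_indep model N hf mC) ppushE; congr (P f _).
  apply/seteqP; split => w /= h i; last by rewrite tnth_mktuple; exact: h.
  by move=> iN; have := h (Ordinal iN); rewrite tnth_mktuple.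
apply: (tuple_domination (Q0 := Q f0) (Q1 := Q f1) c0 _
  (L0 := ppush (P f0) mobs) (L1 := ppush (P f1) mobs)) => //; try exact: box.
move=> A mA; rewrite -(QE f0 0%N A hf0 mA) -(QE f1 0%N A hf1 mA).
have -> := observation_law hfeps model 0 hf0 mA; have -> := observation_law hfeps model 0 hf1 mA.
have mSA : measurable (sphere `&` A) by apply: measurableI => //; exact: measurable_sphere.
have mgA f : sphere_density f -> measurable_fun (sphere `&` A) (g f).
  move=> hf; apply: measurable_funS (mg f hf); first exact: measurable_sphere.
  by move=> y [].
rewrite -ge0_integralZl//; last 2 first.
- exact: mgA.
- by move=> y [sy _]; exact: g_ge0.
apply: ge0_le_integral => //.
- by move=> y [sy _]; rewrite mule_ge0 ?lee_fin// g_ge0.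
- by apply: measurable_funeM; exact: mgA.
- exact: mgA.
- by move=> y [sy _]; exact: g01.
Qed.

End RiskBound.

(** With p the error of the first kind and q = c^N, the error of the second kind is at least q (1 -
    p), and p + q (1 - p) >= q because q <= 1. *)
Lemma minimax_risk_ge (R : realType) d (Om : measurableType d)
    (P : ('cV[R]_3 -> R) -> probability Om R)
    (eps : nat -> Om -> 'M[R]_3) (X : nat -> Om -> 'cV[R]_3) (s r rho c : R) (N : nat)
    (f1 : 'cV[R]_3 -> R) :
  0 <= c <= 1 -> alternatives s r rho f1 ->
  measurable_fun setT (observations eps X N) ->
  (forall B : set (N.-tuple 'cV[R]_3), measurable B ->
    (c ^+ N)%:E * P uniform_density [set w | B (observations eps X N w)] <=
    P f1 [set w | B (observations eps X N w)])%E ->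
  ((c ^+ N)%:E <= minimax_risk P eps X s r rho N)%E.
Proof.
move=> /andP[c0 c1] alt mobs dom; apply: le_ereal_inf_tmp => _ [Delta mD <-].
have mDb b : measurable [set t | Delta t = b].
  by rewrite -[X in measurable X]setTI; exact: (mD measurableT [set b]).
pose A := [set w | Delta (observations eps X N w) = true].
have mA : measurable A.
  by rewrite -[X in measurable X]setTI; exact: (mobs measurableT _ (mDb true)).
have AC : [set w | Delta (observations eps X N w) = false] = ~` A.
  by apply/seteqP; split => w /=; rewrite /A /=; case: (Delta _).
have := dom _ (mDb false); rewrite /= AC => domA.
have cN : 0 <= c ^+ N <= 1 by rewrite exprn_ge0// exprn_ile1.
move: cN; set q := c ^+ N => /andP[q0 q1].
apply: (@le_trans _ _ (P uniform_density A + P f1 (~` A))%E); last first.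
  by rewrite leeD2l// le_max; apply/orP; right; apply: ereal_sup_ubound; exists f1 => //; rewrite AC.
apply: (@le_trans _ _ (P uniform_density A + q%:E * P uniform_density (~` A))%E); last first.
  by rewrite leeD2l.
rewrite probability_setC//.
have [p pE] : exists p, P uniform_density A = p%:E.
  by exists (fine (P uniform_density A)); rewrite fineK// fin_num_measure.
have p0 : 0 <= p by rewrite -lee_fin -pE.
have p1 : p <= 1 by rewrite -lee_fin -pE probability_le1.
by rewrite pE -EFinB -EFinM -EFinD lee_fin; nra.
Qed.

(** * The alternative *)

Section PolynomialFunctions.
Context (R : realType).

(** The Sobolev space is a closure of restrictions of smooth functions on R^3. This class contains
    the perturbation and is stable under directional derivatives, so smoothness of every order
    follows by induction. *)
Inductive polyfun : ('cV[R]_3 -> R) -> Prop :=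
| PolyCst c : polyfun (cst c)
| PolyCoord i : polyfun (fun x => x i 0)
| PolyAdd f g : polyfun f -> polyfun g -> polyfun (f + g)
| PolyMul f g : polyfun f -> polyfun g -> polyfun (f * g).

Lemma polyfun_continuous f : polyfun f -> continuous f.
Proof.
elim=> [c|i|f' g _ cf _ cg|f' g _ cf _ cg] x.
- exact: cst_continuous.
- exact: coord_continuous.
- exact: (continuousD (cf x) (cg x)).
- exact: (continuousM (cf x) (cg x)).
Qed.

Lemma polyfun_derive f (v : 'cV[R]_3) : polyfun f ->
  (forall x, derivable f x v) /\ polyfun (fun x => 'D_v f x).
Proof.
elim=> [c|i|f' g _ [df pf] _ [dg pg]|f' g mf [df pf] mg [dg pg]].
- split=> [x|]; first exact: derivable_cst.
  rewrite (_ : (fun x => _) = cst 0); first exact: PolyCst.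
  by apply/funext => x; rewrite derive_cst.
- have E (x : 'cV[R]_3) :
      h^-1 *: ((h *: v + x) i 0 - x i 0) @[h --> 0^'] --> v i 0.
    apply: cvg_near_cst; near=> h.
    have h0 : h != 0 by near: h; exact: nbhs_dnbhs_neq.
    by rewrite !mxE addrK -[RHS]mul1r -(mulVf h0) -mulrA.
  split=> [x|]; first by apply/cvg_ex; exists (v i 0); exact: E.
  rewrite (_ : (fun x => _) = cst (v i 0)); first exact: PolyCst.
  by apply/funext => x; apply: cvg_lim (E x).
- split=> [x|]; first exact: derivableD.
  rewrite (_ : (fun x => _) = (fun x => 'D_v f' x) + (fun x => 'D_v g x)); first exact: PolyAdd.
  by apply/funext => x; rewrite deriveD.
- split=> [x|]; first exact: derivableM.
  rewrite (_ : (fun x => _) = f' * (fun x => 'D_v g x) + g * (fun x => 'D_v f' x)).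
    by apply: PolyAdd; exact: PolyMul.
  by apply/funext => x; rewrite deriveM.
Unshelve. all: by end_near. Qed.

Lemma polyfun_smooth f : polyfun f -> smooth f.
Proof.
move=> pf k; elim: k f pf => [|k ih] f pf /=; first by split => //; exact: polyfun_continuous.
split; first exact: polyfun_continuous.
by move=> i; have [df pdf] := polyfun_derive (delta_mx i 0) pf; split => //; exact: ih.
Qed.

Lemma polyfun_xyC n : polyfun (fun x : 'cV[R]_3 => complex.Re (xyC x ^+ n)) /\
  polyfun (fun x : 'cV[R]_3 => complex.Im (xyC x ^+ n)).
Proof.
elim: n => [|n [pr pi]].
  by split; under eq_fun do rewrite expr0; [exact: (PolyCst 1)|exact: (PolyCst 0)].
split; under eq_fun do rewrite exprS ?ReM ?ImM.
  rewrite (_ : (fun x => _) = (fun x : 'cV[R]_3 => x 0 0) * (fun x : 'cV[R]_3 => complex.Re (xyC x ^+ n)) +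
     cst (-1) * ((fun x : 'cV[R]_3 => x 1 0) * (fun x : 'cV[R]_3 => complex.Im (xyC x ^+ n)))); last first.
    by apply/funext => x; rewrite !fctE mulN1r.
  by do ![apply: PolyAdd|apply: PolyMul|exact: PolyCoord|exact: PolyCst].
rewrite (_ : (fun x => _) = (fun x : 'cV[R]_3 => x 0 0) * (fun x : 'cV[R]_3 => complex.Im (xyC x ^+ n)) +
     ((fun x : 'cV[R]_3 => x 1 0) * (fun x : 'cV[R]_3 => complex.Re (xyC x ^+ n)))); last first.
  by apply/funext => x; rewrite !fctE.
by do ![apply: PolyAdd|apply: PolyMul|exact: PolyCoord|exact: PolyCst].
Qed.

End PolynomialFunctions.

(** * Size and Fourier expansion of the perturbation *)

Section Perturbation.
Local Open Scope complex_scope.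
Local Open Scope ring_scope.
Context (R : realType).
Local Notation C := R[i].
Notation sigma := (@sphere_measure R).
Notation Y := (@spherical_harmonic R).
Notation CS := (Cintegral sigma (@sphere R)).
Notation bmS := (Cbounded_measurable (@sphere R)).
Notation normc := Normc.normc.
Notation h0 := (harmonic_coef R 0 0).

(** The l-th derivative of P_l is the constant (2l)! / (2^l l!), so Y^l_l is this coefficient times
    (x + i y)^l. *)
Definition top_coef l : R := harmonic_coef R l l * (legendre_coef R l * (2 * l)`!%:R).

Lemma harmonic_top l x : Y l l x = (top_coef l)%:C * xyC x ^+ l.
Proof.
suff E : ((@legendre R l)^`(l)).[x 2 0] = legendre_coef R l * (2 * l)`!%:R.
  by rewrite /spherical_harmonic spherical_harmonic_natE E /top_coef [in RHS]rmorphM.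
rewrite derivn_legendre.
have -> : (rodrigues R l)^`(l + l) = ((2 * l)`!%:R)%:P.
  apply/polyP => i; rewrite coef_derivn coefC; case: i => [|i] /=.
    have -> : (l + l = 2 * l)%N by lia.
    by rewrite addn0 ffactnn lead_rodrigues.
  by rewrite nth_default ?mul0rn// size_rodrigues; lia.
by rewrite hornerZ hornerC.
Qed.

Lemma top_coef_sqr l : (top_coef l ^+ 2) ^+ 2 <= (2 * l + 1)%:R / (4 * pi) ^+ 2.
Proof.
(* W k = binom(2k, k) / 4^k, and W k ^ 2 (2k + 1) decreases from 1. *)
pose W k : R := (2 * k)`!%:R / (2 ^ k * k`!)%:R ^+ 2.
have W1 k : W k ^+ 2 * (2 * k + 1)%:R <= 1.
  elim: k => [|k ih]; first by rewrite /W muln0 fact0 expn0 muln1 expr1n divr1 expr1n mul1r.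
  have k0 : 0 <= k%:R :> R by rewrite ler0n.
  have E : W k.+1 = W k * ((2 * k%:R + 1) / (2 * k%:R + 2)).
    have e1 : (2 * k).+1%:R = 2 * k%:R + 1 :> R by rewrite -addn1 natrD natrM.
    have e2 : (2 * k).+2%:R = 2 * k%:R + 2 :> R by rewrite -addn2 natrD natrM.
    have e3 : k.+1%:R = k%:R + 1 :> R by rewrite -addn1 natrD.
    rewrite /W mulnS !add2n !factS expnS !natrM natrX e1 e2 e3.
    have f0 : k`!%:R != 0 :> R by rewrite pnatr_eq0 -lt0n fact_gt0.
    have f1 : (2 : R) ^+ k != 0 by rewrite expf_neq0.
    field; rewrite f0 f1 /=.
    by apply/andP; split; apply: lt0r_neq0; lra.
  have e5 : (2 * k.+1 + 1)%:R = 2 * (k%:R + 1) + 1 :> R by rewrite natrD natrM -(natr1 k).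
  have e6 : (2 * k + 1)%:R = 2 * k%:R + 1 :> R by rewrite natrD natrM.
  rewrite e6 in ih; rewrite E exprMn e5.
  set t := (_ / _); set w := W k ^+ 2 in ih *.
  have t0 : t ^+ 2 * (2 * (k%:R + 1) + 1) <= 2 * k%:R + 1.
    have k2 : 0 < 2 * k%:R + 2 :> R by lra.
    rewrite /t expr_div_n mulrAC ler_pdivrMr ?exprn_gt0// -subr_ge0.
    (* The difference is 2k + 1 because (2k + 2)^2 - (2k + 1)(2k + 3) = 1. *)
    rewrite (_ : _ - _ = 2 * k%:R + 1); first by rewrite addr_ge0// mulr_ge0.
    ring.
  rewrite -mulrA (le_trans _ ih)//; apply: ler_wpM2l => //; exact: sqr_ge0.
have -> : top_coef l ^+ 2 = (2 * l + 1)%:R / (4 * pi) * W l.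
  rewrite /top_coef exprMn harmonic_coef_sqr subnn fact0 /W /legendre_coef.
  have -> : (l + l = 2 * l)%N by lia.
  have f0 : (2 * l)`!%:R != 0 :> R by rewrite pnatr_eq0 -lt0n fact_gt0.
  have f1 : (2 ^ l * l`!)%:R != 0 :> R by rewrite pnatr_eq0 muln_eq0 expn_eq0 -lt0n fact_gt0.
  have := pi_gt0 R; set p := pi => /lt0r_neq0 p0.
  move: f0 f1; set F := (2 * l)`!%:R; set G := (2 ^ l * l`!)%:R; move=> f0 f1.
  by clearbody F G p; field; rewrite f0 f1 p0.
have := W1 l; have := pi_gt0 R; set p := pi; set w := W l; set n := _%:R => p0 wn.
have n0 : 0 <= n by rewrite /n ler0n.
have -> : (n / (4 * p) * w) ^+ 2 = n * (w ^+ 2 * n) / (4 * p) ^+ 2.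
  by have := lt0r_neq0 p0; move=> p1; clearbody n w p; field.
by rewrite ler_pM2r ?invr_gt0 ?exprn_gt0 ?mulr_gt0// ler_piMr.
Qed.

(** On the sphere |x + i y| <= 1, so the coefficient bounds the harmonic. The fourth power states
    growth of order l^(1/4) without roots. *)
Lemma harmonic_top_bound l x : sphere x ->
  `|complex.Re (Y l l x)| ^+ 4 <= (2 * l + 1)%:R / (4 * pi) ^+ 2.
Proof.
move=> sx; apply: (le_trans _ (top_coef_sqr l)).
have N : normc (Y l l x) ^+ 2 <= top_coef l ^+ 2.
  have xy1 : normc (xyC x) <= 1.
    rewrite -(ler_pXn2r (_ : 0 < 2)%N) ?nnegrE ?normc_ge0// normc_sqr expr1n.
    by move/sphereE: sx => <-; rewrite lerDl sqr_ge0.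
  rewrite harmonic_top Normc.normcM exprMn.
  have -> : normc (top_coef l)%:C ^+ 2 = top_coef l ^+ 2 by rewrite normc_sqr /= expr0n/= addr0.
  have nX : normc (xyC x ^+ l) = normc (xyC x) ^+ l.
    elim: (l) => [|k ih]; first by rewrite !expr0 Normc.normc1.
    by rewrite !exprS Normc.normcM ih.
  by rewrite nX ler_piMr ?sqr_ge0// exprn_ile1 ?exprn_ge0 ?normc_ge0// exprn_ile1 ?normc_ge0.
rewrite (exprM _ 2 2) ; apply: lerXn2r; rewrite ?nnegrE ?sqr_ge0//.
apply: le_trans N; apply: lerXn2r; rewrite ?nnegrE ?normc_ge0//; exact: Re_le_normc.
Qed.

Definition perturbation l a (x : 'cV[R]_3) : R :=
  (4 * pi)^-1 + a * Num.sqrt 2 * complex.Re (Y l l x).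

Lemma harmonicJ l x : (Y l l x)^* = (-1) ^+ l * Y l (- l%:Z) x.
Proof.
case: l => [|l].
  rewrite expr0 mul1r oppr0 harmonic_top expr0 mulr1; exact: (@conjC_real R).
have -> : - l.+1%:Z = Negz l by rewrite NegzE.
by rewrite /spherical_harmonic mulrA -exprMn mulrNN mulr1 expr1n mul1r.
Qed.

Lemma harmonic00 x : Y 0 0 x = h0%:C.
Proof.
rewrite (harmonic_top 0 x) expr0 mulr1 /top_coef /legendre_coef muln0 fact0 expn0 muln1 invr1.
by rewrite !mulr1.
Qed.

Lemma h0_sqr : h0 ^+ 2 = (4 * pi)^-1.
Proof. by rewrite harmonic_coef_sqr muln0 subnn addn0 fact0 divr1 mulr1 div1r. Qed.

(** The real part is half the sum of Y^l_l and its conjugate, which up to sign is the harmonic of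
    order -l. For l > 0 both coefficients have squared modulus a^2 / 2, whence the factor sqrt 2 in
    [perturbation]. *)
Lemma perturbationE l a x : (perturbation l a x)%:C =
  h0%:C * Y 0 0 x + (a * Num.sqrt 2 / 2)%:C * Y l l x +
  (a * Num.sqrt 2 / 2)%:C * (-1) ^+ l * Y l (- l%:Z) x.
Proof.
rewrite -[_ * _ * Y l _ x]mulrA -harmonicJ harmonic00 -rmorphM -expr2 h0_sqr /perturbation.
set q := (_ * _)^-1; clearbody q; apply: complex_eq; rewrite !(ReD, ImD, ReM, ImM, ReJ, ImJ) /=; by field.
Qed.

Lemma Cintegral_perturbation_harmonic l a l' (m : int) : (`|m| <= l')%N ->
  CS (fun x => (perturbation l a x)%:C * (Y l' m x)^*) =
  h0%:C * ((0%N == l') && (0 == m))%:R +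
  (a * Num.sqrt 2 / 2)%:C * ((l == l') && (l%:Z == m))%:R +
  (a * Num.sqrt 2 / 2)%:C * (-1) ^+ l * ((l == l') && (- l%:Z == m))%:R.
Proof.
move=> ml'.
have le k : (`|k%:Z| <= k)%N by [].
have le' k : (`|- k%:Z| <= k)%N by rewrite abszN.
rewrite -(harmonic_orthonormal R (le 0%N) ml') -(harmonic_orthonormal R (le l) ml').
rewrite -(harmonic_orthonormal R (le' l) ml').
have CI k n : Cintegrable sigma (@sphere R) (fun x => Y k n x * (Y l' m x)^*).
  apply: sphere_Cintegrable; apply: Cbounded_measurableM.
    exact: Cbounded_measurable_harmonic.
  by apply: Cbounded_measurableJ; exact: Cbounded_measurable_harmonic.
have mS := @measurable_sphere R.
rewrite -!CintegralZl// -!CintegralD//; try by [exact: CintegrableZl|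
  apply: CintegrableD => //; exact: CintegrableZl].
by apply: eq_Cintegral => x _; rewrite perturbationE !mulrDl !mulrA.
Qed.

End Perturbation.

(** * The perturbation as an alternative *)

Section Alternative.
Local Open Scope complex_scope.
Local Open Scope ring_scope.
Context (R : realType).
Local Notation C := R[i].
Notation sigma := (@sphere_measure R).
Notation Y := (@spherical_harmonic R).
Notation CS := (Cintegral sigma (@sphere R)).
Notation normc := Normc.normc.
Notation h0 := (harmonic_coef R 0 0).
Notation q := ((4 * pi)^-1 : R).

Lemma integral_Cintegral (h : 'cV[R]_3 -> R) : bounded_measurable (@sphere R) h ->
  (\int[sigma]_(x in sphere) (h x)%:E = (complex.Re (CS (fun x => (h x)%:C)))%:E)%E.
Proof.
move=> bh; rewrite /= /Rintegral fineK//.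
apply: (integrable_fin_num (@measurable_sphere R)).
exact: (bounded_measurable_integrable (@measurable_sphere R) (sphere_measure_lty R) bh).
Qed.

Lemma Cintegral_cst (c : C) : CS (fun=> c) = c * (4 * pi)%:C.
Proof.
have -> : CS (fun=> c) = c * CS (fun=> 1).
  rewrite -CintegralZl//; first by under [in RHS]eq_fun do rewrite mulr1.
  - exact: measurable_sphere.
  - by apply: sphere_Cintegrable; exact: Cbounded_measurable_cst.
congr (_ * _); have := integral_Cintegral (bounded_measurable_cst (@sphere R) 1).
rewrite integral_cst//=; last exact: measurable_sphere.
rewrite mul1e [X in X = _]sphere_measure_sphere => -[E]; apply: complex_eq => /=; first exact: esym E.
by rewrite /Rintegral integral0.
Qed.

Lemma sphere_density_uniform : sphere_density (@uniform_density R).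
Proof.
have p0 := @pi_gt0 R; have mS := @measurable_sphere R.
split.
- apply: measurable_funM => //; exact: measurable_indic.
- by move=> x _; rewrite mulr_ge0 ?invr_ge0 ?mulr_ge0// ltW.
- rewrite (eq_integral (fun=> q%:E)) => [|x xS]; last by rewrite /uniform_density indicE xS mulr1.
  rewrite integral_cst// [X in (_ * X)%E]sphere_measure_sphere -EFinM mulVf//.
  by rewrite lt0r_neq0// mulr_gt0.
Qed.

Variables (l : nat) (a : R).
Hypothesis l0 : (0 < l)%N.
Notation f := (perturbation l a).
Notation b := (a * Num.sqrt 2 / 2 : R).

Lemma b_sqr : 2 * b ^+ 2 = a ^+ 2.
Proof. by rewrite !exprMn sqr_sqrtr//; field. Qed.

Lemma bounded_measurable_perturbation : bounded_measurable (@sphere R) f.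
Proof.
apply: bounded_measurableD; first exact: bounded_measurable_cst.
apply: bounded_measurableM; first exact: bounded_measurable_cst.
by have [] := Cbounded_measurable_harmonic R l l.
Qed.

Lemma sum_order l' (m : int) : \sum_(i < (2 * l').+1) (m == order_of i)%:R <= 1 :> R.
Proof.
have [[i0 ->]|nm] := pselect (exists i0 : 'I_(2 * l').+1, m = order_of i0).
  rewrite (bigD1 i0)//= eqxx big1 ?addr0// => j ji.
  by rewrite order_of_inj eq_sym (negbTE ji).
rewrite big1 ?ler01// => i _; case: eqP => // mi; case: nm; exists i; exact: mi.
Qed.

(** Since l > 0, the degrees 0 and l differ and so do the orders l and -l: at most one of the three
    terms is present, and the square has no cross term. *)
Lemma perturbation_fourier_sqr l' (i : 'I_(2 * l').+1) :
  normc (fourier (fun x => (f x)%:C) i) ^+ 2 <=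
  (0 == l')%N%:R * (q * (0 == order_of i)%:R) +
  (l == l')%N%:R * (b ^+ 2 * ((l%:Z == order_of i)%:R + (- l%:Z == order_of i)%:R)).
Proof.
rewrite /fourier Cintegral_perturbation_harmonic ?order_of_le// -h0_sqr.
have -> : ((-1) ^+ l : C) = ((-1) ^+ l)%:C by rewrite rmorphXn rmorphN1.
set e := (-1) ^+ l; have e2 : e ^+ 2 = 1 :> R by rewrite -exprM mulnC exprM sqrrN !expr1n.
have rr (z : bool) : z%:R = (z%:R : R)%:C by case: z.
pose z : R := h0 * ((0%N == l') && (0 == order_of i))%:R +
  b * ((l == l') && (l%:Z == order_of i))%:R +
  b * e * ((l == l') && (- l%:Z == order_of i))%:R.
rewrite (_ : _ + _ = z%:C); last by rewrite !rr /z 2!rmorphD !rmorphM.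
rewrite normc_sqr /= expr0n addr0 {}/z.
have [l'0|l'0] := eqVneq 0%N l'.
  have -> : (l == l') = false by rewrite -l'0 gtn_eqF.
  rewrite /= !mulr0 !addr0 mul1r mul0r addr0.
  by case: (_ == _); rewrite ?mulr1 ?mulr0 ?expr0n.
have [ll|_] /= := eqVneq l l'; last by rewrite !mulr0 !addr0 !mul0r expr0n addr0.
rewrite !mulr0 !mul0r !mul1r !add0r.
have [<-|_] := eqVneq l%:Z (order_of i).
  rewrite (_ : (- l%:Z == l%:Z) = false); last by apply/negbTE; lia.
  by rewrite !mulr1 mulr0 !addr0 mulr1.
rewrite !mulr0 !add0r; case: eqP => _; last by rewrite !mulr0 expr0n.
by rewrite !mulr1 exprMn e2 mulr1.
Qed.

(** The uniform part, of weight one, contributes exactly the 1 / (4 pi) granted in [sobolev_ball],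
    which leaves r^2 for the perturbation. *)
Lemma perturbation_sobolev s :
  (sobolev_sqnorm s (fun x => (f x)%:C) <=
   (q + a ^+ 2 * (1 + l * (l + 1))%:R `^ s)%:E)%E.
Proof.
have p0 := @pi_gt0 R; have q0 : 0 <= q by rewrite invr_ge0 mulr_ge0// ltW.
pose w k : R := (1 + k * (k + 1))%:R `^ s.
have w0 k : 0 <= w k by exact: powR_ge0.
pose A := q; pose B := a ^+ 2 * w l.
pose t k := \sum_(i < (2 * k).+1) w k * normc (fourier (fun x => (f x)%:C) i) ^+ 2.
have tle k : t k <= (0 == k)%N%:R * A + (l == k)%N%:R * B.
  rewrite /t -mulr_sumr (@le_trans _ _ (w k * ((0 == k)%N%:R * q + (l == k)%N%:R * a ^+ 2)))//.
    rewrite ler_wpM2l//; apply: (@le_trans _ _ (\sum_(i < (2 * k).+1)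
        ((0 == k)%N%:R * (q * (0 == order_of i)%:R) +
  (l == k)%N%:R * (b ^+ 2 * ((l%:Z == order_of i)%:R + (- l%:Z == order_of i)%:R))))).
      by apply: ler_sum => i _; exact: perturbation_fourier_sqr.
    rewrite big_split/= -!mulr_sumr big_split/=; apply: lerD; rewrite ler_wpM2l//.
      by rewrite ler_piMr// sum_order.
    rewrite -b_sqr [2 * _]mulrC ler_wpM2l ?sqr_ge0// -[2]/(1 + 1).
    by apply: lerD; exact: sum_order.
  rewrite mulrDr; apply: lerD.
    have [<-|_] := eqVneq 0%N k; last by rewrite !mul0r mulr0.
    by rewrite /w mul0n addn0 powR1 !mul1r.
  by have [<-|_] := eqVneq l k; [rewrite !mul1r mulrC|rewrite !mul0r mulr0].
have -> : sobolev_sqnorm s (fun x => (f x)%:C) = (\sum_(0 <= k <oo) (t k)%:E)%E.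
  by apply: eq_eseriesr => k _; rewrite sumEFin.
apply: lime_le.
  apply: is_cvg_nneseries => k _ _; rewrite lee_fin; apply: sumr_ge0 => i _.
  by rewrite mulr_ge0// sqr_ge0.
apply: nearW => n; rewrite sumEFin lee_fin.
apply: (@le_trans _ _ (\sum_(0 <= k < n) ((0 == k)%N%:R * A + (l == k)%N%:R * B))).
  by apply: ler_sum => k _; exact: tle.
have S m (D : R) : 0 <= D -> \sum_(0 <= k < n) (m == k)%N%:R * D <= D.
  move=> D0; rewrite -mulr_suml ler_piMl//.
  have [mn|nm] := ltnP m n; last first.
    by rewrite big_nat big1 ?ler01// => k /andP[_ kn]; rewrite gtn_eqF// (leq_trans kn).
  rewrite (bigD1_seq m) ?mem_index_iota ?iota_uniq//= eqxx big1 ?addr0// => k km.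
  by rewrite eq_sym (negbTE km).
rewrite big_split/=; apply: lerD; apply: S => //.
by rewrite mulr_ge0 ?sqr_ge0.
Qed.

Let bmf : Cbounded_measurable (@sphere R) (fun x => (f x)%:C).
Proof. by apply: Cbounded_measurable_real; exact: bounded_measurable_perturbation. Qed.

Lemma Cintegral_perturbation : CS (fun x => (f x)%:C) = 1.
Proof.
have h00 : h0 != 0 by rewrite -sqrf_eq0 h0_sqr invr_eq0 lt0r_neq0// mulr_gt0// pi_gt0.
have := Cintegral_perturbation_harmonic l a (isT : (`|0%Z| <= 0)%N).
rewrite (gtn_eqF l0) /= !mulr0 !addr0 mulr1.
rewrite (@eq_Cintegral _ _ _ _ _ _ (fun x => h0%:C * (f x)%:C)) => [|x _]; last first.
  by rewrite -[spherical_harmonic_nat 0 0 x]/(Y 0 0 x) harmonic00 (@conjC_real R) mulrC.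
rewrite CintegralZl; [|exact: measurable_sphere|exact: sphere_Cintegrable].
move=> E; have hC : h0%:C != 0 :> C by rewrite (fmorph_eq0 (real_complex R)).
by apply: (mulfI hC); rewrite E mulr1.
Qed.

Lemma Cintegral_perturbation_sqr : CS (fun x => (f x ^+ 2)%:C) = (q + a ^+ 2)%:C.
Proof.
have mS := @measurable_sphere R.
have CI k m : Cintegrable sigma (@sphere R) (fun x => (f x)%:C * (Y k m x)^*).
  apply: sphere_Cintegrable; apply: Cbounded_measurableM => //.
  by apply: Cbounded_measurableJ; exact: Cbounded_measurable_harmonic.
rewrite (@eq_Cintegral _ _ _ _ _ _ (fun x => h0%:C * ((f x)%:C * (Y 0 0 x)^*) +
   b%:C * ((f x)%:C * (Y l l x)^*) + b%:C * (-1) ^+ l * ((f x)%:C * (Y l (- l%:Z) x)^*))); last first.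
  move=> x _.
  (* As f is real, it also expands in the conjugate harmonics. Expanding one factor of the square
     leaves the Fourier coefficients of f, already computed. *)
  have EJ : (f x)%:C = h0%:C * (Y 0 0 x)^* + b%:C * (Y l l x)^* +
      b%:C * (-1) ^+ l * (Y l (- l%:Z) x)^*.
    have J (u v : R) (y0 y1 y2 : C) : (u%:C * y0 + v%:C * y1 + v%:C * (-1) ^+ l * y2)^* =
        u%:C * y0^* + v%:C * y1^* + v%:C * (-1) ^+ l * y2^*.
      by rewrite !rmorphD !rmorphM rmorphXn rmorphN1 /= !(@conjC_real R).
    by rewrite -[LHS](@conjC_real R) perturbationE J.
  rewrite rmorphXn /= expr2 {2}EJ.
  move: ((f x)%:C) (Y 0 0 x)^* (Y l l x)^* (Y l (- l%:Z) x)^* ((-1) ^+ l) h0%:C b%:C.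
  by move=> *; ring.
rewrite !CintegralD ?CintegralZl//; try by [exact: CintegrableZl|
  apply: CintegrableD => //; exact: CintegrableZl].
rewrite !Cintegral_perturbation_harmonic//; last by rewrite abszN.
rewrite !eqxx (gtn_eqF l0) [0%N == l](ltn_eqF l0) /= !mulr0 !addr0 !add0r.
rewrite (_ : (- l%:Z == l%:Z) = false); last by apply/negbTE; lia.
rewrite (_ : (l%:Z == - l%:Z) = false); last by apply/negbTE; lia.
rewrite !mulr0 !addr0 !add0r !mulr1 mulrACA -expr2 -exprMn mulrNN mulr1 expr1n mulr1.
rewrite -h0_sqr -b_sqr; move: h0 b => u v.
by rewrite rmorphD rmorphXn rmorphM rmorphXn rmorph_nat /=; ring.
Qed.

Lemma integral_perturbation_dist :
  (\int[sigma]_(x in sphere) ((f x - uniform_density x) ^+ 2)%:E = (a ^+ 2)%:E)%E.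
Proof.
have mS := @measurable_sphere R.
have bf := bounded_measurable_perturbation.
rewrite (eq_integral (fun x => ((f x - q) ^+ 2)%:E)) => [|x xS]; last first.
  by rewrite /uniform_density indicE xS mulr1.
rewrite integral_Cintegral; last first.
  have bq : bounded_measurable (@sphere R) (fun x => f x - q).
    by apply: bounded_measurableD => //; exact: bounded_measurable_cst.
  exact: bounded_measurableM.
congr EFin; rewrite (@eq_Cintegral _ _ _ _ _ _
  (fun x => (f x ^+ 2)%:C + ((- 2 * q)%:C * (f x)%:C + (q ^+ 2)%:C))); last first.
  by move=> x _; rewrite -!rmorphM -!rmorphD; congr (_%:C); ring.
have C1 : Cintegrable sigma (@sphere R) (fun x => (f x ^+ 2)%:C).
  by apply: sphere_Cintegrable; apply: Cbounded_measurable_real; exact: bounded_measurableM.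
have C2 : Cintegrable sigma (@sphere R) (fun x => (- 2 * q)%:C * (f x)%:C).
  by apply: CintegrableZl => //; exact: sphere_Cintegrable.
have C3 : Cintegrable sigma (@sphere R) (fun=> (q ^+ 2)%:C).
  by apply: sphere_Cintegrable; exact: Cbounded_measurable_cst.
rewrite CintegralD//; last exact: CintegrableD.
rewrite CintegralD// CintegralZl//; last exact: sphere_Cintegrable.
rewrite Cintegral_perturbation_sqr Cintegral_perturbation Cintegral_cst -!rmorphM mulr1 -!rmorphD /=.
have := @pi_gt0 R; set p := pi => p0; have := lt0r_neq0 p0; clearbody p => p1.
by field.
Qed.

(** The condition implies |a sqrt 2 Re Y^l_l| <= 1 / (4 pi): it is this inequality raised to the
    fourth power, with |Re Y^l_l|^4 replaced by its bound. *)
Lemma perturbation_ge0 x : 4 * a ^+ 4 * (2 * l + 1)%:R * (4 * pi) ^+ 2 <= 1 -> sphere x ->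
  0 <= f x.
Proof.
move=> ha sx; have := harmonic_top_bound l sx; have := @pi_gt0 R.
move: ha; rewrite /perturbation; set p := pi; set y := complex.Re _; set n := (2 * l + 1)%:R.
move=> ha p0; have P0 : 0 < 4 * p by rewrite mulr_gt0.
set P := 4 * p in ha P0 *; rewrite ler_pdivlMr ?exprn_gt0// => hy.
suff : `|a * Num.sqrt 2 * y| <= P^-1 by rewrite ler_norml => /andP[h _]; lra.
rewrite -(ler_pXn2r (_ : 0 < 4)%N) ?nnegrE ?invr_ge0 ?(ltW P0)//.
rewrite !normrM !exprMn [`|Num.sqrt 2|]ger0_norm ?sqrtr_ge0//.
rewrite (exprM (Num.sqrt 2) 2 2) sqr_sqrtr// (exprM `|a| 2 2) real_normK ?num_real// -exprM.
rewrite exprVn -[leRHS]mul1r ler_pdivlMr ?exprn_gt0//.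
apply: le_trans ha.
rewrite (_ : _ * P ^+ 4 = 4 * a ^+ 4 * P ^+ 2 * (`|y| ^+ 4 * P ^+ 2)); last by ring.
rewrite (_ : 4 * a ^+ 4 * n * P ^+ 2 = 4 * a ^+ 4 * P ^+ 2 * n); last by ring.
have a4 : 0 <= a ^+ 4 by rewrite -[4%N]/(2 * 2)%N exprM sqr_ge0.
by rewrite ler_wpM2l// mulr_ge0 ?sqr_ge0// mulr_ge0.
Qed.

Lemma perturbation_smooth : smooth_on_sphere (fun x => (f x)%:C).
Proof.
exists f, (cst 0); split => //; last exact/polyfun_smooth/PolyCst.
apply: polyfun_smooth.
have -> : f = cst q + cst (a * Num.sqrt 2 * top_coef R l) *
    (fun x : 'cV[R]_3 => complex.Re (xyC x ^+ l)).
  apply/funext => x; rewrite /perturbation !fctE; congr (_ + _).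
  by rewrite harmonic_top ReM /= mul0r subr0 mulrA.
apply: PolyAdd; first exact: PolyCst.
by apply: PolyMul; [exact: PolyCst|case: (polyfun_xyC R l)].
Qed.

Lemma perturbation_density : 4 * a ^+ 4 * (2 * l + 1)%:R * (4 * pi) ^+ 2 <= 1 ->
  sphere_density f.
Proof.
move=> ha; split; first by case: bounded_measurable_perturbation.
- by move=> x; exact: perturbation_ge0.
- rewrite integral_Cintegral; last exact: bounded_measurable_perturbation.
  by rewrite Cintegral_perturbation.
Qed.

Lemma perturbation_alternative s r rho :
  4 * a ^+ 4 * (2 * l + 1)%:R * (4 * pi) ^+ 2 <= 1 ->
  a ^+ 2 * (1 + l * (l + 1))%:R `^ s <= r ^+ 2 -> rho <= a ^+ 2 ->
  alternatives s r rho f.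
Proof.
move=> ha hs hrho; split; last by rewrite integral_perturbation_dist lee_fin.
split; first exact: perturbation_density.
- split; first by case: bounded_measurable_perturbation.
    rewrite integral_Cintegral ?ltry//.
    by apply: bounded_measurableM; exact: bounded_measurable_perturbation.
  (* The function is itself smooth on the sphere, so a constant sequence witnesses the closure. *)
  exists (fun _ x => (f x)%:C); split; first by move=> _; exact: perturbation_smooth.
  rewrite (_ : sobolev_sqnorm _ _ = 0%E); first exact: cvg_cst.
  apply: eseries0 => k _ _; apply: big1 => i _.
  rewrite (_ : fourier _ _ = 0) ?Normc.normc0 ?expr0n ?mulr0//.
  rewrite /fourier -[RHS](Cintegral0 sigma (@sphere R)); apply: eq_Cintegral => x _.
  by rewrite subrr mul0r.
- by apply: (le_trans (perturbation_sobolev s)); rewrite lee_fin lerD2l.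
Qed.

End Alternative.

(** * The risk against the perturbation *)

Section PerturbationRisk.
Local Open Scope complex_scope.
Local Open Scope ring_scope.
Context (R : realType).
Notation Y := (@spherical_harmonic R).
Notation q := ((4 * pi)^-1 : R).
Variables (haar : probability 'M[R]_3 R)
  (D : forall l : nat, 'M[R]_3 -> 'M[R[i]]_((2 * l).+1)) (feps : 'M[R]_3 -> R).
Hypothesis hD : is_rotational_harmonics D.
Hypothesis hfeps : is_density haar (@SO3 R) feps.

Lemma noise_integral_cst (c : R) : (\int[haar]_(u in @SO3 R) (feps u * c)%:E = c%:E)%E.
Proof.
under eq_integral do rewrite mulrC EFinM.
rewrite integralZl//; [|exact: measurable_SO3|exact: (noise_integrable hfeps)].
by case: hfeps => _ _ ->; rewrite mule1.
Qed.

Lemma observation_density_uniform y : sphere y ->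
  observation_density haar feps (@uniform_density R) y = q%:E.
Proof.
move=> sy; rewrite -[RHS]noise_integral_cst; apply: eq_integral => u /set_mem su.
by rewrite /uniform_density indicE mem_set ?mulr1// sphere_SO3//; exact: SO3_tr.
Qed.

Lemma order_of_top l : order_of (ord_max : 'I_(2 * l).+1) = l%:Z.
Proof. by rewrite /order_of /=; lia. Qed.

Lemma observation_density_perturbation l a y : sphere y ->
  observation_density haar feps (perturbation l a) y =
  (q + a * Num.sqrt 2 *
   Rintegral haar (@SO3 R) (fun u => feps u * complex.Re (Y l l (u^T *m y))))%:E.
Proof.
move=> sy; have mS := @measurable_SO3 R.
have iY : haar.-integrable (@SO3 R) (fun u => (feps u * complex.Re (Y l l (u^T *m y)))%:E).
  by rewrite -order_of_top; exact: (noise_harmonic_integrable hD hfeps _ sy).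
have iq : haar.-integrable (@SO3 R) (fun u => (feps u * q)%:E).
  under eq_fun do rewrite mulrC EFinM.
  by apply: integrableZl => //; exact: (noise_integrable hfeps).
rewrite /observation_density (eq_integral (fun u => (feps u * q)%:E + (a * Num.sqrt 2)%:E *
   (feps u * complex.Re (Y l l (u^T *m y)))%:E)%E); last first.
  by move=> u _; rewrite -EFinM -EFinD /perturbation; congr EFin; ring.
rewrite integralD//; last exact: integrableZl.
rewrite noise_integral_cst integralZl// [RHS]EFinD [X in _ = (_ + X)%E]EFinM; congr (_ + _ * _)%E.
by rewrite fineK//; exact: integrable_fin_num.
Qed.

(** Under the uniform density an observation is again uniform, so an absolute bound on the
    perturbation becomes a relative one, at the cost of the factor 4 pi. *)
Lemma observation_density_ge l a y : sphere y ->
  ((1 - 4 * pi * (`|a| * Num.sqrt 2 * ((2 * l + 1)%:R ^+ 3 *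
      op_norm (rot_fourier haar D feps l))))%:E *
    observation_density haar feps (@uniform_density R) y <=
   observation_density haar feps (perturbation l a) y)%E.
Proof.
move=> sy; rewrite observation_density_uniform// observation_density_perturbation//.
have := noise_harmonic_bound hD hfeps (ord_max : 'I_(2 * l).+1) sy; rewrite order_of_top.
set I := Rintegral _ _ _; set B := (_ * op_norm _) => IB; rewrite -EFinM lee_fin.
have := @pi_gt0 R; set p := pi => p0.
have -> : (1 - 4 * p * (`|a| * Num.sqrt 2 * B)) * (4 * p)^-1 =
    (4 * p)^-1 - `|a| * Num.sqrt 2 * B.
  by have := lt0r_neq0 p0 => p1; clearbody p; field.
rewrite lerD2l lerNl (le_trans (ler_norm _))// normrN !normrM.
by rewrite [`|Num.sqrt 2|]ger0_norm ?sqrtr_ge0// ler_wpM2l// mulr_ge0 ?sqrtr_ge0.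
Qed.

Lemma one_sub_exp_ge (x : R) n : 0 <= x <= 1 -> 1 - n%:R * x <= (1 - x) ^+ n.
Proof.
move=> /andP[x0 x1]; elim: n => [|n ih]; first by rewrite mul0r subr0 expr0.
rewrite exprS; apply: (@le_trans _ _ ((1 - x) * (1 - n%:R * x))); last first.
  by rewrite ler_wpM2l// subr_ge0.
rewrite -natr1; have n0 : 0 <= n%:R :> R by rewrite ler0n.
nra.
Qed.

(** [eta] is any upper bound on the relative perturbation, so that the decay assumed of the operator
    norm can be inserted afterwards. *)
Lemma perturbation_risk d (Om : measurableType d)
    (P : ('cV[R]_3 -> R) -> probability Om R)
    (eps : nat -> Om -> 'M[R]_3) (X : nat -> Om -> 'cV[R]_3) (s r rho a eta : R) (l N : nat) :
  deconvolution_model P eps X haar feps -> (0 < l)%N ->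
  4 * a ^+ 4 * (2 * l + 1)%:R * (4 * pi) ^+ 2 <= 1 ->
  a ^+ 2 * (1 + l * (l + 1))%:R `^ s <= r ^+ 2 -> rho <= a ^+ 2 ->
  4 * pi * (`|a| * Num.sqrt 2 * ((2 * l + 1)%:R ^+ 3 *
    op_norm (rot_fourier haar D feps l))) <= eta -> eta <= 1 ->
  ((1 - N%:R * eta)%:E <= minimax_risk P eps X s r rho N)%E.
Proof.
move=> model l0 ha hs hrho heta eta1.
have Fi0 : 0 <= op_norm (rot_fourier haar D feps l).
  exact: (le_trans (normc_ge0 _) (op_norm_entry _ ord0 ord0)).
have eta0 : 0 <= eta.
  by apply: le_trans heta; rewrite !mulr_ge0 ?pi_ge0 ?exprn_ge0 ?sqrtr_ge0.
apply: (@le_trans _ _ ((1 - eta) ^+ N)%:E); first by rewrite lee_fin one_sub_exp_ge ?eta0.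
apply: (@minimax_risk_ge _ _ _ _ _ _ _ _ _ _ _ (perturbation l a)).
- by rewrite subr_ge0 eta1 gerBl.
- exact: perturbation_alternative.
- exact: measurable_observations model _.
- move=> B mB; apply: (observations_domination hfeps model) => //.
  + exact: sphere_density_uniform.
  + exact: perturbation_density.
  + by rewrite subr_ge0.
  + move=> y sy; apply: le_trans (observation_density_ge l a sy).
    rewrite observation_density_uniform// lee_wpmul2r ?lee_fin ?lerD2l ?lerN2//.
    by rewrite invr_ge0 mulr_ge0// pi_ge0.
Qed.

End PerturbationRisk.

(** * Asymptotics *)

Section Asymptotics.
Context (R : realType).
Implicit Types (p c beta e x : R).

(** With u = x^beta and k >= |p| / beta, x^p is at most u^k, while the exponential exceeds its
    Taylor term of degree k + 1; a factor 1 / u remains. *)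
Lemma powR_expR_bound p c beta : 0 < c -> 0 < beta ->
  exists2 A, 0 < A & forall x, 1 <= x -> x `^ p * expR (- (c * x `^ beta)) <= A / x `^ beta.
Proof.
move=> c0 b0; pose k := (Num.truncn (`|p| / beta)).+1.
have pk : `|p| / beta <= k%:R by rewrite ltW// truncnS_gt.
have f0 : 0 < (k.+1)`!%:R :> R by rewrite ltr0n fact_gt0.
exists ((k.+1)`!%:R / c ^+ k.+1); first by rewrite divr_gt0// exprn_gt0.
move=> x x1; have x0 : 0 < x by exact: lt_le_trans x1.
set u := x `^ beta; have u0 : 0 < u by rewrite powR_gt0.
have xu : x `^ p <= u ^+ k.
  rewrite -powR_mulrn ?(ltW u0)// /u -powRrM ler_powR// (le_trans (ler_norm p))//.
  by rewrite mulrC -ler_pdivrMr.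
rewrite expRN; apply: (@le_trans _ _ (u ^+ k * (expR (c * u))^-1)).
  by rewrite ler_wpM2r// invr_ge0 expR_ge0.
have cu0 : 0 < (c * u) ^+ k.+1 / (k.+1)`!%:R by rewrite divr_gt0// exprn_gt0// mulr_gt0.
have cu : (c * u) ^+ k.+1 / (k.+1)`!%:R <= expR (c * u).
  apply: le_trans (expR_ge1Dxn k (ltW (mulr_gt0 c0 u0))); by rewrite lerDr.
apply: (@le_trans _ _ (u ^+ k * ((c * u) ^+ k.+1 / (k.+1)`!%:R)^-1)).
  by rewrite ler_wpM2l ?exprn_ge0 ?(ltW u0)// lef_pV2// posrE ?expR_gt0.
rewrite invf_div exprMn [u ^+ k.+1]exprSr.
move: f0; set F := (k.+1)`!%:R; have := lt0r_neq0 (exprn_gt0 k.+1 c0); set G := c ^+ _.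
have := lt0r_neq0 (exprn_gt0 k u0); set H := u ^+ k; have := lt0r_neq0 u0.
move=> a1 a2 a3 a4; clearbody u F G H; rewrite le_eqVlt; apply/orP; left; apply/eqP.
by field; rewrite a1 a2 a3.
Qed.

Lemma limn_einf_ge (u : (\bar R)^nat) (a : \bar R) :
  (\forall n \near \oo, (a <= u n)%E) -> (a <= limn_einf u)%E.
Proof.
move=> [n0 _ h]; rewrite limn_einf_lim; apply: lime_ge; first exact: is_cvg_einfs.
exists n0 => // n /= nn0; apply: le_ereal_inf_tmp => _ [m /= nm <-].
by apply: h; rewrite /= (leq_trans nn0).
Qed.

(** With T = (2 delta ln N)^(1/beta), the degree is at most 2 T and 1 + l(l+1) <= 12 T^2. The
    Sobolev cost of a^2 = C psi_N is then at most C 12^s (2 delta)^(2s/beta), and this constant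
    makes it at most r^2. *)
Definition critical_constant (delta beta s : R) : R :=
  (12 `^ s * (2 * delta) `^ (2 * s / beta))^-1.

(* The degree l is of order (2 delta ln N)^(1/beta), so that N is at most
   exp(l^beta / (2 delta)), which the decay exp(- l^beta / delta) of the noise beats. *)
Lemma critical_degree (d1 nu1 delta beta s r C e : R) :
  0 < d1 -> 0 < delta -> 0 < beta -> 1 / 2 <= s -> 0 < r -> 0 < C ->
  C <= critical_constant delta beta s * r ^+ 2 -> 0 < e ->
  \forall N \near \oo, exists l (a eta : R), [/\ (0 < l)%N,
    4 * a ^+ 4 * (2 * l + 1)%:R * (4 * pi) ^+ 2 <= 1,
    a ^+ 2 * (1 + l * (l + 1))%:R `^ s <= r ^+ 2,
    C * separation_rate s beta N <= a ^+ 2 &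
    [/\ 4 * pi * (`|a| * Num.sqrt 2 * ((2 * l + 1)%:R ^+ 3 *
      (d1 * (l%:R `^ nu1) * expR (- (l%:R `^ beta / delta))))) <= eta,
      eta <= 1 & N%:R * eta <= e]].
Proof.
move=> d10 de0 b0 s12 r0 C0 CK e0.
(* Bounding N eta by e' gives both N eta <= e and, since N >= 1, eta <= 1. *)
pose e' := Num.min e 1; have e'0 : 0 < e' by rewrite lt_min e0 ltr01.
pose c := (2 * delta)^-1; have c0 : 0 < c by rewrite invr_gt0 mulr_gt0.
have pi0 := @pi_gt0 R.
(* The constants of eta: 27 is the cube of the 3 in 2l + 1 <= 3l, and r bounds |a|. *)
pose B : R := 4 * pi * r * Num.sqrt 2 * 27 * d1.
have B0 : 0 < B by rewrite !mulr_gt0// sqrtr_gt0.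
have [A A0 hA] := @powR_expR_bound (3 + nu1) c beta c0 b0.
(* Thresholds for the degree: above M2 the alternative is nonnegative, and above M3 the product N
   eta is at most e'. *)
pose M2 : R := 12 * r ^+ 4 * (4 * pi) ^+ 2.
have M20 : 0 < M2 by rewrite !mulr_gt0// exprn_gt0// mulr_gt0.
pose M3 : R := (B * A / e') `^ beta^-1.
pose M := Num.max 1 (Num.max M2 M3).
have M1 : 1 <= M by rewrite le_max lexx.
have M0 : 0 < M by exact: lt_le_trans M1.
have MM2 : M2 <= M by rewrite !le_max lexx orbT.
have MM3 : M3 <= M by rewrite !le_max lexx !orbT.
(* Beyond this N one has ln N >= c M^beta, that is, T >= M. *)
exists (Num.truncn (expR (c * M `^ beta))).+1 => // N /= hN.
have NM : expR (c * M `^ beta) <= N%:R.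
  by rewrite ltW// (lt_le_trans (truncnS_gt _))// ler_nat.
have N0 : 0 < N%:R :> R by apply: lt_le_trans NM; rewrite expR_gt0.
set L := ln (N%:R : R).
have LM : c * M `^ beta <= L by rewrite /L -[leLHS]expRK ler_ln// posrE expR_gt0.
have L0 : 0 < L by apply: lt_le_trans LM; rewrite mulr_gt0// powR_gt0.
have dL0 : 0 < 2 * delta * L by rewrite !mulr_gt0.
pose T := (2 * delta * L) `^ beta^-1.
have powK x : 0 <= x -> (x `^ beta) `^ beta^-1 = x.
  by move=> x0; rewrite -powRrM divff ?lt0r_neq0// powRr1.
have powKV x : 0 <= x -> (x `^ beta^-1) `^ beta = x.
  by move=> x0; rewrite -powRrM mulVf ?lt0r_neq0// powRr1.
have pmono y z : 0 <= y -> y <= z -> y `^ beta <= z `^ beta.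
  by move=> y0 yz; rewrite ge0_ler_powR ?(ltW b0)// nnegrE// (le_trans y0).
have MT : M <= T.
  rewrite -[leLHS]powK ?(ltW M0)// /T ge0_ler_powR ?invr_ge0 ?(ltW b0)// ?nnegrE ?powR_ge0 ?(ltW dL0)//.
  by rewrite -ler_pdivrMl ?mulr_gt0// mulrC -/c mulrC.
have T1 : 1 <= T := le_trans M1 MT.
have T0 : 0 < T := lt_le_trans ltr01 T1.
pose l := (Num.truncn T).+1; pose x : R := l%:R.
have Tx : T <= x by rewrite ltW// truncnS_gt.
have xT : x <= 2 * T.
  have : (Num.truncn T)%:R <= T by rewrite truncn_le ltW.
  by rewrite /x /l -natr1; lra.
have x1 : 1 <= x by exact: le_trans Tx.
have x0 : 0 < x by exact: lt_le_trans x1.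
have w3 : (2 * l + 1)%:R <= 3 * x by rewrite natrD natrM -/x; lra.
have w12 : (1 + l * (l + 1))%:R <= 12 * T ^+ 2.
  by rewrite !(natrD, natrM) -/x; nra.
have w2 : x ^+ 2 <= (1 + l * (l + 1))%:R by rewrite !(natrD, natrM) -/x; nra.
have s0 : 0 <= s by lra.
pose psi := separation_rate s beta N; have psi0 : 0 < psi by rewrite powR_gt0.
(* Up to a constant [psi] is T^(-2s), so the rate cancels the Sobolev weight. *)
have TL : T `^ (2 * s) * psi = (2 * delta) `^ (2 * s / beta).
  rewrite /T -powRrM mulrC [_ * (2 * s)]mulrC powRM ?ltW ?mulr_gt0//.
  by rewrite /psi /separation_rate -/L powRN mulrCA mulVf ?mulr1// lt0r_neq0// powR_gt0.
have a2 : Num.sqrt (C * psi) ^+ 2 = C * psi by rewrite sqr_sqrtr// ltW// mulr_gt0.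
have sob : C * psi * (1 + l * (l + 1))%:R `^ s <= r ^+ 2.
  apply: (@le_trans _ _ (C * psi * (12 * T ^+ 2) `^ s)).
    by rewrite ler_wpM2l ?ge0_ler_powR// ?nnegrE ?mulr_ge0 ?ltW.
  rewrite powRM// ?sqr_ge0// -powR_mulrn ?(ltW T0)// -powRrM.
  rewrite (_ : _ * _ = C * (12 `^ s * (T `^ (2 * s) * psi))); last by ring.
  rewrite TL -ler_pdivlMr; last by rewrite mulr_gt0 ?powR_gt0// mulr_gt0.
  by rewrite mulrC.
(* Here s >= 1/2 enters: the weight is at least (x^2)^(1/2) = x. The bound serves twice, for |a| <=
   r and for the nonnegativity condition, as a^4 x <= r^4 / x. *)
have ax : C * psi * x <= r ^+ 2.
  apply: le_trans sob; apply: ler_wpM2l; first by rewrite ltW// mulr_gt0.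
  have x2 : 1 <= x ^+ 2 by rewrite expr_ge1 ?(ltW x0).
  rewrite -[leLHS](_ : (x ^+ 2) `^ (1 / 2) = x); last first.
    by rewrite -powR_mulrn ?(ltW x0)// -powRrM div1r mulfV ?powRr1 ?(ltW x0).
  rewrite (le_trans (ler_powR x2 s12))// ge0_ler_powR// ?nnegrE ?sqr_ge0//.
have ar : `|Num.sqrt (C * psi)| <= r.
  rewrite -(ler_pXn2r (_ : 0 < 2)%N) ?nnegrE ?(ltW r0)// real_normK ?num_real// a2.
  by apply: le_trans ax; rewrite ler_peMr// ltW// mulr_gt0.
pose eta := B * (x `^ (3 + nu1) * expR (- (x `^ beta / delta))).
have Neta : N%:R * eta <= e'.
  have NL : N%:R <= expR (c * x `^ beta).
    rewrite -[leLHS]lnK ?posrE// ler_expR -/L.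
    rewrite -[leLHS](_ : c * (2 * delta * L) = L); last by rewrite /c mulrA mulVf ?mul1r// lt0r_neq0// mulr_gt0.
    rewrite ler_wpM2l ?(ltW c0)// -[leLHS]powKV ?(ltW dL0)// -/T.
    by rewrite pmono ?(ltW T0).
  have xb0 : 0 < x `^ beta by rewrite powR_gt0.
  apply: (@le_trans _ _ (B * (x `^ (3 + nu1) * expR (- (c * x `^ beta))))).
    rewrite /eta mulrCA ler_wpM2l ?(ltW B0)// mulrCA ler_wpM2l ?powR_ge0//.
    (* Since c is half of 1 / delta, absorbing N costs half of the decay; the other half still beats
       the power of x, through [hA]. *)
    apply: (@le_trans _ _ (expR (c * x `^ beta) * expR (- (x `^ beta / delta)))).
      by rewrite ler_wpM2r ?expR_ge0.
    rewrite -expRD ler_expR /c le_eqVlt; apply/orP; left; apply/eqP.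
    by field; rewrite lt0r_neq0.
  apply: (@le_trans _ _ (B * (A / x `^ beta))); first by rewrite ler_wpM2l ?(ltW B0)// hA.
  rewrite mulrA ler_pdivrMr// -ler_pdivrMl// [_^-1 * _]mulrC.
  have BA0 : 0 <= B * A / e' by rewrite divr_ge0 ?mulr_ge0 ?ltW.
  rewrite -[leLHS]powKV// pmono ?powR_ge0// -/M3.
  exact: (le_trans MM3 (le_trans MT Tx)).
exists l, (Num.sqrt (C * psi)), eta; split => //.
- rewrite (_ : 4%N = (2 * 2)%N)// exprM a2; set y := C * psi in ax *.
  have y0 : 0 < y by rewrite mulr_gt0.
  apply: (@le_trans _ _ (4 * y ^+ 2 * (3 * x) * (4 * pi) ^+ 2)).
    by rewrite ler_wpM2r ?sqr_ge0// ler_wpM2l// mulr_ge0 ?sqr_ge0.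
  (* Multiplication by M2, which is at most x, completes the square of y x, bounded by [ax]. *)
  rewrite -(ler_pM2r M20) mul1r.
  apply: (@le_trans _ _ (4 * y ^+ 2 * (3 * x) * (4 * pi) ^+ 2 * x)).
    rewrite ler_wpM2l ?(le_trans MM2 (le_trans MT Tx))//.
    by rewrite !mulr_ge0 ?sqr_ge0 ?ltW// mulr_gt0.
  rewrite (_ : _ * x = 12 * (y * x) ^+ 2 * (4 * pi) ^+ 2); last by ring.
  rewrite /M2 ler_wpM2r ?sqr_ge0// ler_wpM2l// (_ : r ^+ 4 = (r ^+ 2) ^+ 2); last by rewrite -exprM.
  by apply: lerXn2r; rewrite ?nnegrE ?sqr_ge0// ltW// mulr_gt0.
- by rewrite a2.
- by rewrite a2.
- split.
  + rewrite -/x /eta; set E := expR _; set a := `|_| in ar *.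
    have a0 : 0 <= a by exact: normr_ge0.
    have -> : x `^ (3 + nu1) = x ^+ 3 * x `^ nu1.
      by rewrite powRD ?powR_mulrn ?(ltW x0)//; apply/implyP => _; exact: lt0r_neq0.
    apply: (@le_trans _ _ (4 * pi * (r * Num.sqrt 2 * ((3 * x) ^+ 3 * (d1 * x `^ nu1 * E))))); last first.
      by rewrite /B le_eqVlt; apply/orP; left; apply/eqP; ring.
    have E0 : 0 <= d1 * x `^ nu1 * E by rewrite !mulr_ge0 ?powR_ge0 ?expR_ge0 ?ltW.
    rewrite ler_wpM2l ?mulr_ge0 ?(ltW pi0)//; apply: ler_pM => //.
    * by rewrite mulr_ge0 ?sqrtr_ge0.
    * by rewrite mulr_ge0// exprn_ge0.
    * by rewrite ler_wpM2r ?sqrtr_ge0.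
    * rewrite ler_wpM2r//; apply: lerXn2r; rewrite ?nnegrE// mulr_ge0// ltW//.
  + have N1 : 1 <= N%:R :> R by rewrite ler1n; move: hN; case: (N).
    have et0 : 0 <= eta by rewrite /eta !mulr_ge0 ?powR_ge0 ?expR_ge0 ?ltW.
    apply: (@le_trans _ _ (N%:R * eta)); first by rewrite ler_peMl.
    by rewrite (le_trans Neta)// ge_min lexx orbT.
  + by rewrite (le_trans Neta)// ge_min lexx.
Qed.

End Asymptotics.

Theorem theorem5 (R : realType) (d0 d1 nu0 beta delta s : R)
    (hd0 : 0 < d0) (hd1 : 0 < d1) (hbeta : 0 < beta) (hdelta : 0 < delta) (hs : 1 / 2 <= s) :
  exists K : R, 0 < K /\
    forall (nu1 : R) (haar : probability 'M[R]_3 R)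
           (D : forall l : nat, 'M[R]_3 -> 'M[R[i]]_((2 * l).+1))
           (feps : 'M[R]_3 -> R),
      is_haar haar ->
      is_rotational_harmonics D ->
      is_density haar SO3 feps ->
      super_smooth haar D feps nu0 nu1 d0 d1 delta beta ->
    forall (d : measure_display) (Om : measurableType d)
           (P : ('cV[R]_3 -> R) -> probability Om R)
           (eps : nat -> Om -> 'M[R]_3) (X : nat -> Om -> 'cV[R]_3),
      deconvolution_model P eps X haar feps ->
    forall r C : R, 0 < r -> 0 < C -> C <= K * r ^+ 2 ->
      (1 <= limn_einf (fun N : nat =>
              minimax_risk P eps X s r (C * separation_rate s beta N) N))%E.
Proof.
exists (critical_constant delta beta s); split.
  by rewrite /critical_constant invr_gt0 mulr_gt0 ?powR_gt0// mulr_gt0.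
move=> nu1 haar D feps _ hD hfeps [_ [_ hF]] d Om P eps X model r C r0 C0 CK.
(* It suffices that for each e > 0 the risk is eventually at least 1 - e, so N eta need only be at
   most e for N large. *)
apply/lee_addgt0Pr => e e0; rewrite -leeBlDr// -EFinB; apply: limn_einf_ge.
have := critical_degree nu1 hd1 hdelta hbeta hs r0 C0 CK e0.
apply: filterS => N [l [a [eta [l0 ha hsob ha2 [heta eta1 hN]]]]].
apply: (@le_trans _ _ (1 - N%:R * eta)%:E); first by rewrite lee_fin lerD2l lerN2.
refine (@perturbation_risk R haar D feps hD hfeps d Om P eps X s r _ a eta l N model l0 ha hsob ha2 _ eta1).
apply: le_trans heta; rewrite ler_wpM2l ?mulr_ge0 ?pi_ge0//.
rewrite ler_wpM2l ?mulr_ge0 ?sqrtr_ge0// ler_wpM2l ?exprn_ge0//.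
by have [] := hF l l0.
Qed.
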